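(* Let $a>0$, $x>0$, $0<\theta,\psi<1$, let $k\geq 0$ be an even integer, and let $\nu\in\mathbb{C}$ with $\Re(\nu)>0$. Then \begin{align*} &\left(\frac{a^2x}{4}\right)^{\frac{\nu}{2}+k+1}\sum_{n=1}^{\infty} n^{\nu/2}K_{\nu}(a\sqrt{nx})\sum_{d\mid n}d^k\sin(2\pi d\theta)\cos\left(\frac{2\pi n\psi}{d}\right)\\ &=-\frac{(-1)^{k/2}a^{2k+2}k!}{2^{2k+4}(2\pi)^{k+1}}\Gamma(\nu)\bigl(\zeta(1+k,\theta)-\zeta(1+k,1-\theta)\bigr)x^{k+1}\\ &\quad+\frac{(-1)^{k/2}(2\pi)^{k+1}}{8}\Gamma(\nu+k+1)\sum_{m,n\geq 0}\left\{\frac{(n+\psi)^k}{\left(\frac{16\pi^2}{a^2}\frac{(n+\psi)(m+\theta)}{x}+1\right)^{\nu+k+1}}+\frac{(n+1-\psi)^k}{\left(\frac{16\pi^2}{a^2}\frac{(n+1-\psi)(m+\theta)}{x}+1\right)^{\nu+k+1}}\right.\\ &\qquad\left.-\frac{(n+1-\psi)^k}{\left(\frac{16\pi^2}{a^2}\frac{(n+1-\psi)(m+1-\theta)}{x}+1\right)^{\nu+k+1}}-\frac{(n+\psi)^k}{\left(\frac{16\pi^2}{a^2}\frac{(n+\psi)(m+1-\theta)}{x}+1\right)^{\nu+k+1}}\right\}. \end{align*}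
   Context: $K_\nu$ denotes the modified Bessel function of the second kind of order $\nu$. $\zeta(s,\alpha)=\sum_{n=0}^\infty (n+\alpha)^{-s}$ ($\Re s>1$) is the Hurwitz zeta function; when $k=0$ the expression $\zeta(1,\theta)-\zeta(1,1-\theta)$ is understood as $\lim_{s\to1}(\zeta(s,\theta)-\zeta(s,1-\theta))$. The double sum runs over all pairs of non-negative integers $m,n$. *)

(* Defs.v *)
From Stdlib Require Import Reals Arith.
From Coquelicot Require Export Coquelicot.
Open Scope R_scope.

Definition Cexp (z : C) : C :=
  (exp (Re z) * cos (Im z), exp (Re z) * sin (Im z)).

Definition Cpow_pos (r : R) (z : C) : C := Cexp (Cmult z (RtoC (ln r))).

Definition Ccosh (z : C) : C := Cmult (RtoC (/2)) (Cplus (Cexp z) (Cexp (Copp z))).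

Definition CGamma (s : C) : C :=
  RInt_gen (V := C_R_CompleteNormedModule)
    (fun t => Cmult (Cpow_pos t (Cminus s 1)) (RtoC (exp (- t))))
    (at_right 0) (Rbar_locally p_infty).

(* Modified Bessel function of the second kind, for z > 0 (DLMF 10.32.9):
   K_nu(z) = int_0^oo exp(-z cosh t) cosh(nu t) dt *)
Definition BesselK (nu : C) (z : R) : C :=
  RInt_gen (V := C_R_CompleteNormedModule)
    (fun t => Cmult (RtoC (exp (- z * cosh t))) (Ccosh (Cmult nu (RtoC t))))
    (at_point 0) (Rbar_locally p_infty).

Definition hurwitz_zeta (s alpha : R) : R :=
  Series (fun n => Rpower (INR n + alpha) (- s)).

(* zeta(1+k,theta) - zeta(1+k,1-theta); for k = 0 this is the limit s -> 1
   (taken from the right, i.e. within the half-plane of convergence of the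
   defining series; written as a limit of h -> 0 of the value at 1+|h|) *)
Definition zeta_diff (k : nat) (theta : R) : R :=
  if (k =? 0)%nat then
    real (Lim (fun h => hurwitz_zeta (1 + Rabs h) theta
                       - hurwitz_zeta (1 + Rabs h) (1 - theta)) 0)
  else hurwitz_zeta (1 + INR k) theta - hurwitz_zeta (1 + INR k) (1 - theta).

Definition divisor_sum (n : nat) (f : nat -> R) : R :=
  sum_n (fun d => if andb (0 <? d)%nat (n mod d =? 0)%nat then f d else 0) n.

(* Unordered sum over N x N of an absolutely summable family:
   absolute summability plus convergence of the square partial sums. *)
Definition is_double_sum (T : nat -> nat -> C) (D : C) : Prop :=
  (exists M : R, forall N : nat,
      sum_n (fun m => sum_n (fun n => Cmod (T m n)) N) N <= M) /\
  filterlim (fun N => sum_n (fun m => sum_n (fun n => T m n) N) N)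
    eventually (locally D).

(* Main.v *)
(** Put t = e^s in the integral representations of Gamma and K_nu: with
    A = a^2 x / 4, the n-th Bessel term is a multiple of the integral over R of
    e^(nu s) exp (- e^s - A n e^(-s)).  Hence both sides are integrals of
    e^(nu s) exp (- e^s) against, respectively, the Lambert-type sum
      S(y) = sum_(d,e >= 1) d^k sin (2 pi d theta) cos (2 pi e psi) e^(-y d e)
    at y = A e^(-s), and a lattice sum R(w) of terms u^k e^(-w u v) at w = 4 pi^2 / y,
    with u in the cosets psi, 1 - psi and v in the cosets theta, 1 - theta.
    They agree because of the transformation formula
      S(y) = (-1)^(k/2) ((w / 2 pi)^(k+1) R(w) / 4 - k! Z / (2 (2 pi)^(k+1))),
    Z being the difference of zeta values.  It follows from two Poisson summations:
    over u, for the even function u^k sum_m sgn(m + theta) e^(-w |m + theta| u), and,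
    to recognise the resulting Fourier coefficients, over d.  Only partial sums are
    integrated: their difference is at most eps_N times an integrable weight,
    with eps_N -> 0. *)

Require Import Defs.
From Stdlib Require Import Reals Arith Lra Lia Psatz FunctionalExtensionality.
From Coquelicot Require Import Coquelicot.
Open Scope R_scope.

(** * The sawtooth kernel *)

(* Equations produced by sum_n and RInt are typed in Coquelicot's carriers, which
   ring does not recognise as R. *)
Ltac ring_R := match goal with |- ?a = ?b => change (@eq R a b) end; ring.

Ltac continuous_derive := match goal with |- continuous ?f ?x =>
  apply (ex_derive_continuous f); unfold cosh, Rpower; auto_derive; trivial end.

Local Notation RV := R_CompleteNormedModule.

(** Improper Riemann integrals do not commute with infinite sums for free, and at k = 0 the sum
    defining Z and the sums over m giving the Fourier coefficients converge only conditionally. So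
    each m + theta is paired with m + 1 - theta, and limits are reached with explicit rates. The
    Lambert side is cut at d e <= N + 1, as the Bessel series demands, the lattice side on a square;
    both cuts cost a factor eps_N independent of s. The weight beside it is y^(-(k+3)) + w^(-d): the
    first part grows like a power of e^s and is absorbed by exp (- e^s), the second grows as s tends
    to minus infinity and is absorbed by e^(nu s) once d < Re nu. Evenness of k enters twice. It
    makes the function summed over u even, so that the cosets psi and 1 - psi fold onto a half line;
    and it lets k! / (b - i om)^(k+1) keep its form, up to sign and an exchange of real and
    imaginary parts, when b and om are swapped. Hence the cosine transform in u of one exponential
    is a sine transform in d with decay rate and frequency exchanged, which the second summation
    recognises. *)

Definition freq (n : nat) : R := 2 * PI * INR (S n).

(** On (0, 1) the sine sum tends to [/ 2 - t], so this is the error of a partial sum with N + 1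
    terms. Its end values -1/2 at 0 and 1/2 at 1 do not shrink with N; they are the source of the
    trapezoid means below. *)
Definition sawtooth_err (N : nat) (t : R) : R :=
  t - / 2 + sum_n (fun n => 2 / freq n * sin (freq n * t)) N.

Definition dirichlet (N : nat) (t : R) : R :=
  1 + 2 * sum_n (fun n => cos (freq n * t)) N.

Lemma sum_Sn_R (a : nat -> R) (N : nat) : sum_n a (S N) = sum_n a N + a (S N) :> R.
Proof. exact (sum_Sn a N). Qed.

Lemma sum_O_R (a : nat -> R) : sum_n a 0 = a 0%nat :> R.
Proof. exact (sum_O a). Qed.

Lemma sum_n_mult_l_R (a : R) (u : nat -> R) (n : nat) :
  sum_n (fun k => a * u k) n = a * sum_n u n :> R.
Proof. exact (sum_n_mult_l (K := R_AbsRing) a u n). Qed.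

Lemma continuous_Rmult (f g : R -> R) (x : R) :
  continuous f x -> continuous g x -> continuous (fun x => f x * g x) x.
Proof. exact (continuous_mult (K := R_AbsRing) f g x). Qed.

Lemma continuous_Rplus (f g : R -> R) (x : R) :
  continuous f x -> continuous g x -> continuous (fun x => f x + g x) x.
Proof. exact (continuous_plus (V := R_NormedModule) f g x). Qed.

Lemma continuous_sum_n (h : nat -> R -> R) (N : nat) (s : R) :
  (forall n, continuous (h n) s) -> continuous (fun s => sum_n (fun n => h n s) N) s.
Proof.
  intro H. induction N as [|N IH].
  - eapply continuous_ext; [|apply (H 0%nat)]. intro; now rewrite sum_O_R.
  - eapply continuous_ext; [|apply continuous_Rplus; [apply IH|apply (H (S N))]]. intro; now rewrite sum_Sn_R.
Qed.

Lemma is_lim_seq_sum_n (u : nat -> nat -> R) (l : nat -> R) (N : nat) :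
  (forall n, is_lim_seq (u n) (l n)) -> is_lim_seq (fun J => sum_n (fun n => u n J) N) (sum_n l N).
Proof.
  intro H. induction N as [|N IH].
  - rewrite sum_O_R. eapply is_lim_seq_ext; [|apply (H 0%nat)]. intro; now rewrite sum_O_R.
  - rewrite sum_Sn_R. eapply is_lim_seq_ext; [|apply is_lim_seq_plus'; [apply IH|apply (H (S N))]].
    intro; now rewrite sum_Sn_R.
Qed.

Lemma is_RInt_sum_n (f : nat -> R -> R) (l : nat -> R) (a b : R) (N : nat) :
  (forall n, is_RInt (f n) a b (l n)) -> is_RInt (fun x => sum_n (fun n => f n x) N) a b (sum_n l N).
Proof.
  intro H. induction N as [|N IH].
  - rewrite sum_O_R. eapply is_RInt_ext; [|apply (H 0%nat)]. intros; now rewrite sum_O_R.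
  - rewrite sum_Sn_R. eapply is_RInt_ext; [|apply (is_RInt_plus (V := R_NormedModule)); [apply IH|apply (H (S N))]].
    intros; now rewrite sum_Sn_R.
Qed.

Lemma is_lim_seq_inv_S : is_lim_seq (fun N => / INR (S N)) 0.
Proof.
  apply (is_lim_seq_incr_1 (fun n => / INR n)).
  replace (Finite 0) with (Rbar_inv p_infty) by reflexivity.
  apply is_lim_seq_inv; [apply is_lim_seq_INR|discriminate].
Qed.

Lemma freq_pos (n : nat) : 0 < freq n.
Proof.
  unfold freq; apply Rmult_lt_0_compat; [generalize PI_RGT_0; lra|].
  apply lt_0_INR; lia.
Qed.

Lemma is_derive_sawtooth_err (N : nat) (t : R) :
  is_derive (sawtooth_err N) t (dirichlet N t).
Proof.
  assert (H : forall n, is_derive (fun t => 2 / freq n * sin (freq n * t)) t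
    (2 * cos (freq n * t))).
  { intro n; auto_derive; trivial. field. apply Rgt_not_eq, freq_pos. }
  unfold sawtooth_err, dirichlet.
  apply (is_derive_plus (fun t => t - / 2) _ t 1).
  - auto_derive; trivial; ring.
  - induction N as [|N IH].
    + apply (is_derive_ext (fun t => 2 / freq 0 * sin (freq 0 * t))).
      { intro; now rewrite sum_O_R. }
      rewrite sum_O_R; apply H.
    + apply (is_derive_ext (fun t => sum_n (fun n => 2 / freq n * sin (freq n * t)) N
                + 2 / freq (S N) * sin (freq (S N) * t))).
      { intro; now rewrite sum_Sn_R. }
      rewrite sum_Sn_R, Rmult_plus_distr_l.
      apply (is_derive_plus (V := R_NormedModule)); [exact IH | apply H].
Qed.

(** Telescoping of [2 cos a sin b]. The multiplier is 2N + 3 because [dirichlet N] has N + 1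
    cosines. *)
Lemma dirichlet_sin (N : nat) (t : R) :
  dirichlet N t * sin (PI * t) = sin ((2 * INR N + 3) * (PI * t)).
Proof.
  unfold dirichlet, freq.
  induction N as [|N IH].
  - rewrite sum_O_R; simpl INR.
    replace ((2 * 0 + 3) * (PI * t)) with (2 * PI * 1 * t + PI * t) by ring.
    rewrite sin_plus.
    replace (2 * PI * 1 * t) with (2 * (PI * t)) by ring.
    rewrite sin_2a, cos_2a_sin. generalize (sin2_cos2 (PI * t)); unfold Rsqr.
    intro E.
    transitivity (sin (PI * t) * (3 - 4 * (sin (PI * t) * sin (PI * t)))); [ring|].
    replace (2 * sin (PI * t) * cos (PI * t) * cos (PI * t)) with
      (2 * sin (PI * t) * (1 - sin (PI * t) * sin (PI * t))).
    + ring.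
    + rewrite <- E at 1. ring.
  - rewrite sum_Sn_R.
    replace ((1 + 2 * (sum_n (fun n : nat => cos (2 * PI * INR (S n) * t)) N
      + cos (2 * PI * INR (S (S N)) * t))) * sin (PI * t))
    with ((1 + 2 * sum_n (fun n : nat => cos (2 * PI * INR (S n) * t)) N) * sin (PI * t)
      + 2 * cos (2 * PI * INR (S (S N)) * t) * sin (PI * t)) by ring.
    rewrite IH.
    replace ((2 * INR N + 3) * (PI * t)) with (2 * PI * INR (S (S N)) * t - PI * t)
      by (rewrite !S_INR; ring).
    replace ((2 * INR (S N) + 3) * (PI * t)) with (2 * PI * INR (S (S N)) * t + PI * t)
      by (rewrite !S_INR; ring).
    rewrite sin_plus, sin_minus; ring.
Qed.

Lemma sin_freq_int (n j : nat) (t : R) : sin (freq n * (t + INR j)) = sin (freq n * t).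
Proof.
  unfold freq.
  replace (2 * PI * INR (S n) * (t + INR j))
    with (2 * PI * INR (S n) * t + 2 * INR (S n * j) * PI) by (rewrite mult_INR; ring).
  apply sin_period.
Qed.

Lemma cos_freq_int (n j : nat) (t : R) : cos (freq n * (t + INR j)) = cos (freq n * t).
Proof.
  unfold freq.
  replace (2 * PI * INR (S n) * (t + INR j))
    with (2 * PI * INR (S n) * t + 2 * INR (S n * j) * PI) by (rewrite mult_INR; ring).
  apply cos_period.
Qed.

Lemma dirichlet_period (N j : nat) (t : R) : dirichlet N (t + INR j) = dirichlet N t.
Proof.
  unfold dirichlet. f_equal; f_equal. apply sum_n_ext; intro n; apply cos_freq_int.
Qed.

Lemma continuous_dirichlet (N : nat) (t : R) : continuous (dirichlet N) t.
Proof.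
  apply (continuous_plus (fun _ => 1)); [apply continuous_const|].
  apply (continuous_scal_r 2 (fun t => sum_n (fun n => cos (freq n * t)) N)).
  apply (continuous_sum_n (fun n t => cos (freq n * t))). intro n.
  continuous_derive.
Qed.

Lemma sawtooth_err_refl (N : nat) (t : R) : sawtooth_err N (1 - t) = - sawtooth_err N t.
Proof.
  assert (H : sum_n (fun n => 2 / freq n * sin (freq n * (1 - t))) N
     = - sum_n (fun n => 2 / freq n * sin (freq n * t)) N :> R).
  { assert (E : forall n, 2 / freq n * sin (freq n * (1 - t)) = - (2 / freq n * sin (freq n * t))).
    { intro n. generalize (sin_freq_int n 1 (- t)); simpl (INR 1).
      replace (- t + 1) with (1 - t) by ring. intros ->.
      replace (freq n * - t) with (- (freq n * t)) by ring. rewrite sin_neg; ring. }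
    induction N as [|N IH]; [rewrite !sum_O_R|rewrite !sum_Sn_R, IH]; rewrite E; ring. }
  unfold sawtooth_err; rewrite H; field.
Qed.

Lemma sawtooth_err_0 (N : nat) : sawtooth_err N 0 = - / 2.
Proof.
  unfold sawtooth_err.
  assert (H : sum_n (fun n => 2 / freq n * sin (freq n * 0)) N = 0 :> R).
  { induction N as [|N IH]; [rewrite sum_O_R|rewrite sum_Sn_R, IH];
    rewrite Rmult_0_r, sin_0; ring. }
  rewrite H; ring.
Qed.

Lemma sawtooth_err_1 (N : nat) : sawtooth_err N 1 = / 2.
Proof.
  generalize (sawtooth_err_refl N 0). rewrite sawtooth_err_0, Rminus_0_r. lra.
Qed.

Lemma sawtooth_err_half (N : nat) : sawtooth_err N (/ 2) = 0.
Proof.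
  generalize (sawtooth_err_refl N (/2)). replace (1 - /2) with (/2) by field. lra.
Qed.

Lemma Rabs_sin_le (x : R) : 0 <= x -> Rabs (sin x) <= x.
Proof.
  intro H. apply Rabs_le; split.
  - destruct (Rle_dec x PI) as [H3|H3].
    + generalize (sin_ge_0 x H H3); lra.
    + generalize (SIN_bound x) PI2_3_2; unfold PI2; lra.
  - destruct H as [H | <-]; [left; now apply sin_lt_x | rewrite sin_0; lra].
Qed.

(** For t of order 1/N no cancellation between the sines is needed: each term is at most 2t because
    |sin x| <= x. *)
Lemma sawtooth_err_near (N : nat) (t : R) : 0 <= t <= / 2 ->
  Rabs (sawtooth_err N t) <= / 2 + 2 * (INR N + 1) * t.
Proof.
  intro Ht. unfold sawtooth_err.
  assert (H : Rabs (sum_n (fun n => 2 / freq n * sin (freq n * t)) N) <= 2 * (INR N + 1) * t).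
  { assert (E : forall n, Rabs (2 / freq n * sin (freq n * t)) <= 2 * t).
    { intro n. generalize (freq_pos n); intro Hf.
      rewrite Rabs_mult, (Rabs_pos_eq (2 / freq n))
        by (apply Rlt_le, Rdiv_lt_0_compat; lra).
      replace (2 * t) with (2 / freq n * (freq n * t)) by (field; lra).
      apply Rmult_le_compat_l; [apply Rlt_le, Rdiv_lt_0_compat; lra|].
      apply Rabs_sin_le. nra. }
    induction N as [|N IH].
    - rewrite sum_O_R; simpl INR. generalize (E 0%nat); lra.
    - rewrite sum_Sn_R, S_INR. eapply Rle_trans; [apply Rabs_triang|].
      generalize (E (S N)); lra. }
  eapply Rle_trans; [apply Rabs_triang|].
  assert (Rabs (t - / 2) <= / 2) by (apply Rabs_le; lra). lra.
Qed.

Lemma sin_PI_pos (t : R) : 0 < t <= / 2 -> 0 < sin (PI * t).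
Proof.
  intro Ht. generalize PI_RGT_0; intro. apply sin_gt_0; nra.
Qed.

(* Integration by parts of sin (M pi s) / sin (pi s) on [t, 1/2], with M = 2N+3. *)
Lemma sawtooth_err_far_sin (N : nat) (t : R) : 0 < t <= / 2 ->
  Rabs (sawtooth_err N t) <= 2 / ((2 * INR N + 3) * PI * sin (PI * t)).
Proof.
  intro Ht. generalize PI_RGT_0; intro HPI. generalize (pos_INR N); intro HN.
  set (M := 2 * INR N + 3). assert (HM : 0 < M) by (unfold M; lra).
  assert (Hpos : forall u, 0 < u -> 0 < M * PI * u).
  { intros u Hu. apply Rmult_lt_0_compat; trivial. now apply Rmult_lt_0_compat. }
  (* [Phi] is the boundary term of the integration by parts and [B] an antiderivative of the
     absolute bound on the integrand that remains. [Phi] vanishes at 1/2 because M is an odd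
     integer. *)
  set (Phi := fun t => - cos (M * (PI * t)) / (M * PI * sin (PI * t))).
  set (B := fun t => - / (M * PI * sin (PI * t))).
  assert (Phalf : Phi (/ 2) = 0).
  { unfold Phi.
    replace (M * (PI * / 2)) with (PI / 2 + (INR (S N)) * PI)
      by (unfold M; rewrite S_INR; field).
    rewrite cos_plus, cos_PI2, sin_PI2.
    replace (sin (INR (S N) * PI)) with 0; [rewrite Rmult_0_l; unfold Rdiv; ring|].
    symmetry. clear. induction (S N) as [|n IH].
    - simpl; rewrite Rmult_0_l; apply sin_0.
    - rewrite S_INR. replace ((INR n + 1) * PI) with (INR n * PI + PI) by ring.
      rewrite neg_sin, IH; ring. }
  assert (HB : B (/2) = - / (M * PI)).
  { unfold B. replace (PI * / 2) with (PI / 2) by field.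
    rewrite sin_PI2, Rmult_1_r; reflexivity. }
  assert (Hd : forall s, 0 < s <= / 2 ->
    is_derive (fun s => sawtooth_err N s - Phi s) s
      (- (cos (M * (PI * s)) * cos (PI * s) / (M * sin (PI * s) ^ 2)))).
  { intros s Hs. generalize (sin_PI_pos s Hs); intro Hp.
    evar_last.
    apply (is_derive_minus (V := R_NormedModule)); [apply is_derive_sawtooth_err|].
    unfold Phi; auto_derive; [|reflexivity].
    repeat split; trivial. now apply Rgt_not_eq, Hpos.
    unfold minus, plus, opp; simpl.
    replace (dirichlet N s) with (sin (M * (PI * s)) / sin (PI * s)).
    - field. lra.
    - unfold M; rewrite <- dirichlet_sin. field; lra. }
  assert (HdB : forall s, 0 < s <= / 2 ->
    is_derive B s (cos (PI * s) / (M * sin (PI * s) ^ 2))).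
  { intros s Hs. generalize (sin_PI_pos s Hs); intro Hp.
    unfold B; auto_derive.
    - now apply Rgt_not_eq, Hpos.
    - field; lra. }
  (* A monotonicity argument in place of an integral estimate: the derivative of
     [sg * (err - Phi) + B] has the factor [1 - sg cos >= 0], and err and [Phi] both vanish at 1/2.
     The signs sg = 1 and sg = -1 give the two halves of the absolute value. *)
  assert (Hcmp : forall sg, Rabs sg <= 1 ->
     sg * (sawtooth_err N t - Phi t) + B t <= B (/ 2)).
  { intros sg Hsg.
    set (h := fun s => sg * (sawtooth_err N s - Phi s) + B s).
    assert (Hh : forall s, 0 < s <= / 2 -> is_derive h s
       ((1 - sg * cos (M * (PI * s))) * (cos (PI * s) / (M * sin (PI * s) ^ 2)))).
    { intros s Hs. generalize (sin_PI_pos s Hs); intro Hp. evar_last.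
      apply (is_derive_plus (V := R_NormedModule)).
      apply (is_derive_scal (fun s => sawtooth_err N s - Phi s) s sg), Hd, Hs.
      apply HdB, Hs.
      unfold plus; simpl. field; lra. }
    destruct (Rle_lt_or_eq_dec t (/2)) as [Hlt|Heq]; [lra| |].
    - destruct (MVT_gen h t (/2) (fun s => (1 - sg * cos (M * (PI * s))) * (cos (PI * s) / (M * sin (PI * s) ^ 2)))) as [s [Hs E]].
      + intros s. rewrite Rmin_left, Rmax_right by lra. intro; apply Hh; lra.
      + intros s. rewrite Rmin_left, Rmax_right by lra. intro.
        apply continuity_pt_filterlim. apply (ex_derive_continuous h).
        eexists; apply Hh; lra.
      + rewrite Rmin_left, Rmax_right in Hs by lra.
        assert (Hp : 0 <= h (/2) - h t).
        { rewrite E. apply Rmult_le_pos; [|lra].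
          apply Rmult_le_pos.
          - assert (Rabs (sg * cos (M * (PI * s))) <= 1).
            { rewrite Rabs_mult. replace 1 with (1 * 1) by ring.
              apply Rmult_le_compat; try apply Rabs_pos; trivial.
              apply Rabs_le, COS_bound. }
            apply Rabs_le_between in H; lra.
          - apply Rmult_le_pos. apply cos_ge_0; nra.
            apply Rlt_le, Rinv_0_lt_compat, Rmult_lt_0_compat; trivial.
            apply pow_lt, sin_PI_pos; lra. }
        unfold h in Hp. rewrite Phalf, sawtooth_err_half in Hp. lra.
    - rewrite Heq, Phalf, sawtooth_err_half. lra. }
  assert (Hs := sin_PI_pos t Ht).
  assert (HX : 0 < / (M * PI * sin (PI * t))).
  { now apply Rinv_0_lt_compat, Hpos. }
  assert (HY : 0 < / (M * PI)).
  { now apply Rinv_0_lt_compat, Rmult_lt_0_compat. }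
  assert (HPhi : Rabs (Phi t) <= / (M * PI * sin (PI * t))).
  { unfold Phi, Rdiv. rewrite Rabs_mult, Rabs_Ropp, (Rabs_pos_eq (/ _)) by lra.
    rewrite <- (Rmult_1_l (/ _)) at 2. apply Rmult_le_compat_r; [lra|].
    apply Rabs_le, COS_bound. }
  generalize (Hcmp 1) (Hcmp (-1)). rewrite HB. unfold B, Rdiv.
  rewrite Rabs_R1, Rabs_m1. intros H1 H2.
  specialize (H1 (Rle_refl 1)). specialize (H2 (Rle_refl 1)).
  apply Rabs_le_between in HPhi. apply Rabs_le. lra.
Qed.

Lemma sin_PI_ge (t : R) : 0 <= t <= / 2 -> 2 * t <= PI * sin (PI * t).
Proof.
  intro Ht. generalize PI_RGT_0 PI2_3_2; unfold PI2; intros HPI H32.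
  assert (H := PI_4).
  assert (Hx : 0 <= PI * t <= 2) by nra.
  assert (L : PI * t - (PI * t) ^ 3 / 6 <= sin (PI * t)).
  { destruct (sin_bound (PI * t) 0) as [H1 _]; try lra; try nra.
    unfold sin_approx in H1; simpl in H1; unfold sin_term in H1; simpl in H1. lra. }
  set (z := PI * t) in *.
  assert (z - z ^ 3 / 6 >= z / 3). { assert (z^2 <= 4) by nra. simpl in *. nra. }
  assert (2 * t <= 3 * (z / 3)). { unfold z; nra. }
  nra.
Qed.

(** With M = 2N + 3, the near bound serves for M t <= 1 and the far bound, at most 1 / (M t),
    beyond. The constant 3 is (1/2 + 1)(1 + 1), the worst case of the near bound at M t = 1. *)
Lemma sawtooth_err_half_bound (N : nat) (t : R) : 0 <= t <= / 2 ->
  Rabs (sawtooth_err N t) <= 3 / (1 + (2 * INR N + 3) * t).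
Proof.
  intro Ht. generalize (pos_INR N); intro HN.
  set (M := 2 * INR N + 3). assert (HM : 0 < M) by (unfold M; lra).
  assert (HMt : 0 <= M * t) by nra.
  destruct (Rle_dec (M * t) 1) as [H|H].
  - eapply Rle_trans; [apply sawtooth_err_near, Ht|].
    apply Rle_div_r; [lra|].
    assert (2 * (INR N + 1) * t <= M * t) by (unfold M; nra). nra.
  - assert (Ht0 : 0 < t).
    { destruct (Rle_lt_or_eq_dec 0 t) as [|E]; try lra. rewrite <- E in H; lra. }
    eapply Rle_trans; [apply sawtooth_err_far_sin; lra|].
    fold M. generalize (sin_PI_ge t Ht); intro Hs.
    apply Rle_trans with (/ (M * t)).
    + replace (2 / (M * PI * sin (PI * t))) with (/ (M * (PI * sin (PI * t)) / 2)).
      * apply Rinv_le_contravar; nra.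
      * generalize (sin_PI_pos t) PI_RGT_0; intros; field; split; [|split]; lra.
    + apply Rle_div_r; [lra|]. apply (Rmult_le_reg_l (M * t)); [lra|].
      rewrite <- Rmult_assoc, Rinv_r by lra. lra.
Qed.

Lemma sawtooth_err_bound (N : nat) (t : R) : 0 <= t <= 1 ->
  Rabs (sawtooth_err N t) <=
    3 / (1 + (2 * INR N + 3) * t) + 3 / (1 + (2 * INR N + 3) * (1 - t)).
Proof.
  intro Ht. generalize (pos_INR N); intro HN.
  assert (H : forall u, 0 <= u -> 0 < 3 / (1 + (2 * INR N + 3) * u)).
  { intros u Hu. apply Rdiv_lt_0_compat; nra. }
  generalize (H t) (H (1 - t)); intros H1 H2.
  destruct (Rle_dec t (/2)).
  - generalize (sawtooth_err_half_bound N t); lra.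
  - generalize (sawtooth_err_half_bound N (1 - t)).
    rewrite sawtooth_err_refl, Rabs_Ropp. lra.
Qed.

(** The integral over [0, 1] of the majorant of [sawtooth_err], of order ln N / N. The error is not
    uniformly small, being 1/2 in absolute value at the end points, but it is small in L^1, and that
    suffices. *)
Definition saw_eps (N : nat) : R := 6 / (2 * INR N + 3) * ln (2 * INR N + 4).

Lemma saw_bound_RInt (N : nat) :
  is_RInt (fun t => 3 / (1 + (2 * INR N + 3) * t) + 3 / (1 + (2 * INR N + 3) * (1 - t)))
    0 1 (saw_eps N).
Proof.
  generalize (pos_INR N); intro HN. set (M := 2 * INR N + 3).
  assert (HM : 0 < M) by (unfold M; lra).
  set (P := fun t => 3 / M * (ln (1 + M * t) - ln (1 + M * (1 - t)))).
  replace (saw_eps N) with (minus (P 1) (P 0)).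
  - apply (is_RInt_derive P).
    + intros x; rewrite Rmin_left, Rmax_right by lra; intro Hx. unfold P.
      auto_derive. repeat split; nra. field. repeat split; nra.
    + intros x; rewrite Rmin_left, Rmax_right by lra; intro Hx.
      apply (ex_derive_continuous (fun t => 3 / (1 + M * t) + 3 / (1 + M * (1 - t)))).
      auto_derive. repeat split; nra.
  - unfold minus, plus, opp, P, saw_eps; simpl.
    replace (1 + M * (1 - 1)) with 1 by ring. replace (1 + M * 0) with 1 by ring.
    rewrite Rminus_0_r, !Rmult_1_r, ln_1. unfold M.
    replace (1 + (2 * INR N + 3)) with (2 * INR N + 4) by ring. field. lra.
Qed.

Lemma saw_eps_lim : is_lim_seq saw_eps 0.
Proof.
  assert (H := is_lim_div_ln_p).
  assert (H2 : is_lim_seq (fun N => 2 * INR N + 4) p_infty).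
  { replace p_infty with (Rbar_plus p_infty 4) by reflexivity.
    apply (is_lim_seq_plus _ _ p_infty 4); [|apply is_lim_seq_const|reflexivity].
    replace p_infty with (Rbar_mult 2 p_infty).
    apply is_lim_seq_scal_l, is_lim_seq_INR.
    simpl. destruct (Rle_dec 0 2) as [h|h]; [|exfalso; lra].
    destruct (Rle_lt_or_eq_dec 0 2 h); trivial; exfalso; lra. }
  assert (H3 : is_lim_seq (fun N => 12 * (ln (2 * INR N + 4) / (2 * INR N + 4))) 0).
  { replace (Finite 0) with (Rbar_mult 12 0) by (simpl; f_equal; ring).
    apply is_lim_seq_scal_l.
    apply (is_lim_comp_seq (fun y => ln y / y) _ p_infty 0 H); trivial.
    exists 0%nat; intros; discriminate. }
  apply (is_lim_seq_le_le (fun _ => 0) _ (fun N => 12 * (ln (2 * INR N + 4) / (2 * INR N + 4))));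
    trivial; [|apply is_lim_seq_const].
  intro N. unfold saw_eps. generalize (pos_INR N); intro HN.
  assert (0 < ln (2 * INR N + 4)) by (rewrite <- ln_1; apply ln_increasing; lra).
  split.
  - apply Rmult_le_pos; [|lra]. apply Rlt_le, Rdiv_lt_0_compat; lra.
  - set (l := ln (2 * INR N + 4)) in *.
    replace (6 / (2 * INR N + 3) * l) with (6 * l * / (2 * INR N + 3)) by (field; lra).
    replace (12 * (l / (2 * INR N + 4))) with (6 * l * / (INR N + 2)) by (field; lra).
    apply Rmult_le_compat_l; [lra|]. apply Rinv_le_contravar; lra.
Qed.

(** * Poisson summation on the half line *)

Lemma ex_RInt_cont (f : R -> R) (a b : R) : a <= b ->
  (forall x, a <= x <= b -> continuous f x) -> ex_RInt f a b.
Proof.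
  intros Hab H. apply (ex_RInt_continuous (V := RV)).
  intro x; rewrite Rmin_left, Rmax_right by trivial. apply H.
Qed.

Lemma exp_nondecreasing (x y : R) : x <= y -> exp x <= exp y.
Proof. intros [H | <-]; [now apply Rlt_le, exp_increasing | apply Rle_refl]. Qed.

Lemma exp_INR (c : R) (n : nat) : exp (- c * INR n) = exp (- c) ^ n.
Proof.
  induction n as [|n IH]; [simpl; rewrite Rmult_0_r; apply exp_0|].
  rewrite S_INR. simpl. rewrite <- IH, <- exp_plus. f_equal; ring.
Qed.

Section Poisson.

Variables (F F' : R -> R) (K c : R).
Hypothesis Hc : 0 < c.
Hypothesis HF : forall x, 0 <= x -> is_derive F x (F' x).
Hypothesis HF'c : forall x, 0 <= x -> continuous F' x.
Hypothesis HFb : forall x, 0 <= x -> Rabs (F x) <= K * exp (- c * x).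
Hypothesis HF'b : forall x, 0 <= x -> Rabs (F' x) <= K * exp (- c * x).

Lemma bound_nonneg : 0 <= K.
Proof.
  generalize (HFb 0 (Rle_refl 0)) (Rabs_pos (F 0)). rewrite Rmult_0_r, exp_0. lra.
Qed.

Lemma continuous_F (x : R) : 0 <= x -> continuous F x.
Proof. intro Hx. apply (ex_derive_continuous F). eexists; now apply HF. Qed.

(** [F * dirichlet N] is integrated by parts with [sawtooth_err] as antiderivative of the kernel.
    The end values -1/2 and 1/2 turn the boundary term into the mean of F at j and j + 1; what
    remains is F' against the error, bounded through the value of the exponential majorant at j. *)
Lemma trapezoid_step (N j : nat) :
  Rabs ((F (INR j) + F (INR (S j))) / 2
    - RInt (fun x => F x * dirichlet N x) (INR j) (INR (S j)))
  <= K * exp (- c * INR j) * saw_eps N.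
Proof.
  assert (Hj := pos_INR j). assert (HSj : INR (S j) = INR j + 1) by apply S_INR.
  set (e := fun x => sawtooth_err N (x - INR j)).
  assert (He : forall x, is_derive e x (dirichlet N x)).
  { intro x. unfold e. evar_last.
    - apply (is_derive_comp (sawtooth_err N) (fun x => x - INR j)).
      + apply is_derive_sawtooth_err.
      + auto_derive; trivial.
    - unfold scal; simpl; unfold mult; simpl. rewrite Rmult_1_l, <- (dirichlet_period N j). f_equal; ring. }
  assert (Hec : forall x, continuous e x).
  { intro x; apply (ex_derive_continuous e); eexists; apply He. }
  assert (I1 : is_RInt (fun x => F' x * e x + F x * dirichlet N x) (INR j) (INR (S j))
     (F (INR (S j)) * e (INR (S j)) - F (INR j) * e (INR j))).
  { apply (is_RInt_derive (fun x => F x * e x)).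
    - intros x; rewrite Rmin_left, Rmax_right by lra; intro Hx.
      apply (is_derive_mult (K := R_AbsRing) F e x); [apply HF; lra|apply He|].
      intros; apply Rmult_comm.
    - intros x; rewrite Rmin_left, Rmax_right by lra; intro Hx.
      apply continuous_Rplus; apply continuous_Rmult; trivial.
      + apply HF'c; lra.
      + apply continuous_F; lra.
      + apply continuous_dirichlet. }
  assert (E2 : ex_RInt (fun x => F x * dirichlet N x) (INR j) (INR (S j))).
  { apply ex_RInt_cont; [lra|]. intros; apply continuous_Rmult.
    apply continuous_F; lra. apply continuous_dirichlet. }
  assert (I3 := is_RInt_minus _ _ _ _ _ _ I1 (RInt_correct _ _ _ E2)).
  unfold e in I3. rewrite HSj in I3.
  replace (INR j + 1 - INR j) with 1 in I3 by ring.
  replace (INR j - INR j) with 0 in I3 by ring.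
  rewrite sawtooth_err_0, sawtooth_err_1 in I3. rewrite HSj.
  assert (I4 : is_RInt (fun x => F' x * e x) (INR j) (INR j + 1)
     ((F (INR j) + F (INR j + 1)) / 2
    - RInt (fun x => F x * dirichlet N x) (INR j) (INR j + 1))).
  { eapply is_RInt_ext; [|evar_last; [apply I3|]].
    - intros x _. unfold minus, plus, opp; simpl. unfold e. ring.
    - unfold minus, plus, opp; simpl. field. }
  assert (I5 : is_RInt (fun x => K * exp (- c * INR j) *
      (3 / (1 + (2 * INR N + 3) * (x - INR j)) + 3 / (1 + (2 * INR N + 3) * (1 - (x - INR j)))))
      (INR j) (INR j + 1) (K * exp (- c * INR j) * saw_eps N)).
  { apply (is_RInt_scal (V := R_NormedModule)).
    assert (I6 : is_RInt (fun t => 3 / (1 + (2 * INR N + 3) * t) + 3 / (1 + (2 * INR N + 3) * (1 - t)))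
       (1 * INR j + - INR j) (1 * (INR j + 1) + - INR j) (saw_eps N)).
    { replace (1 * INR j + - INR j) with 0 by ring.
      replace (1 * (INR j + 1) + - INR j) with 1 by ring. apply saw_bound_RInt. }
    apply is_RInt_comp_lin in I6.
    eapply is_RInt_ext; [|apply I6]. intros x _. simpl. unfold scal; simpl; unfold mult; simpl. rewrite Rmult_1_l.
    replace (1 * x + - INR j) with (x - INR j) by ring. reflexivity. }
  refine (norm_RInt_le _ _ _ _ _ _ _ _ I4 I5); [lra|].
  intros x Hx. unfold norm; simpl; unfold abs; simpl. rewrite Rabs_mult.
  apply Rmult_le_compat; try apply Rabs_pos.
  - eapply Rle_trans; [apply HF'b; lra|].
    apply Rmult_le_compat_l; [apply bound_nonneg|]. apply exp_nondecreasing. nra.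
  - apply sawtooth_err_bound; lra.
Qed.

Lemma trapezoid_sum (N J : nat) :
  Rabs (F 0 / 2 + sum_n (fun d => F (INR (S d))) J - F (INR (S J)) / 2
    - RInt (fun x => F x * dirichlet N x) 0 (INR (S J)))
  <= K * saw_eps N * sum_n (fun j => exp (- c) ^ j) J.
Proof.
  induction J as [|J IH].
  - rewrite !sum_O_R. generalize (trapezoid_step N 0).
    rewrite exp_INR. simpl pow. replace (INR 0) with 0 by reflexivity. intro H.
    replace (F 0 / 2 + F (INR 1) - F (INR 1) / 2) with ((F 0 + F (INR 1)) / 2) by field.
    lra.
  - rewrite !sum_Sn_R. generalize (trapezoid_step N (S J)). rewrite exp_INR. intro H.
    rewrite <- (RInt_Chasles (V := RV) _ 0 (INR (S J)) (INR (S (S J)))).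
    + change plus with Rplus.
      match goal with |- Rabs ?e <= _ => replace e with
       ((F 0 / 2 + sum_n (fun d => F (INR (S d))) J - F (INR (S J)) / 2
    - RInt (fun x => F x * dirichlet N x) 0 (INR (S J))) +
       ((F (INR (S J)) + F (INR (S (S J)))) / 2
    - RInt (fun x => F x * dirichlet N x) (INR (S J)) (INR (S (S J))))) end.
      * eapply Rle_trans; [apply Rabs_triang|]. lra.
      * field.
    + apply ex_RInt_cont; [apply pos_INR|]. intros; apply continuous_Rmult.
      apply continuous_F; lra. apply continuous_dirichlet.
    + generalize (pos_INR (S J)); intro.
      apply ex_RInt_cont; [rewrite (S_INR (S J)); lra|]. intros; apply continuous_Rmult.
      apply continuous_F; lra. apply continuous_dirichlet.
Qed.

Lemma RInt_dirichlet (N : nat) (b : R) : 0 <= b ->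
  RInt (fun x => F x * dirichlet N x) 0 b
  = RInt F 0 b + 2 * sum_n (fun n => RInt (fun x => F x * cos (freq n * x)) 0 b) N.
Proof.
  intro Hb. apply (is_RInt_unique (V := RV)).
  assert (E : forall n, ex_RInt (fun x => F x * cos (freq n * x)) 0 b).
  { intro n. apply ex_RInt_cont; trivial. intros x Hx. apply continuous_Rmult.
    apply continuous_F; lra.
    continuous_derive. }
  assert (E0 : ex_RInt F 0 b).
  { apply ex_RInt_cont; trivial. intros; apply continuous_F; lra. }
  apply (is_RInt_ext (fun x => F x + 2 * sum_n (fun n => F x * cos (freq n * x)) N)).
  { intros x _. unfold dirichlet. rewrite sum_n_mult_l_R. ring_R. }
  apply (is_RInt_plus (V := R_NormedModule)); [now apply (RInt_correct (V := RV))|].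
  apply (is_RInt_scal (V := R_NormedModule) _ 0 b 2).
  apply (is_RInt_sum_n (fun n x => F x * cos (freq n * x))).
  intro n. apply (RInt_correct (V := RV)), E.
Qed.

Lemma decay_lim : is_lim_seq (fun J => F (INR (S J))) 0.
Proof.
  assert (H : is_lim_seq (fun J => K * exp (- c * INR (S J))) 0).
  { replace (Finite 0) with (Rbar_mult K 0) by (simpl; f_equal; ring).
    apply is_lim_seq_scal_l.
    apply (is_lim_seq_incr_1 (fun J => exp (- c * INR J))).
    apply (is_lim_seq_ext (fun n => exp (- c) ^ n)); [intro; symmetry; apply exp_INR|].
    apply is_lim_seq_geom. rewrite Rabs_pos_eq by (apply Rlt_le, exp_pos).
    rewrite <- exp_0. apply exp_increasing; lra. }
  apply is_lim_seq_abs_0.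
  apply (is_lim_seq_le_le (fun _ => 0) _ (fun J => K * exp (- c * INR (S J)))); trivial.
  - intro J; split; [apply Rabs_pos|apply HFb, pos_INR].
  - apply is_lim_seq_const.
Qed.

Lemma geom_le (J : nat) : sum_n (fun j => exp (- c) ^ j) J <= / (1 - exp (- c)).
Proof.
  assert (Hq : 0 < exp (- c) < 1).
  { split; [apply exp_pos|]. rewrite <- exp_0; apply exp_increasing; lra. }
  rewrite sum_n_Reals, tech3 by lra. unfold Rdiv.
  rewrite <- (Rmult_1_l (/ (1 - exp (- c)))) at 2.
  apply Rmult_le_compat_r; [apply Rlt_le, Rinv_0_lt_compat; lra|].
  generalize (pow_lt (exp (- c)) (S J)); lra.
Qed.

(* Integrating by parts, the error of the N-th partial sum is the integral of F' against
   the L^1-small kernel sawtooth_err N, so no C^2 hypothesis is needed. *)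
Lemma poisson_half_line (I0 : R) (I : nat -> R) (S0 : R) :
  is_lim_seq (fun J => RInt F 0 (INR J)) I0 ->
  (forall n, is_lim_seq (fun J => RInt (fun x => F x * cos (freq n * x)) 0 (INR J)) (I n)) ->
  is_series (fun d => F (INR (S d))) S0 ->
  is_lim_seq (fun N => I0 + 2 * sum_n I N) (F 0 / 2 + S0).
Proof.
  intros HI0 HI HS.
  assert (Hq : 0 < exp (- c) < 1).
  { split; [apply exp_pos|]. rewrite <- exp_0; apply exp_increasing; lra. }
  set (C0 := K * / (1 - exp (- c))).
  assert (Heps : forall N, 0 <= saw_eps N).
  { intro N. unfold saw_eps. generalize (pos_INR N); intro HN.
    apply Rmult_le_pos; [apply Rlt_le, Rdiv_lt_0_compat; lra|].
    rewrite <- ln_1. apply ln_le; lra. }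
  assert (HK := bound_nonneg).
  (* N is fixed and J tends to infinity: the geometric sum in [trapezoid_sum] is bounded uniformly
     in J, so the estimate passes to the limit. *)
  assert (HN : forall N, Rabs (F 0 / 2 + S0 - (I0 + 2 * sum_n I N)) <= C0 * saw_eps N).
  { intro N.
    assert (L1 : is_lim_seq (fun J => RInt (fun x => F x * dirichlet N x) 0 (INR (S J)))
       (I0 + 2 * sum_n I N)).
    { apply (is_lim_seq_incr_1 (fun J => RInt (fun x => F x * dirichlet N x) 0 (INR J))).
      apply (is_lim_seq_ext (fun J => RInt F 0 (INR J) + 2 * sum_n (fun n => RInt (fun x => F x * cos (freq n * x)) 0 (INR J)) N)).
      { intro J; symmetry; apply RInt_dirichlet, pos_INR. }
      apply is_lim_seq_plus'; trivial.
      apply (is_lim_seq_scal_l _ 2 (Finite (sum_n I N))).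
      apply (is_lim_seq_sum_n (fun n J => RInt (fun x => F x * cos (freq n * x)) 0 (INR J))), HI. }
    assert (L2 : is_lim_seq (fun J => F 0 / 2 + sum_n (fun d => F (INR (S d))) J - F (INR (S J)) / 2)
        (F 0 / 2 + S0)).
    { replace (F 0 / 2 + S0) with (F 0 / 2 + S0 - 0 / 2) by field.
      apply is_lim_seq_minus'.
      - apply is_lim_seq_plus'; [apply is_lim_seq_const|exact HS].
      - apply is_lim_seq_ext with (fun J => / 2 * F (INR (S J))); [intro; field|].
        replace (0 / 2) with (/ 2 * 0) by field.
        apply (is_lim_seq_scal_l _ (/2) (Finite 0)), decay_lim. }
    assert (L3 := is_lim_seq_abs _ _ (is_lim_seq_minus' _ _ _ _ L2 L1)).
    refine (is_lim_seq_le _ (fun _ => C0 * saw_eps N) (Finite _) (Finite _) _ L3 (is_lim_seq_const _)).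
    intro J. eapply Rle_trans; [apply trapezoid_sum|].
    unfold C0. rewrite (Rmult_assoc K (/ _)), (Rmult_comm (/ _)), <- Rmult_assoc.
    apply Rmult_le_compat_l; [now apply Rmult_le_pos|apply geom_le]. }
  assert (L : is_lim_seq (fun N => F 0 / 2 + S0 - (I0 + 2 * sum_n I N)) 0).
  { apply is_lim_seq_abs_0.
    apply (is_lim_seq_le_le (fun _ => 0) _ (fun N => C0 * saw_eps N)).
    - intro N; split; [apply Rabs_pos|apply HN].
    - apply is_lim_seq_const.
    - replace (Finite 0) with (Rbar_mult C0 0) by (simpl; f_equal; ring).
      apply is_lim_seq_scal_l, saw_eps_lim. }
  apply (is_lim_seq_ext (fun N => (F 0 / 2 + S0) - (F 0 / 2 + S0 - (I0 + 2 * sum_n I N)))).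
  { intro; ring. }
  replace (Finite (F 0 / 2 + S0)) with (Finite (F 0 / 2 + S0 - 0)) by (f_equal; ring).
  apply is_lim_seq_minus'; [apply is_lim_seq_const|exact L].
Qed.

End Poisson.

(** * Laplace transforms of x^k cos and x^k sin *)

(** The inequality y <= e^y at y = x / k, raised to the power k. For k = 0 the constant is 0^0 =
    1. *)
Lemma pow_le_exp (k : nat) (x : R) : 0 <= x -> x ^ k <= INR k ^ k * exp x.
Proof.
  intro Hx. destruct k as [|k].
  - simpl. rewrite Rmult_1_l. generalize (exp_ineq1_le x); lra.
  - assert (Hk : 0 < INR (S k)) by (apply lt_0_INR; lia).
    set (y := x / INR (S k)).
    assert (Hy : 0 <= y) by (unfold y; apply Rmult_le_pos; [lra|]; apply Rlt_le, Rinv_0_lt_compat; lra).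
    replace x with (INR (S k) * y) at 1 by (unfold y; field; lra).
    rewrite Rpow_mult_distr. apply Rmult_le_compat_l; [apply pow_le; lra|].
    replace (exp x) with (exp y ^ S k).
    + apply pow_incr. split; trivial. generalize (exp_ineq1_le y); lra.
    + replace x with (- (- y) * INR (S k)) by (unfold y; field; lra).
      now rewrite exp_INR, Ropp_involutive.
Qed.

(** Half of the exponential rate b is spent on absorbing x^k: this is the constant of [pow_le_exp]
    at b x / 2. *)
Definition pow_exp_cst (k : nat) (b : R) : R := (2 * INR k / b) ^ k.

Lemma pow_exp_le (k : nat) (b x : R) : 0 < b -> 0 <= x ->
  x ^ k * exp (- b * x) <= pow_exp_cst k b * exp (- (b / 2) * x).
Proof.
  intros Hb Hx.
  assert (H := pow_le_exp k (b / 2 * x)).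
  replace (exp (- b * x)) with (exp (- (b / 2) * x) * exp (- (b / 2) * x))
    by (rewrite <- exp_plus; f_equal; field).
  rewrite <- Rmult_assoc. apply Rmult_le_compat_r; [apply Rlt_le, exp_pos|].
  unfold pow_exp_cst.
  replace (2 * INR k / b) with (2 / b * INR k) by (field; lra).
  rewrite Rpow_mult_distr.
  replace (x ^ k) with ((2 / b) ^ k * (b / 2 * x) ^ k).
  2: { rewrite <- Rpow_mult_distr. f_equal; field; lra. }
  rewrite Rmult_assoc. apply Rmult_le_compat_l.
  { apply pow_le. apply Rlt_le, Rdiv_lt_0_compat; lra. }
  apply (Rmult_le_reg_r (exp (b / 2 * x))); [apply exp_pos|].
  rewrite Rmult_assoc, <- exp_plus. replace (- (b / 2) * x + b / 2 * x) with 0 by ring.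
  rewrite exp_0, Rmult_1_r. apply H. apply Rmult_le_pos; lra.
Qed.

Lemma exp_INR_lim (b : R) : 0 < b -> is_lim_seq (fun J => exp (- b * INR J)) 0.
Proof.
  intro Hb. apply (is_lim_seq_ext (fun n => exp (- b) ^ n)); [intro; symmetry; apply exp_INR|].
  apply is_lim_seq_geom. rewrite Rabs_pos_eq by (apply Rlt_le, exp_pos).
  rewrite <- exp_0. apply exp_increasing; lra.
Qed.

Lemma is_lim_seq_squeeze (u v : nat -> R) (l : R) :
  (forall n, Rabs (u n - l) <= v n) -> is_lim_seq v 0 -> is_lim_seq u l.
Proof.
  intros H Hv.
  assert (L : is_lim_seq (fun n => u n - l) 0).
  { apply is_lim_seq_abs_0. apply (is_lim_seq_le_le (fun _ => 0) _ v); trivial.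
    - intro; split; [apply Rabs_pos|trivial].
    - apply is_lim_seq_const. }
  apply (is_lim_seq_ext (fun n => (u n - l) + l)); [intro; ring|].
  replace (Finite l) with (Finite (0 + l)) by (f_equal; ring).
  apply is_lim_seq_plus'; [exact L|apply is_lim_seq_const].
Qed.

Lemma is_lim_seq_scal_0 (K : R) (u : nat -> R) :
  is_lim_seq u 0 -> is_lim_seq (fun n => K * u n) 0.
Proof.
  intro H. replace (Finite 0) with (Rbar_mult K 0) by (simpl; f_equal; ring).
  now apply is_lim_seq_scal_l.
Qed.

Lemma pow_exp_lim (k : nat) (b B : R) (r : nat -> R) : 0 < b -> (forall n, Rabs (r n) <= B) ->
  is_lim_seq (fun J => INR J ^ k * exp (- b * INR J) * r J) 0.
Proof.
  intros Hb Hr.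
  apply (is_lim_seq_squeeze _ (fun J => (B * pow_exp_cst k b) * exp (- (b / 2) * INR J))).
  - intro J. rewrite Rminus_0_r, Rabs_mult.
    assert (HJ := pos_INR J).
    rewrite Rabs_pos_eq.
    + generalize (pow_exp_le k b (INR J) Hb HJ) (Hr J) (Rabs_pos (r J)).
      assert (0 <= INR J ^ k * exp (- b * INR J)).
      { apply Rmult_le_pos; [now apply pow_le|apply Rlt_le, exp_pos]. }
      nra.
    + apply Rmult_le_pos; [now apply pow_le|apply Rlt_le, exp_pos].
  - apply is_lim_seq_scal_0, exp_INR_lim. lra.
Qed.

(* lap k b om is the complex number k! / (b - i om)^(k+1), i.e. the pair of the
   cosine and sine transforms of x^k exp(-b x) at om. *)
Fixpoint lap (k : nat) (b om : R) : R * R :=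
  let p := b / (b ^ 2 + om ^ 2) in
  let q := om / (b ^ 2 + om ^ 2) in
  match k with
  | O => (p, q)
  | S k' => let AB := lap k' b om in
      (INR k * (p * fst AB - q * snd AB), INR k * (p * snd AB + q * fst AB))
  end.

Definition lapc (k : nat) (b om : R) : R := fst (lap k b om).
Definition laps (k : nat) (b om : R) : R := snd (lap k b om).

Lemma sq_sum_pos (b om : R) : 0 < b -> 0 < b ^ 2 + om ^ 2.
Proof. intro; simpl; nra. Qed.

Lemma continuous_pow_exp_trig (k : nat) (b om x : R) :
  continuous (fun x => x ^ k * exp (- b * x) * cos (om * x)) x /\
  continuous (fun x => x ^ k * exp (- b * x) * sin (om * x)) x.
Proof.
  split.
  - continuous_derive.
  - continuous_derive.
Qed.

(** The two equations say p + i q = 1 / (b - i om), so the two parts are the real and imaginary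
    parts of one integration by parts of x^k e^(-(b - i om) x). The terms with [0 ^ k] are the
    boundary values at 0, present only for k = 0. *)
Lemma trig_parts (k J : nat) (b om p q : R) : b * p + om * q = 1 -> om * p - b * q = 0 ->
  is_RInt (fun x => INR k * (x ^ pred k * exp (- b * x) * (- p * cos (om * x) + q * sin (om * x)))
     + x ^ k * exp (- b * x) * cos (om * x)) 0 (INR J)
     (INR J ^ k * exp (- b * INR J) * (- p * cos (om * INR J) + q * sin (om * INR J)) + 0 ^ k * p)
  /\
  is_RInt (fun x => INR k * (x ^ pred k * exp (- b * x) * (- p * sin (om * x) - q * cos (om * x)))
     + x ^ k * exp (- b * x) * sin (om * x)) 0 (INR J)
     (INR J ^ k * exp (- b * INR J) * (- p * sin (om * INR J) - q * cos (om * INR J)) + 0 ^ k * q).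
Proof.
  intros H1 H2. split.
  - evar_last.
    + apply (is_RInt_derive (fun x => x ^ k * exp (- b * x) * (- p * cos (om * x) + q * sin (om * x)))).
      * intros x _. auto_derive; trivial.
        replace (x ^ k * exp (- b * x) * cos (om * x)) with
          (x ^ k * exp (- b * x) * ((b * p + om * q) * cos (om * x) + (om * p - b * q) * sin (om * x)))
          by (rewrite H1, H2; ring).
        ring.
      * intros x _.
        continuous_derive.
    + unfold minus, plus, opp; simpl. rewrite !Rmult_0_r, exp_0, cos_0, sin_0. ring.
  - evar_last.
    + apply (is_RInt_derive (fun x => x ^ k * exp (- b * x) * (- p * sin (om * x) - q * cos (om * x)))).
      * intros x _. auto_derive; trivial.
        replace (x ^ k * exp (- b * x) * sin (om * x)) with
          (x ^ k * exp (- b * x) * ((b * p + om * q) * sin (om * x) - (om * p - b * q) * cos (om * x)))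
          by (rewrite H1, H2; ring).
        ring.
      * intros x _.
        continuous_derive.
    + unfold minus, plus, opp; simpl. rewrite !Rmult_0_r, exp_0, cos_0, sin_0. ring.
Qed.

Lemma trig_boundary_lim (k : nat) (b om p q : R) : 0 < b ->
  is_lim_seq (fun J => INR J ^ k * exp (- b * INR J) * (p * cos (om * INR J) + q * sin (om * INR J))) 0.
Proof.
  intro Hb. apply (pow_exp_lim k b (Rabs p + Rabs q)
    (fun J => p * cos (om * INR J) + q * sin (om * INR J))); trivial.
  intro J. eapply Rle_trans; [apply Rabs_triang|]. rewrite !Rabs_mult.
  assert (Rabs (cos (om * INR J)) <= 1) by apply Rabs_le, COS_bound.
  assert (Rabs (sin (om * INR J)) <= 1) by apply Rabs_le, SIN_bound.
  generalize (Rabs_pos p) (Rabs_pos q); nra.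
Qed.

(** Induction on k: [trig_parts] expresses the integrals for k + 1 through those for k, and its
    boundary term at J tends to zero. The cosine and sine transforms must be treated together, since
    each step mixes them. *)
Lemma lap_lim (k : nat) (b om : R) : 0 < b ->
  is_lim_seq (fun J => RInt (fun x => x ^ k * exp (- b * x) * cos (om * x)) 0 (INR J)) (lapc k b om)
  /\ is_lim_seq (fun J => RInt (fun x => x ^ k * exp (- b * x) * sin (om * x)) 0 (INR J)) (laps k b om).
Proof.
  intro Hb.
  assert (HD := sq_sum_pos b om Hb).
  assert (Hpq1 : b * (b / (b ^ 2 + om ^ 2)) + om * (om / (b ^ 2 + om ^ 2)) = 1) by (field; lra).
  assert (Hpq2 : om * (b / (b ^ 2 + om ^ 2)) - b * (om / (b ^ 2 + om ^ 2)) = 0) by (field; lra).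
  assert (E0 : lap 0 b om = (b / (b ^ 2 + om ^ 2), om / (b ^ 2 + om ^ 2))) by reflexivity.
  assert (ES' : forall k, lap (S k) b om =
    (INR (S k) * (b / (b ^ 2 + om ^ 2) * fst (lap k b om) - om / (b ^ 2 + om ^ 2) * snd (lap k b om)),
     INR (S k) * (b / (b ^ 2 + om ^ 2) * snd (lap k b om) + om / (b ^ 2 + om ^ 2) * fst (lap k b om))))
    by reflexivity.
  unfold lapc, laps.
  (* Only the two linear relations between p and q and the recursion [ES'] matter from here on. *)
  generalize dependent (b / (b ^ 2 + om ^ 2)). intros p Hp1 Hp2.
  generalize dependent (om / (b ^ 2 + om ^ 2)). intros q Hq1 Hq2 E0 ES'.
  assert (EC : forall n J, is_RInt (fun x => x ^ n * exp (- b * x) * cos (om * x)) 0 (INR J)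
     (RInt (fun x => x ^ n * exp (- b * x) * cos (om * x)) 0 (INR J))).
  { intros n J. apply (RInt_correct (V := RV)).
    apply ex_RInt_cont; [apply pos_INR|]. intros x _; exact (proj1 (continuous_pow_exp_trig n b om x)). }
  assert (ES : forall n J, is_RInt (fun x => x ^ n * exp (- b * x) * sin (om * x)) 0 (INR J)
     (RInt (fun x => x ^ n * exp (- b * x) * sin (om * x)) 0 (INR J))).
  { intros n J. apply (RInt_correct (V := RV)).
    apply ex_RInt_cont; [apply pos_INR|]. intros x _; exact (proj2 (continuous_pow_exp_trig n b om x)). }
  induction k as [|k [IHc IHs]].
  - rewrite E0; cbn [fst snd]. split.
    + eapply is_lim_seq_ext; [|replace (Finite p) with (Finite (0 + p)) by (f_equal; ring);
        apply is_lim_seq_plus'; [apply (trig_boundary_lim 0 b om (- p) q Hb)|apply is_lim_seq_const]].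
      intro J. symmetry. apply (is_RInt_unique (V := RV)).
      eapply is_RInt_ext; [|evar_last; [apply (proj1 (trig_parts 0 J b om p q Hq1 Hq2))|]].
      * intros x _; simpl; ring.
      * simpl; ring.
    + eapply is_lim_seq_ext; [|replace (Finite q) with (Finite (0 + q)) by (f_equal; ring);
        apply is_lim_seq_plus'; [apply (trig_boundary_lim 0 b om (- q) (- p) Hb)|apply is_lim_seq_const]].
      intro J. symmetry. apply (is_RInt_unique (V := RV)).
      eapply is_RInt_ext; [|evar_last; [apply (proj2 (trig_parts 0 J b om p q Hq1 Hq2))|]].
      * intros x _; simpl; ring.
      * simpl; ring.
  - rewrite ES'; cbn [fst snd].
    assert (LL : forall u v x y z w s, is_lim_seq u (Finite x) -> is_lim_seq v (Finite y) -> is_lim_seq w (Finite 0) ->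
      is_lim_seq (fun J => w J + INR (S k) * (z * u J + s * v J)) (INR (S k) * (z * x + s * y))).
    { intros u v x y z w s Hu Hv Hw.
      replace (Finite (INR (S k) * (z * x + s * y))) with (Finite (0 + INR (S k) * (z * x + s * y)))
        by (f_equal; ring).
      apply is_lim_seq_plus'; trivial.
      apply (is_lim_seq_scal_l _ _ (Finite (z * x + s * y))).
      apply is_lim_seq_plus'.
      + now apply (is_lim_seq_scal_l _ _ (Finite x)).
      + now apply (is_lim_seq_scal_l _ _ (Finite y)). }
    split.
    + replace (p * fst (lap k b om) - q * snd (lap k b om))
        with (p * fst (lap k b om) + (- q) * snd (lap k b om)) by ring.
      eapply is_lim_seq_ext; [|apply LL; [exact IHc|exact IHs|exact (trig_boundary_lim (S k) b om (- p) q Hb)]].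
      intro J. symmetry. apply (is_RInt_unique (V := RV)).
      assert (H := is_RInt_minus _ _ _ _ _ _ (proj1 (trig_parts (S k) J b om p q Hq1 Hq2))
        (is_RInt_scal _ _ _ (INR (S k)) _ (is_RInt_plus _ _ _ _ _ _
           (is_RInt_scal _ _ _ (- p) _ (EC k J)) (is_RInt_scal _ _ _ q _ (ES k J))))).
      eapply is_RInt_ext; [|evar_last; [exact H|]].
      * intros x _. unfold minus, plus, opp, scal; simpl; unfold mult; simpl; ring.
      * unfold minus, plus, opp, scal; simpl; unfold mult; simpl; ring.
    + replace (p * snd (lap k b om) + q * fst (lap k b om))
        with (q * fst (lap k b om) + p * snd (lap k b om)) by ring.
      eapply is_lim_seq_ext; [|apply LL; [exact IHc|exact IHs|exact (trig_boundary_lim (S k) b om (- q) (- p) Hb)]].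
      intro J. symmetry. apply (is_RInt_unique (V := RV)).
      assert (H := is_RInt_minus _ _ _ _ _ _ (proj2 (trig_parts (S k) J b om p q Hq1 Hq2))
        (is_RInt_scal _ _ _ (INR (S k)) _ (is_RInt_plus _ _ _ _ _ _
           (is_RInt_scal _ _ _ (- q) _ (EC k J)) (is_RInt_scal _ _ _ (- p) _ (ES k J))))).
      eapply is_RInt_ext; [|evar_last; [exact H|]].
      * intros x _. unfold minus, plus, opp, scal; simpl; unfold mult; simpl; ring.
      * unfold minus, plus, opp, scal; simpl; unfold mult; simpl; ring.
Qed.

Lemma lap_S (k : nat) (b om : R) :
  lapc (S k) b om = INR (S k) * (b / (b ^ 2 + om ^ 2) * lapc k b om - om / (b ^ 2 + om ^ 2) * laps k b om)
  /\ laps (S k) b om = INR (S k) * (b / (b ^ 2 + om ^ 2) * laps k b om + om / (b ^ 2 + om ^ 2) * lapc k b om).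
Proof. split; reflexivity. Qed.

Lemma lap_om0 (k : nat) (b : R) : 0 < b ->
  lapc k b 0 = INR (fact k) / b ^ S k /\ laps k b 0 = 0.
Proof.
  intro Hb. induction k as [|k [IHc IHs]].
  - unfold lapc, laps; simpl. split; field; lra.
  - destruct (lap_S k b 0) as [-> ->]. rewrite IHc, IHs, fact_simpl, mult_INR. simpl pow.
    split; field; try split; try (apply pow_nonzero; lra); lra.
Qed.

Lemma lap_scale (k : nat) (lam b om : R) : 0 < lam -> 0 < b ->
  lapc k (lam * b) (lam * om) = lapc k b om / lam ^ S k
  /\ laps k (lam * b) (lam * om) = laps k b om / lam ^ S k.
Proof.
  intros Hl Hb. assert (HD := sq_sum_pos b om Hb).
  assert (HD' := sq_sum_pos (lam * b) (lam * om) (Rmult_lt_0_compat _ _ Hl Hb)).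
  assert (E : (lam * b) ^ 2 + (lam * om) ^ 2 = lam * lam * (b ^ 2 + om ^ 2)) by ring.
  induction k as [|k [IHc IHs]].
  - unfold lapc, laps. cbn [lap fst snd]. rewrite E, pow_1. split; field; lra.
  - destruct (lap_S k (lam * b) (lam * om)) as [-> ->]. destruct (lap_S k b om) as [-> ->].
    rewrite IHc, IHs, E.
    replace (lam ^ S (S k)) with (lam * lam ^ S k) by reflexivity.
    assert (lam ^ S k <> 0) by (apply pow_nonzero; lra).
    split; field; repeat split; lra.
Qed.

(* (om - i b) = -i (b + i om), so for even k the two transforms swap up to sign. *)
Lemma lap_swap (j : nat) (b om : R) :
  lapc (2 * j) om b = (-1) ^ j * laps (2 * j) b om
  /\ laps (2 * j) om b = (-1) ^ j * lapc (2 * j) b om.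
Proof.
  induction j as [|j [IHc IHs]].
  - unfold lapc, laps; simpl Nat.mul; cbn [lap fst snd]. rewrite (Rplus_comm (om ^ 2)). simpl. split; ring.
  - replace (2 * S j)%nat with (S (S (2 * j))) by lia.
    destruct (lap_S (S (2 * j)) om b) as [-> ->]. destruct (lap_S (2 * j) om b) as [-> ->].
    destruct (lap_S (S (2 * j)) b om) as [-> ->]. destruct (lap_S (2 * j) b om) as [-> ->].
    rewrite IHc, IHs, (Rplus_comm (om ^ 2)). simpl ((-1) ^ S j). split; ring.
Qed.

(** Since |p| and |q| are at most 1 / b and every step of the recursion adds two products, each step
    costs a factor 2 / b. The crude power of 2 is harmless: only the decay in b is wanted. *)
Lemma lap_bound (k : nat) (b om : R) : 0 < b ->
  Rabs (lapc k b om) <= INR (fact k) * (2 / b) ^ S k /\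
  Rabs (laps k b om) <= INR (fact k) * (2 / b) ^ S k.
Proof.
  intro Hb. assert (HD := sq_sum_pos b om Hb).
  set (p := b / (b ^ 2 + om ^ 2)). set (q := om / (b ^ 2 + om ^ 2)).
  assert (Hp : Rabs p <= / b).
  { unfold p. rewrite Rabs_pos_eq by (apply Rlt_le, Rdiv_lt_0_compat; lra).
    apply Rle_div_l; [lra|]. apply (Rmult_le_reg_l b); trivial.
    rewrite <- Rmult_assoc, Rinv_r by lra. simpl; nra. }
  assert (Hq : Rabs q <= / b).
  { unfold q, Rdiv. rewrite Rabs_mult, (Rabs_pos_eq (/ _)) by (apply Rlt_le, Rinv_0_lt_compat; lra).
    apply (Rle_div_l (Rabs om)); [lra|]. apply (Rmult_le_reg_l b); trivial.
    rewrite <- Rmult_assoc, Rinv_r by lra. rewrite <- (pow2_abs om). generalize (Rabs_pos om). simpl; nra. }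
  assert (Hib : 0 < / b) by now apply Rinv_0_lt_compat.
  induction k as [|k [IHc IHs]].
  - unfold lapc, laps; cbn [lap fst snd]. fold p q. simpl. split; lra.
  - destruct (lap_S k b om) as [-> ->]. fold p q.
    rewrite fact_simpl, mult_INR.
    assert (Hk : 0 < INR (S k)) by (apply lt_0_INR; lia).
    set (M := INR (fact k) * (2 / b) ^ S k) in *.
    replace (INR (S k) * INR (fact k) * (2 / b) ^ S (S k)) with (INR (S k) * (/ b * M + / b * M))
      by (unfold M; simpl; field; lra).
    assert (HH : forall x y, Rabs x <= M -> Rabs y <= M -> Rabs (p * x + q * y) <= / b * M + / b * M).
    { intros x y Hx Hy. eapply Rle_trans; [apply Rabs_triang|]. rewrite !Rabs_mult.
      apply Rplus_le_compat; apply Rmult_le_compat; trivial; apply Rabs_pos. }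
    split; rewrite Rabs_mult, (Rabs_pos_eq (INR (S k))) by lra; apply Rmult_le_compat_l; try lra.
    + replace (p * lapc k b om - q * laps k b om) with (p * lapc k b om + q * - laps k b om) by ring.
      apply HH; trivial. now rewrite Rabs_Ropp.
    + now apply HH.
Qed.

Lemma pow_exp_cst_nonneg (k : nat) (b : R) : 0 < b -> 0 <= pow_exp_cst k b.
Proof.
  intro Hb. apply pow_le. apply Rmult_le_pos.
  - generalize (pos_INR k); lra.
  - apply Rlt_le, Rinv_0_lt_compat, Hb.
Qed.

Lemma Rabs_sin_1 (x : R) : Rabs (sin x) <= 1.
Proof. apply Rabs_le, SIN_bound. Qed.

Lemma Rabs_cos_1 (x : R) : Rabs (cos x) <= 1.
Proof. apply Rabs_le, COS_bound. Qed.

Lemma pow_exp_nonneg (k : nat) (b x : R) : 0 <= x -> 0 <= x ^ k * exp (- b * x).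
Proof. intro. apply Rmult_le_pos; [now apply pow_le|apply Rlt_le, exp_pos]. Qed.

(** Poisson summation for x^k e^(-b x) sin (2 pi th x), which vanishes at 0 even for k = 0. The
    product of this sine with cos (2 pi n x) splits each Fourier coefficient into the frequencies n
    + th and n - th. This is the imaginary part of Lipschitz's formula, with n and -n grouped so
    that k = 0 is covered. *)
Lemma lipschitz_sum (k : nat) (b th G : R) : 0 < b ->
  is_series (fun d => INR (S d) ^ k * sin (2 * PI * INR (S d) * th) * exp (- b * INR (S d))) G ->
  is_lim_seq (fun N => laps k b (2 * PI * th) +
     sum_n (fun n => laps k b (2 * PI * (INR (S n) + th)) - laps k b (2 * PI * (INR (S n) - th))) N) G.
Proof.
  intros Hb HG.
  set (F := fun x => x ^ k * exp (- b * x) * sin (2 * PI * th * x)).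
  set (F' := fun x => INR k * (x ^ pred k * exp (- b * x)) * sin (2 * PI * th * x)
     + x ^ k * exp (- b * x) * (2 * PI * th * cos (2 * PI * th * x) - b * sin (2 * PI * th * x))).
  set (K := pow_exp_cst k b + (INR k * pow_exp_cst (pred k) b
      + pow_exp_cst k b * (Rabs (2 * PI * th) + b))).
  assert (HF0 : F 0 = 0) by (unfold F; rewrite Rmult_0_r, (Rmult_0_r (2 * PI * th)), sin_0; ring).
  assert (C1 := pow_exp_cst_nonneg k b Hb).
  assert (C2 := pow_exp_cst_nonneg (pred k) b Hb).
  assert (C3 := pos_INR k). assert (C4 := Rabs_pos (2 * PI * th)).
  assert (C5 : 0 <= INR k * pow_exp_cst (pred k) b) by now apply Rmult_le_pos.
  assert (C6 : 0 <= pow_exp_cst k b * (Rabs (2 * PI * th) + b)) by (apply Rmult_le_pos; lra).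
  assert (P := poisson_half_line F F' K (b / 2)).
  replace (Finite G) with (Finite (F 0 / 2 + G)) by (rewrite HF0; f_equal; field).
  apply (is_lim_seq_ext (fun N => laps k b (2 * PI * th) + 2 *
    sum_n (fun n => / 2 * (laps k b (2 * PI * (INR (S n) + th)) - laps k b (2 * PI * (INR (S n) - th)))) N)).
  { intro N. rewrite sum_n_mult_l_R, <- Rmult_assoc, Rinv_r by lra. now rewrite Rmult_1_l. }
  apply P; clear P.
  - lra.
  - intros x _. unfold F, F'. auto_derive; trivial. ring.
  - intros x _. apply (ex_derive_continuous F'). unfold F'. auto_derive; trivial.
  - intros x Hx. unfold F. rewrite Rabs_mult, (Rabs_pos_eq (x ^ k * _)) by now apply pow_exp_nonneg.
    generalize (pow_exp_le k b x Hb Hx) (pow_exp_nonneg k b x Hx) (Rabs_sin_1 (2 * PI * th * x))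
      (Rabs_pos (sin (2 * PI * th * x))) (exp_pos (- (b / 2) * x)).
    unfold K. intros. apply Rle_trans with (pow_exp_cst k b * exp (- (b / 2) * x)); nra.
  - intros x Hx. unfold F'.
    assert (E := exp_pos (- (b / 2) * x)).
    eapply Rle_trans; [apply Rabs_triang|].
    rewrite !Rabs_mult, (Rabs_pos_eq (x ^ k)), (Rabs_pos_eq (x ^ pred k)), (Rabs_pos_eq (exp _)),
      (Rabs_pos_eq (INR k)); trivial; try apply pow_le; trivial; try (apply Rlt_le, exp_pos).
    assert (T1 : INR k * (x ^ pred k * exp (- b * x)) * Rabs (sin (2 * PI * th * x))
       <= INR k * (pow_exp_cst (pred k) b * exp (- (b / 2) * x))).
    { generalize (pow_exp_nonneg (pred k) b x Hx); intro.
      rewrite <- (Rmult_1_r (INR k * (pow_exp_cst _ _ * _))).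
      apply Rmult_le_compat; [now apply Rmult_le_pos|apply Rabs_pos| |apply Rabs_sin_1].
      apply Rmult_le_compat_l; trivial. now apply pow_exp_le. }
    assert (T2 : x ^ k * exp (- b * x) * Rabs (2 * PI * th * cos (2 * PI * th * x) - b * sin (2 * PI * th * x))
       <= pow_exp_cst k b * exp (- (b / 2) * x) * (Rabs (2 * PI * th) + b)).
    { apply Rmult_le_compat; [now apply pow_exp_nonneg|apply Rabs_pos|now apply pow_exp_le|].
      eapply Rle_trans; [apply Rabs_triang|]. rewrite Rabs_Ropp, (Rabs_mult (2 * PI * th)), (Rabs_mult b), (Rabs_pos_eq b) by lra.
      generalize (Rabs_sin_1 (2 * PI * th * x)) (Rabs_cos_1 (2 * PI * th * x)). nra. }
    unfold K. nra.
  - apply (proj2 (lap_lim k b (2 * PI * th) Hb)).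
  - intro n.
    assert (L1 := proj2 (lap_lim k b (2 * PI * (INR (S n) + th)) Hb)).
    assert (L2 := proj2 (lap_lim k b (2 * PI * (INR (S n) - th)) Hb)).
    eapply is_lim_seq_ext; [|exact (is_lim_seq_scal_l _ (/2) _ (is_lim_seq_minus' _ _ _ _ L1 L2))].
    intro J. symmetry. apply (is_RInt_unique (V := RV)).
    assert (ES : forall om, is_RInt (fun x => x ^ k * exp (- b * x) * sin (om * x)) 0 (INR J)
     (RInt (fun x => x ^ k * exp (- b * x) * sin (om * x)) 0 (INR J))).
    { intros om. apply (RInt_correct (V := RV)).
      apply ex_RInt_cont; [apply pos_INR|]. intros x _. exact (proj2 (continuous_pow_exp_trig k b om x)). }
    eapply is_RInt_ext; [|apply (is_RInt_scal (V := R_NormedModule)), (is_RInt_minus (V := R_NormedModule));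
      [apply (ES (2 * PI * (INR (S n) + th)))|apply (ES (2 * PI * (INR (S n) - th)))]].
    intros x _.
    change (/ 2 * (x ^ k * exp (- b * x) * sin (2 * PI * (INR (S n) + th) * x)
      - x ^ k * exp (- b * x) * sin (2 * PI * (INR (S n) - th) * x)) = F x * cos (freq n * x)).
    unfold F, freq.
    replace (2 * PI * (INR (S n) + th) * x) with (2 * PI * th * x + 2 * PI * INR (S n) * x) by ring.
    replace (2 * PI * (INR (S n) - th) * x) with (- (2 * PI * th * x - 2 * PI * INR (S n) * x)) by ring.
    rewrite sin_neg, sin_plus, sin_minus. field.
  - eapply is_series_ext; [|exact HG]. intro d. unfold F. cbv beta.
    replace (2 * PI * th * INR (S d)) with (2 * PI * INR (S d) * th) by ring. simpl; ring.
Qed.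

(** The previous sum with decay rate and frequency exchanged: [lap_scale] with lam = 2 pi / w and
    then [lap_swap], which needs the even exponent, turn each sine transform at rate lam om and
    frequency 2 pi u into a cosine transform at rate w u and frequency om. *)
Lemma lipschitz_sum_cos (j : nat) (w om th G : R) : 0 < w -> 0 < om -> 0 < th < 1 ->
  is_series (fun d => INR (S d) ^ (2 * j) * sin (2 * PI * INR (S d) * th)
       * exp (- (2 * PI / w * om) * INR (S d))) G ->
  is_lim_seq (fun N => sum_n (fun m => lapc (2 * j) (w * (INR m + th)) om
       - lapc (2 * j) (w * (INR m + 1 - th)) om) N)
    ((-1) ^ j * (2 * PI / w) ^ S (2 * j) * G).
Proof.
  intros Hw Hom Hth HG. assert (HPI := PI_RGT_0).
  assert (Hl : 0 < 2 * PI / w) by (apply Rdiv_lt_0_compat; lra).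
  assert (Hb : 0 < 2 * PI / w * om) by now apply Rmult_lt_0_compat.
  assert (L := lipschitz_sum (2 * j) _ th G Hb HG).
  set (lam := 2 * PI / w) in *.
  assert (Hs : forall u, 0 < u -> laps (2 * j) (lam * om) (2 * PI * u)
     = (-1) ^ j * (lapc (2 * j) (w * u) om / lam ^ S (2 * j))).
  { intros u Hu. assert (Hwu : 0 < w * u) by now apply Rmult_lt_0_compat.
    rewrite <- (proj1 (lap_scale (2 * j) lam (w * u) om Hl Hwu)).
    replace (lam * (w * u)) with (2 * PI * u) by (unfold lam; field; lra).
    rewrite (proj1 (lap_swap j (lam * om) (2 * PI * u))), <- Rmult_assoc.
    replace ((-1) ^ j * (-1) ^ j) with 1; [ring|].
    rewrite <- Rpow_mult_distr. replace (-1 * -1) with 1 by ring. now rewrite pow1. }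
  assert (Hlam : lam ^ S (2 * j) <> 0) by (apply pow_nonzero; lra).
  assert (Hm1 : (-1) ^ j * (-1) ^ j = 1).
  { rewrite <- Rpow_mult_distr. replace (-1 * -1) with 1 by ring. apply pow1. }
  assert (L2 := is_lim_seq_scal_l _ ((-1) ^ j * lam ^ S (2 * j)) _ L).
  (* Pairing m + th with m + 1 - th instead of n + th with n - th leaves one unmatched term at the
     upper end; it tends to zero. *)
  assert (L3 : is_lim_seq (fun N => - lapc (2 * j) (w * (INR (S N) + 1 - th)) om) 0).
  { apply (is_lim_seq_squeeze _ (fun N => INR (fact (2 * j)) * (2 / w) ^ S (2 * j) * / INR (S N))).
    - intro N. rewrite Rminus_0_r, Rabs_Ropp.
      assert (HN : 1 <= INR (S N)) by (apply (le_INR 1); lia).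
      eapply Rle_trans; [apply lap_bound; nra|].
      rewrite Rmult_assoc. apply Rmult_le_compat_l; [apply pos_INR|].
      apply Rle_trans with ((2 / w * / INR (S N)) ^ S (2 * j)).
      + apply pow_incr. split. { apply Rlt_le, Rdiv_lt_0_compat; nra. }
        unfold Rdiv; rewrite Rmult_assoc, <- Rinv_mult. apply Rmult_le_compat_l; [lra|].
        apply Rinv_le_contravar; nra.
      + rewrite Rpow_mult_distr. apply Rmult_le_compat_l. { apply pow_le, Rlt_le, Rdiv_lt_0_compat; lra. }
        assert (Hi : 0 < / INR (S N) <= 1).
        { split; [apply Rinv_0_lt_compat; lra|]. rewrite <- Rinv_1. apply Rinv_le_contravar; lra. }
        assert (Hp : (/ INR (S N)) ^ (2 * j) <= 1 ^ (2 * j)) by (apply pow_incr; lra).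
        rewrite pow1 in Hp. change ((/ INR (S N)) ^ S (2 * j)) with (/ INR (S N) * (/ INR (S N)) ^ (2 * j)). nra.
    - apply is_lim_seq_scal_0. exact is_lim_seq_inv_S. }
  apply is_lim_seq_incr_1.
  replace (Finite ((-1) ^ j * lam ^ S (2 * j) * G)) with (Finite ((-1) ^ j * lam ^ S (2 * j) * G + 0)) by (f_equal; ring).
  eapply is_lim_seq_ext; [|apply (is_lim_seq_plus' _ _ _ _ L2 L3)].
  intro N. cbv beta. rewrite Hs by lra.
  (* Since (n + 1) - th is the second member of the pair at m = n, shifting the second members by
     one index changes the sum only at its two ends. *)
  assert (E : forall N, sum_n (fun n => laps (2 * j) (lam * om) (2 * PI * (INR (S n) + th))
        - laps (2 * j) (lam * om) (2 * PI * (INR (S n) - th))) N =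
     (-1) ^ j / lam ^ S (2 * j) * (sum_n (fun m => lapc (2 * j) (w * (INR m + th)) om
       - lapc (2 * j) (w * (INR m + 1 - th)) om) (S N) + lapc (2 * j) (w * (INR (S N) + 1 - th)) om
       - lapc (2 * j) (w * th) om) :> R).
  { clear N. induction N as [|N IH].
    - rewrite sum_Sn_R, !sum_O_R. assert (E1 : INR 1 = 1) by reflexivity.
      rewrite !Hs by (rewrite E1; lra).
      replace (INR 0) with 0 by reflexivity.
      replace (0 + th) with th by ring. replace (0 + 1 - th) with (INR 1 - th) by (rewrite E1; ring).
      field; trivial.
    - rewrite (sum_Sn_R _ N), (sum_Sn_R _ (S N)), IH.
      assert (E1 : 0 < INR (S (S N)) - th).
      { assert (1 <= INR (S (S N))) by (apply (le_INR 1); lia). lra. }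
      rewrite !Hs by (generalize (pos_INR (S (S N))); lra).
      replace (INR (S (S N)) - th) with (INR (S N) + 1 - th) by (rewrite (S_INR (S N)); ring).
      field; trivial. }
  rewrite E.
  match goal with |- _ + - ?z = _ => set (t2 := z) end.
  match goal with |- context [sum_n ?f ?n] => set (t1 := sum_n f n) end.
  replace ((-1) ^ j * lam ^ S (2 * j) * ((-1) ^ j * (lapc (2 * j) (w * th) om / lam ^ S (2 * j))
     + (-1) ^ j / lam ^ S (2 * j) * (t1 + t2 - lapc (2 * j) (w * th) om)) + - t2)
  with (((-1) ^ j * (-1) ^ j) * (t1 + t2) - t2) by (field; trivial).
  rewrite Hm1. ring_R.
Qed.

(** * The lattice sum over m in closed form *)

Lemma RInt_exp_decay (c a b : R) : 0 < c ->
  is_RInt (fun x => exp (- c * x)) a b ((exp (- c * a) - exp (- c * b)) / c).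
Proof.
  intro Hc. evar_last.
  - apply (is_RInt_derive (fun x => - exp (- c * x) / c)).
    + intros x _. auto_derive; trivial. field; lra.
    + intros x _. continuous_derive.
  - unfold minus, plus, opp; simpl. field; lra.
Qed.

Lemma norm_RInt_decay {V : CompleteNormedModule R_AbsRing} (f : R -> V) (K c a b : R) (l : V) :
  0 < c -> 0 <= K -> a <= b ->
  (forall x, a <= x <= b -> norm (f x) <= K * exp (- c * x)) ->
  is_RInt f a b l -> norm l <= K / c * exp (- c * a).
Proof.
  intros Hc HK Hab Hf Hl.
  assert (H := is_RInt_scal (V := R_NormedModule) _ _ _ K _ (RInt_exp_decay c a b Hc)).
  eapply Rle_trans; [apply (norm_RInt_le _ _ _ _ _ _ Hab Hf Hl H)|].
  unfold scal; simpl; unfold mult; simpl.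
  replace (K / c * exp (- c * a)) with (K * (exp (- c * a) / c)) by (field; lra).
  apply Rmult_le_compat_l; trivial. apply Rmult_le_compat_r.
  - apply Rlt_le, Rinv_0_lt_compat, Hc.
  - generalize (exp_pos (- c * b)); lra.
Qed.

Lemma exp_decay_eventually (K c eps : R) : 0 < c -> 0 < eps ->
  exists M, 0 <= M /\ forall x, M <= x -> K * exp (- c * x) < eps.
Proof.
  intros Hc He.
  set (M := Rmax 0 ((Rabs K + 1) / (eps * c))).
  assert (HA : 0 < Rabs K + 1) by (generalize (Rabs_pos K); lra).
  assert (Hec : 0 < eps * c) by now apply Rmult_lt_0_compat.
  exists M. split; [apply Rmax_l|]. intros x Hx.
  assert (H1 : (Rabs K + 1) / (eps * c) <= x) by (eapply Rle_trans; [apply Rmax_r|exact Hx]).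
  assert (H0 : 0 <= x) by (eapply Rle_trans; [apply Rmax_l|exact Hx]).
  assert (H2 : Rabs K + 1 <= x * (eps * c)) by now apply Rle_div_l.
  assert (H3 := exp_ineq1_le (c * x)). assert (H4 := exp_pos (- c * x)).
  assert (H5 : exp (- c * x) * exp (c * x) = 1).
  { rewrite <- exp_plus. replace (- c * x + c * x) with 0 by ring. apply exp_0. }
  assert (H6 : K * exp (- c * x) <= Rabs K * exp (- c * x)).
  { apply Rmult_le_compat_r; [lra|apply Rle_abs]. }
  apply (Rmult_lt_reg_r (exp (c * x))); [apply exp_pos|].
  rewrite Rmult_assoc, H5, Rmult_1_r.
  generalize (Rle_abs K). nra.
Qed.

Lemma minus_plus_l {G : AbelianGroup} (a b : G) : minus (plus a b) a = b.
Proof.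
  unfold minus. rewrite (plus_comm a b), <- plus_assoc.
  transitivity (plus b zero); [apply (f_equal (plus b)), plus_opp_r | apply plus_zero_r].
Qed.

Lemma norm_minus_triangle {V : NormedModule R_AbsRing} (a b c : V) :
  norm (minus a c) <= norm (minus b a) + norm (minus b c).
Proof.
  replace (minus a c) with (plus (opp (minus b a)) (minus b c)).
  - eapply Rle_trans; [apply norm_triangle|]. rewrite norm_opp. apply Rle_refl.
  - rewrite opp_minus. symmetry. apply minus_trans.
Qed.

(** The integral up to X is Cauchy with an explicit rate, and the limit inherits that rate, which
    later arguments use instead of mere convergence. The module is kept general because both real
    and complex integrands occur. *)
Lemma RInt_decay_lim {V : CompleteNormedModule R_AbsRing} (f : R -> V) (K c : R) :
  0 < c -> 0 <= K -> (forall x, 0 <= x -> continuous f x) ->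
  (forall x, 0 <= x -> norm (f x) <= K * exp (- c * x)) ->
  exists l, forall X, 0 <= X -> norm (minus l (RInt f 0 X)) <= K / c * exp (- c * X).
Proof.
  intros Hc HK Hcont Hb.
  assert (E : forall a b, 0 <= a -> a <= b -> ex_RInt f a b).
  { intros a b Ha Hab. apply (ex_RInt_continuous (V := V)).
    intros x. rewrite Rmin_left, Rmax_right by trivial. intro; apply Hcont; lra. }
  assert (HKc : 0 <= K / c) by (apply Rmult_le_pos; [lra|apply Rlt_le, Rinv_0_lt_compat, Hc]).
  assert (HD : forall a b, 0 <= a -> a <= b -> norm (minus (RInt f 0 b) (RInt f 0 a)) <= K / c * exp (- c * a)).
  { intros a b Ha Hab.
    rewrite <- (RInt_Chasles f 0 a b) by (apply E; lra).
    replace (minus (plus (RInt f 0 a) (RInt f a b)) (RInt f 0 a)) with (RInt f a b).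
    2: { symmetry; exact (minus_plus_l (RInt f 0 a) (RInt f a b)). }
    apply (norm_RInt_decay f K c a b); trivial.
    - intros; apply Hb; lra.
    - apply RInt_correct, E; lra. }
  assert (Hex : exists l, filterlim (fun X => RInt f 0 X) (Rbar_locally p_infty) (locally l)).
  { apply (proj1 (filterlim_locally_cauchy (U := V) (F := Rbar_locally p_infty) (fun X => RInt f 0 X))).
    intro eps.
    destruct (exp_decay_eventually (K / c) c eps Hc (cond_pos eps)) as [M [HM0 HM]].
    exists (fun x => M < x). split; [exists M; trivial|].
    intros u v Hu Hv.
    destruct (Rle_dec u v) as [Huv|Huv].
    - refine (norm_compat1 (V := V) _ _ _ _). eapply Rle_lt_trans; [apply HD; lra|]. apply HM; lra.
    - apply ball_sym. refine (norm_compat1 (V := V) _ _ _ _). eapply Rle_lt_trans; [apply HD; lra|]. apply HM; lra. }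
  destruct Hex as [l Hl]. exists l. intros X HX.
  apply Rle_plus_epsilon. intros eps He.
  assert (Hl2 := proj1 (filterlim_locally_ball_norm _ _) Hl (mkposreal eps He)).
  destruct Hl2 as [M HM].
  set (Y := Rmax X (M + 1)).
  assert (HY : norm (minus (RInt f 0 Y) l) < eps).
  { apply HM. unfold Y. generalize (Rmax_r X (M + 1)); lra. }
  assert (HXY : X <= Y) by apply Rmax_l.
  eapply Rle_trans; [exact (norm_minus_triangle (V := V) l (RInt f 0 Y) (RInt f 0 X))|].
  rewrite (Rplus_comm (K / c * _)). apply Rplus_le_compat; [exact (Rlt_le _ _ HY)|exact (HD X Y HX HXY)].
Qed.

(** The entire function (e^v - 1) / v, given by its power series so that v = 0 needs no separate
    treatment. *)
Definition expq (v : R) : R := PSeries (fun n => / INR (fact (S n))) v.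

Lemma expq_radius : CV_radius (fun n => / INR (fact (S n))) = p_infty.
Proof.
  change (CV_radius (PS_decr_1 (fun n => / INR (fact n))) = p_infty).
  rewrite CV_radius_decr_1. apply CV_radius_infinite_DAlembert.
  - intro n. apply Rinv_neq_0_compat, INR_fact_neq_0.
  - apply (is_lim_seq_ext (fun n => / INR (S n))).
    + intro n. rewrite fact_simpl, mult_INR. assert (H := INR_fact_neq_0 n).
      assert (H2 : 0 < INR (S n)) by (apply lt_0_INR; lia).
      replace (/ (INR (S n) * INR (fact n)) / / INR (fact n)) with (/ INR (S n)) by (field; lra).
      symmetry; apply Rabs_pos_eq, Rlt_le, Rinv_0_lt_compat, H2.
    + exact is_lim_seq_inv_S.
Qed.

Lemma expq_mult (v : R) : v * expq v = exp v - 1.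
Proof.
  unfold expq. rewrite exp_Reals.
  change (fun n => / INR (fact (S n))) with (PS_decr_1 (fun n => / INR (fact n))).
  rewrite (PSeries_decr_1 (fun n => / INR (fact n)) v).
  - simpl. field.
  - eexists; apply is_exp_Reals.
Qed.

Lemma expq_0 : expq 0 = 1.
Proof. unfold expq. rewrite PSeries_0. simpl. field. Qed.

Lemma expq_pos (v : R) : 0 < expq v.
Proof.
  assert (H := expq_mult v).
  destruct (Rtotal_order v 0) as [Hv|[->|Hv]].
  - assert (exp v < 1) by (rewrite <- exp_0; now apply exp_increasing). nra.
  - rewrite expq_0; lra.
  - assert (1 < exp v) by (rewrite <- exp_0; now apply exp_increasing). nra.
Qed.

Lemma ex_derive_expq (v : R) : ex_derive expq v.
Proof. apply ex_derive_PSeries. now rewrite expq_radius. Qed.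

Lemma ex_derive_Derive_expq (v : R) : ex_derive (Derive expq) v.
Proof.
  apply (ex_derive_ext (PSeries (PS_derive (fun n => / INR (fact (S n)))))).
  - intro t. symmetry. apply Derive_PSeries. now rewrite expq_radius.
  - apply ex_derive_PSeries. rewrite CV_radius_derive, expq_radius. exact I.
Qed.

(* For u > 0 this is the sum over m in Z of sgn(m + th) exp (- w |m + th| u); writing
   it with expq makes the even extension visibly smooth at u = 0. *)
Definition phi (w th u : R) : R :=
  exp (- (w * th) * u) * (1 - 2 * th) * expq (- (w * (1 - 2 * th)) * u) / expq (- w * u).

Lemma phi_quot (w th u : R) : 0 < w -> u <> 0 ->
  phi w th u = (exp (- (w * th) * u) - exp (- (w * (1 - th)) * u)) / (1 - exp (- w * u)).
Proof.
  intros Hw Hu. unfold phi.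
  assert (H1 := expq_mult (- w * u)). assert (H2 := expq_mult (- (w * (1 - 2 * th)) * u)).
  assert (P := expq_pos (- w * u)).
  assert (N : w * u * expq (- w * u) <> 0).
  { apply Rmult_integral_contrapositive_currified; [|lra].
    apply Rmult_integral_contrapositive_currified; lra. }
  replace (1 - exp (- w * u)) with (w * u * expq (- w * u)) by lra.
  replace (exp (- (w * (1 - th)) * u)) with (exp (- (w * th) * u) * exp (- (w * (1 - 2 * th)) * u))
    by (rewrite <- exp_plus; f_equal; ring).
  replace (exp (- (w * (1 - 2 * th)) * u)) with (1 + - (w * (1 - 2 * th)) * u * expq (- (w * (1 - 2 * th)) * u)) by lra.
  field. repeat split; lra.
Qed.

Lemma phi_even (w th u : R) : 0 < w -> phi w th (- u) = phi w th u.
Proof.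
  intro Hw. destruct (Req_dec u 0) as [->|Hu]; [now rewrite Ropp_0|].
  rewrite !phi_quot by lra.
  assert (E1 : exp (- w * - u) = / exp (- w * u)) by (rewrite <- exp_Ropp; f_equal; ring).
  assert (E2 : exp (- (w * th) * - u) = exp (- (w * (1 - th)) * u) * / exp (- w * u)).
  { rewrite <- exp_Ropp, <- exp_plus; f_equal; ring. }
  assert (E3 : exp (- (w * (1 - th)) * - u) = exp (- (w * th) * u) * / exp (- w * u)).
  { rewrite <- exp_Ropp, <- exp_plus; f_equal; ring. }
  rewrite E1, E2, E3. assert (P := exp_pos (- w * u)).
  assert (N : exp (- w * u) <> 1).
  { intro E. rewrite <- exp_0 in E. apply exp_inv in E. assert (w * u = 0) by lra.
    apply Rmult_integral in H; lra. }
  field. repeat split; lra.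
Qed.

Lemma phi_C1 (w th u : R) : ex_derive (phi w th) u /\ continuous (Derive (phi w th)) u.
Proof.
  set (phi' := fun u => (- (w * th)) * exp (- (w * th) * u) * (1 - 2 * th) * expq (- (w * (1 - 2 * th)) * u) / expq (- w * u)
    + exp (- (w * th) * u) * (1 - 2 * th) * (- (w * (1 - 2 * th)) * Derive expq (- (w * (1 - 2 * th)) * u)) / expq (- w * u)
    + exp (- (w * th) * u) * (1 - 2 * th) * expq (- (w * (1 - 2 * th)) * u)
       * (w * Derive expq (- w * u)) / (expq (- w * u)) ^ 2).
  assert (H : forall u, is_derive (phi w th) u (phi' u)).
  { intro v. unfold phi. auto_derive.
    - repeat split; try apply ex_derive_expq. apply Rgt_not_eq, expq_pos.
    - unfold phi'. assert (P := expq_pos (- w * v)).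
      change (Derive (fun x => expq x)) with (Derive expq). field. lra. }
  split; [eexists; apply H|].
  apply (continuous_ext phi').
  { intro v. symmetry. apply is_derive_unique, H. }
  apply (ex_derive_continuous phi'). unfold phi'.
  auto_derive. repeat split; try apply ex_derive_expq; try apply ex_derive_Derive_expq;
    try apply Rgt_not_eq, expq_pos.
  apply Rgt_not_eq. generalize (expq_pos (- w * u)); nra.
Qed.

Lemma continuous_bounded_01 (f : R -> R) : (forall x, continuous f x) ->
  exists M, 0 <= M /\ forall x, 0 <= x <= 1 -> Rabs (f x) <= M.
Proof.
  intro Hf.
  destruct (continuity_ab_maj (fun x => Rabs (f x)) 0 1) as [y [Hy _]]; [lra| |].
  - intros c _. apply continuity_pt_filterlim.
    apply (continuous_comp f Rabs); [apply Hf|apply continuous_Rabs].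
  - exists (Rabs (f y)). split; [apply Rabs_pos|exact Hy].
Qed.

(** The rate is that of the slower of the two exponentials in [phi_quot]. The quotient is estimated
    only for u > 1, where its denominator is at least 1 - e^(-w); on [0, 1] continuity gives a
    bound, and the factor e^c makes up for the decaying exponential there. *)
Lemma phi_decay (w th : R) : 0 < w -> 0 < th < 1 ->
  exists K c, 0 <= K /\ 0 < c /\ forall u, 0 <= u ->
    Rabs (phi w th u) <= K * exp (- c * u) /\ Rabs (Derive (phi w th) u) <= K * exp (- c * u).
Proof.
  intros Hw Hth.
  set (c := w * Rmin th (1 - th)).
  assert (Hm : 0 < Rmin th (1 - th)) by (apply Rmin_pos; lra).
  assert (Hc : 0 < c) by now apply Rmult_lt_0_compat.
  destruct (continuous_bounded_01 (phi w th)) as [M1 [HM1 B1]].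
  { intro x. apply (ex_derive_continuous (phi w th)), phi_C1. }
  destruct (continuous_bounded_01 (Derive (phi w th))) as [M2 [HM2 B2]].
  { intro x. apply phi_C1. }
  set (d := 1 - exp (- w)).
  assert (Hd : 0 < d).
  { unfold d. assert (exp (- w) < 1) by (rewrite <- exp_0; apply exp_increasing; lra). lra. }
  assert (Hid : 0 < / d) by now apply Rinv_0_lt_compat.
  assert (Hid2 : 0 < / d * / d) by now apply Rmult_lt_0_compat.
  set (K := (M1 + M2) * exp c + (2 * / d + 2 * w * / d + 2 * w * (/ d * / d))).
  assert (Q1 : 0 <= (M1 + M2) * exp c) by (apply Rmult_le_pos; [lra|apply Rlt_le, exp_pos]).
  assert (Q2 : 0 <= 2 * w * / d) by (apply Rmult_le_pos; lra).
  assert (Q3 : 0 <= 2 * w * (/ d * / d)) by (apply Rmult_le_pos; lra).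
  assert (HK : 0 <= K) by (unfold K; lra).
  exists K, c. split; [exact HK|]. split; [exact Hc|]. intros u Hu.
  destruct (Rle_dec u 1) as [H1|H1].
  - assert (HE : 1 <= exp c * exp (- c * u)).
    { rewrite <- exp_plus, <- exp_0. apply exp_nondecreasing. nra. }
    assert (HE2 : M1 + M2 <= (M1 + M2) * exp c * exp (- c * u)).
    { rewrite Rmult_assoc. rewrite <- (Rmult_1_r (M1 + M2)) at 1. apply Rmult_le_compat_l; lra. }
    assert (HE3 : (M1 + M2) * exp c * exp (- c * u) <= K * exp (- c * u)).
    { apply Rmult_le_compat_r; [apply Rlt_le, exp_pos|]. unfold K; lra. }
    assert (Hu1 : 0 <= u <= 1) by lra.
    generalize (B1 u Hu1) (B2 u Hu1). split; lra.
  - assert (Hu0 : 1 < u) by lra.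
    assert (X1 : exp (- (w * th) * u) <= exp (- c * u)).
    { apply exp_nondecreasing. unfold c. generalize (Rmin_l th (1 - th)). intro.
      apply Rmult_le_compat_r; [lra|]. apply Ropp_le_contravar, Rmult_le_compat_l; lra. }
    assert (X2 : exp (- (w * (1 - th)) * u) <= exp (- c * u)).
    { apply exp_nondecreasing. unfold c. generalize (Rmin_r th (1 - th)). intro.
      apply Rmult_le_compat_r; [lra|]. apply Ropp_le_contravar, Rmult_le_compat_l; lra. }
    assert (P1 := exp_pos (- (w * th) * u)). assert (P2 := exp_pos (- (w * (1 - th)) * u)).
    assert (Pw := exp_pos (- w * u)).
    assert (X3 : d <= 1 - exp (- w * u)).
    { unfold d. assert (exp (- w * u) <= exp (- w)) by (apply exp_nondecreasing; nra). lra. }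
    assert (X4 : 0 < / (1 - exp (- w * u)) <= / d).
    { split; [apply Rinv_0_lt_compat; lra|apply Rinv_le_contravar; lra]. }
    set (E := exp (- c * u)) in *. assert (PE : 0 < E) by apply exp_pos.
    set (i := / (1 - exp (- w * u))) in *.
    split.
    + rewrite phi_quot by lra. unfold Rdiv. fold i. rewrite Rabs_mult, (Rabs_pos_eq i) by lra.
      apply Rle_trans with (2 * E * / d).
      * apply Rmult_le_compat; try lra; [apply Rabs_pos|]. apply Rabs_le; lra.
      * unfold K. nra.
    + assert (HD : Derive (phi w th) u =
        (- (w * th) * exp (- (w * th) * u) + w * (1 - th) * exp (- (w * (1 - th)) * u)) * i
         - (exp (- (w * th) * u) - exp (- (w * (1 - th)) * u)) * (w * exp (- w * u)) * (i * i)).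
      { rewrite (Derive_ext_loc _ (fun u => (exp (- (w * th) * u) - exp (- (w * (1 - th)) * u)) / (1 - exp (- w * u)))).
        - apply is_derive_unique. auto_derive; [lra|]. unfold i. field. lra.
        - exists (mkposreal 1 Rlt_0_1). intros v Hv. apply phi_quot; trivial.
          unfold ball in Hv; simpl in Hv; unfold AbsRing_ball, minus, plus, opp, abs in Hv; simpl in Hv.
          apply Rabs_def2 in Hv. lra. }
      rewrite HD.
      assert (Y1 : Rabs (- (w * th) * exp (- (w * th) * u) + w * (1 - th) * exp (- (w * (1 - th)) * u)) <= 2 * w * E).
      { apply Rabs_le.
        assert (0 <= w * th <= w) by nra. assert (0 <= w * (1 - th) <= w) by nra.
        assert (0 <= w * th * exp (- (w * th) * u) <= w * E) by nra.
        assert (0 <= w * (1 - th) * exp (- (w * (1 - th)) * u) <= w * E) by nra. lra. }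
      assert (Y2 : Rabs ((exp (- (w * th) * u) - exp (- (w * (1 - th)) * u)) * (w * exp (- w * u))) <= 2 * w * E).
      { rewrite Rabs_mult, (Rabs_pos_eq (w * _)) by nra.
        assert (exp (- w * u) <= 1) by lra.
        assert (Rabs (exp (- (w * th) * u) - exp (- (w * (1 - th)) * u)) <= 2 * E) by (apply Rabs_le; lra).
        replace (2 * w * E) with (2 * E * w) by ring.
        apply Rmult_le_compat; trivial; [apply Rabs_pos|nra|nra]. }
      assert (Hii : 0 < i * i <= / d * / d) by nra.
      eapply Rle_trans; [apply Rabs_triang|]. rewrite Rabs_Ropp, (Rabs_mult _ i), (Rabs_mult _ (i * i)),
        (Rabs_pos_eq i), (Rabs_pos_eq (i * i)) by lra.
      apply Rle_trans with (2 * w * E * / d + 2 * w * E * (/ d * / d)).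
      * apply Rplus_le_compat; apply Rmult_le_compat; try lra; apply Rabs_pos.
      * unfold K. nra.
Qed.

Definition profile (j : nat) (w th u : R) : R := u ^ (2 * j) * phi w th u.

Definition profile' (j : nat) (w th u : R) : R :=
  INR (2 * j) * u ^ pred (2 * j) * phi w th u + u ^ (2 * j) * Derive (phi w th) u.

(** The cosine transform over the half line, thus half the Fourier transform of the even function
    [profile]. That the limit exists, so that [real] yields no default value, is part of the proof
    of [ghat_spec]. *)
Definition ghat (j : nat) (w th om : R) : R :=
  real (Lim_seq (fun J => RInt (fun u => profile j w th u * cos (om * u)) 0 (INR J))).

Lemma is_derive_profile (j : nat) (w th u : R) : is_derive (profile j w th) u (profile' j w th u).
Proof.
  unfold profile, profile'. generalize (2 * j)%nat; intro n. auto_derive.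
  - exact (proj1 (phi_C1 w th u)).
  - change (Derive (fun x => phi w th x)) with (Derive (phi w th)). ring.
Qed.

Lemma continuous_profile (j : nat) (w th u : R) : continuous (profile j w th) u.
Proof. apply (ex_derive_continuous (profile j w th)). eexists; apply is_derive_profile. Qed.

Lemma continuous_profile' (j : nat) (w th u : R) : continuous (profile' j w th) u.
Proof.
  unfold profile'. apply continuous_Rplus; apply continuous_Rmult.
  - continuous_derive.
  - apply (ex_derive_continuous (phi w th)); exact (proj1 (phi_C1 w th u)).
  - continuous_derive.
  - exact (proj2 (phi_C1 w th u)).
Qed.

Lemma profile_even (j : nat) (w th u : R) : 0 < w -> profile j w th (- u) = profile j w th u.
Proof.
  intro Hw. unfold profile. rewrite phi_even by trivial. f_equal.
  rewrite !pow_mult. f_equal. ring.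
Qed.

Lemma profile'_odd (j : nat) (w th u : R) : 0 < w -> profile' j w th (- u) = - profile' j w th u.
Proof.
  intro Hw.
  assert (H : is_derive (profile j w th) u (- profile' j w th (- u))).
  { apply (is_derive_ext (fun v => profile j w th (- v))); [intro; now apply profile_even|].
    evar_last. apply (is_derive_comp (profile j w th) (fun v => - v)); [apply is_derive_profile|auto_derive; trivial].
    unfold scal; simpl; unfold mult; simpl. ring. }
  assert (E := is_derive_unique _ _ _ H). rewrite (is_derive_unique _ _ _ (is_derive_profile j w th u)) in E.
  lra.
Qed.

(** Negative u are included because Poisson summation is applied to a function containing the shift
    by -psi, whose argument is negative near 0. Parity carries the bounds over from u >= 0. *)
Lemma profile_decay (j : nat) (w th : R) : 0 < w -> 0 < th < 1 ->
  exists K c, 0 <= K /\ 0 < c /\ forall u,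
    Rabs (profile j w th u) <= K * exp (- c * Rabs u) /\ Rabs (profile' j w th u) <= K * exp (- c * Rabs u).
Proof.
  intros Hw Hth. destruct (phi_decay w th Hw Hth) as [K [c [HK [Hc H]]]].
  assert (A1 := pow_exp_cst_nonneg (2 * j) c Hc). assert (A2 := pow_exp_cst_nonneg (pred (2 * j)) c Hc).
  assert (A3 := pos_INR (2 * j)).
  set (K2 := K * pow_exp_cst (2 * j) c + (INR (2 * j) * (K * pow_exp_cst (pred (2 * j)) c))).
  assert (B1 : 0 <= K * pow_exp_cst (2 * j) c) by now apply Rmult_le_pos.
  assert (B2 : 0 <= INR (2 * j) * (K * pow_exp_cst (pred (2 * j)) c)) by (repeat apply Rmult_le_pos; trivial).
  exists K2, (c / 2). split; [unfold K2; lra|]. split; [lra|].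
  assert (Hpos : forall u, 0 <= u -> Rabs (profile j w th u) <= K2 * exp (- (c / 2) * u) /\
     Rabs (profile' j w th u) <= K2 * exp (- (c / 2) * u)).
  { intros u Hu. destruct (H u Hu) as [H1 H2].
    assert (E := exp_pos (- (c / 2) * u)).
    assert (T : forall n v, Rabs v <= K * exp (- c * u) ->
        u ^ n * Rabs v <= K * pow_exp_cst n c * exp (- (c / 2) * u)).
    { intros n v Hv. apply Rle_trans with (u ^ n * (K * exp (- c * u))).
      - apply Rmult_le_compat_l; [now apply pow_le|trivial].
      - replace (u ^ n * (K * exp (- c * u))) with (K * (u ^ n * exp (- c * u))) by ring.
        rewrite Rmult_assoc. apply Rmult_le_compat_l; trivial. now apply pow_exp_le. }
    assert (G1 := T (2 * j)%nat _ H1). assert (G2 := T (2 * j)%nat _ H2). assert (G3 := T (pred (2 * j)) _ H1).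
    split.
    - unfold profile. rewrite Rabs_mult, (Rabs_pos_eq (u ^ _)) by now apply pow_le.
      unfold K2. nra.
    - unfold profile'. eapply Rle_trans; [apply Rabs_triang|].
      rewrite !Rabs_mult, (Rabs_pos_eq (u ^ (2 * j))), (Rabs_pos_eq (u ^ pred _)), (Rabs_pos_eq (INR _)); trivial; try (now apply pow_le).
      apply (Rmult_le_compat_l (INR (2 * j))) in G3; trivial. unfold K2. nra. }
  intro u. destruct (Rle_dec 0 u) as [Hu|Hu].
  - rewrite (Rabs_pos_eq u) by trivial. now apply Hpos.
  - rewrite (Rabs_left u) by lra. assert (Hu' : 0 <= - u) by lra.
    destruct (Hpos (- u) Hu') as [H1 H2].
    rewrite profile_even in H1 by trivial. rewrite profile'_odd, Rabs_Ropp in H2 by trivial. now split.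
Qed.

Lemma continuous_trig (om u : R) :
  continuous (fun u => cos (om * u)) u /\ continuous (fun u => sin (om * u)) u.
Proof.
  split.
  - continuous_derive.
  - continuous_derive.
Qed.

Lemma Rmult_le_bound (a b B : R) : Rabs a <= B -> Rabs b <= 1 -> Rabs (a * b) <= B.
Proof.
  intros Ha Hb. rewrite Rabs_mult. generalize (Rabs_pos a) (Rabs_pos b). nra.
Qed.

Lemma INR_shift_large (a X : R) : 0 < X -> eventually (fun J => X <= INR J + a).
Proof.
  intro HX. destruct (nfloor_ex (Rabs a + X)) as [n [Hn1 Hn2]].
  { generalize (Rabs_pos a); lra. }
  exists (S n). intros J HJ. apply le_INR in HJ. rewrite S_INR in HJ.
  generalize (Rabs_maj2 a). lra.
Qed.

Lemma decay_seq_lim (K c a l : R) (u : R -> R) : 0 < c ->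
  (forall X, 0 <= X -> Rabs (l - u X) <= K * exp (- c * X)) ->
  is_lim_seq (fun J => u (INR J + a)) l.
Proof.
  intros Hc H. apply is_lim_seq_spec. intro eps.
  destruct (exp_decay_eventually K c eps Hc (cond_pos eps)) as [M [HM0 HM]].
  assert (HM1 : 0 < M + 1) by lra.
  destruct (INR_shift_large a (M + 1) HM1) as [N HN].
  exists N. intros J HJ. specialize (HN J HJ).
  rewrite Rabs_minus_sym. eapply Rle_lt_trans; [apply H; lra|]. apply HM; lra.
Qed.

Section Ghat.

Variables (j : nat) (w th K c : R).
Hypothesis Hw : 0 < w.
Hypothesis HK : 0 <= K.
Hypothesis Hc : 0 < c.
Hypothesis Hth : 0 < th < 1.
Hypothesis Hg : forall u, Rabs (profile j w th u) <= K * exp (- c * Rabs u) /\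
   Rabs (profile' j w th u) <= K * exp (- c * Rabs u).

Lemma profile_trig_lim (t : R -> R) : (forall u, continuous t u) -> (forall u, Rabs (t u) <= 1) ->
  exists l, forall X, 0 <= X -> Rabs (l - RInt (fun u => profile j w th u * t u) 0 X) <= K / c * exp (- c * X).
Proof.
  intros Ht Hb.
  apply (RInt_decay_lim (V := RV) (fun u => profile j w th u * t u) K c); trivial.
  - intros x _. apply continuous_Rmult; [apply continuous_profile|apply Ht].
  - intros x Hx. apply Rmult_le_bound; [|apply Hb].
    rewrite <- (Rabs_pos_eq x) at 2 by trivial. apply Hg.
Qed.

Lemma ghat_spec (om X : R) : 0 <= X ->
  Rabs (ghat j w th om - RInt (fun u => profile j w th u * cos (om * u)) 0 X) <= K / c * exp (- c * X).
Proof.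
  destruct (profile_trig_lim (fun u => cos (om * u))) as [l Hl].
  { intro u; exact (proj1 (continuous_trig om u)). } { intro; apply Rabs_cos_1. }
  replace (ghat j w th om) with l; [apply Hl|].
  unfold ghat.
  assert (L := decay_seq_lim (K / c) c 0 l (fun X => RInt (fun u => profile j w th u * cos (om * u)) 0 X) Hc Hl).
  assert (L2 : is_lim_seq (fun J => RInt (fun u => profile j w th u * cos (om * u)) 0 (INR J)) l).
  { eapply is_lim_seq_ext; [|exact L]. intro; simpl. now rewrite Rplus_0_r. }
  now rewrite (is_lim_seq_unique _ _ L2).
Qed.

(** A finite geometric sum: removing the terms m <= M damps the whole profile by e^(-w (M + 1) u).
    The exact remainder replaces absolute convergence of the sum over m, which fails after
    integration when j = 0. *)
Lemma profile_remainder (M : nat) (u : R) :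
  profile j w th u - sum_n (fun m => u ^ (2 * j) * exp (- (w * (INR m + th)) * u)
     - u ^ (2 * j) * exp (- (w * (INR m + 1 - th)) * u)) M = exp (- (w * INR (S M)) * u) * profile j w th u.
Proof.
  unfold profile. destruct (Req_dec u 0) as [->|Hu].
  (* At u = 0 the two exponentials of each pair cancel, also for j = 0, where 0^0 = 1. *)
  - assert (E : sum_n (fun m => 0 ^ (2 * j) * exp (- (w * (INR m + th)) * 0)
     - 0 ^ (2 * j) * exp (- (w * (INR m + 1 - th)) * 0)) M = 0 :> R).
    { induction M as [|M IH]; [rewrite sum_O_R|rewrite sum_Sn_R, IH]; rewrite !Rmult_0_r, exp_0; ring. }
    rewrite E, Rmult_0_r, exp_0. ring.
  - rewrite phi_quot by trivial.
    assert (N : exp (- w * u) <> 1).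
    { intro E. rewrite <- exp_0 in E. apply exp_inv in E. assert (w * u = 0) by lra.
      apply Rmult_integral in H; lra. }
    induction M as [|M IH].
    + rewrite sum_O_R. simpl (INR 0). simpl (INR 1).
      replace (- (w * (0 + th)) * u) with (- (w * th) * u) by ring.
      replace (- (w * (0 + 1 - th)) * u) with (- (w * (1 - th)) * u) by ring.
      replace (- (w * 1) * u) with (- w * u) by ring. field. lra.
    + rewrite sum_Sn_R. rewrite Rminus_plus_distr, IH.
      replace (- (w * (INR (S M) + th)) * u) with (- (w * INR (S M)) * u + - (w * th) * u) by ring.
      replace (- (w * (INR (S M) + 1 - th)) * u) with (- (w * INR (S M)) * u + - (w * (1 - th)) * u) by ring.
      replace (- (w * INR (S (S M))) * u) with (- (w * INR (S M)) * u + - w * u) by (rewrite (S_INR (S M)); ring).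
      rewrite !exp_plus. field. lra.
Qed.

(** Termwise integration, justified by [profile_remainder]: the remainder integrates to at most K
    times the integral of e^(-w (N + 1) u), hence to K / (w (N + 1)). *)
Lemma ghat_sum (om : R) :
  is_lim_seq (fun N => sum_n (fun m => lapc (2 * j) (w * (INR m + th)) om
       - lapc (2 * j) (w * (INR m + 1 - th)) om) N) (ghat j w th om).
Proof.
  pose (f b x := x ^ (2 * j) * exp (- b * x) * cos (om * x)).
  apply (is_lim_seq_squeeze _ (fun N => K / w * / INR (S N))).
  2: { apply is_lim_seq_scal_0. exact is_lim_seq_inv_S. }
  intro N.
  assert (HN : 0 < INR (S N)) by (apply lt_0_INR; lia).
  assert (HwN : 0 < w * INR (S N)) by now apply Rmult_lt_0_compat.
  assert (L1 : is_lim_seq (fun J => RInt (fun u => profile j w th u * cos (om * u)) 0 (INR J)) (ghat j w th om)).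
  { eapply is_lim_seq_ext; [|apply (decay_seq_lim (K / c) c 0 _ (fun X => RInt (fun u => profile j w th u * cos (om * u)) 0 X) Hc (ghat_spec om))].
    intro; simpl. now rewrite Rplus_0_r. }
  set (s := fun J => sum_n (fun m => RInt (fun x => f (w * (INR m + th)) x) 0 (INR J)
     - RInt (fun x => f (w * (INR m + 1 - th)) x) 0 (INR J)) N : R).
  assert (L2 : is_lim_seq s (sum_n (fun m => lapc (2 * j) (w * (INR m + th)) om
       - lapc (2 * j) (w * (INR m + 1 - th)) om) N)).
  { assert (T : forall m, is_lim_seq (fun J => RInt (fun x => f (w * (INR m + th)) x) 0 (INR J)
     - RInt (fun x => f (w * (INR m + 1 - th)) x) 0 (INR J))
       (lapc (2 * j) (w * (INR m + th)) om - lapc (2 * j) (w * (INR m + 1 - th)) om)).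
    { intro m. apply is_lim_seq_minus'; refine (proj1 (lap_lim _ _ _ _)); apply Rmult_lt_0_compat; trivial;
      generalize (pos_INR m); lra. }
    exact (is_lim_seq_sum_n _ _ N T). }
  assert (L3 := is_lim_seq_abs _ _ (is_lim_seq_minus' _ _ _ _ L2 L1)).
  refine (is_lim_seq_le _ (fun _ => K / w * / INR (S N)) (Finite _) (Finite _) _ L3 (is_lim_seq_const _)).
  intro J. rewrite Rabs_minus_sym.
  replace (K / w * / INR (S N)) with (K / (w * INR (S N)) * exp (- (w * INR (S N)) * 0)).
  2: { rewrite Rmult_0_r, exp_0. field. lra. }
  apply (norm_RInt_decay (V := RV) (fun u => exp (- (w * INR (S N)) * u) * profile j w th u * cos (om * u)) K (w * INR (S N)) 0 (INR J)); trivial.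
  - apply pos_INR.
  - intros x [Hx _]. apply Rmult_le_bound; [|apply Rabs_cos_1].
    rewrite Rmult_comm, Rabs_mult, (Rabs_pos_eq (exp _)) by (apply Rlt_le, exp_pos).
    apply Rmult_le_compat_r; [apply Rlt_le, exp_pos|].
    eapply Rle_trans; [apply Hg|]. rewrite <- (Rmult_1_r K) at 2. apply Rmult_le_compat_l; trivial.
    rewrite <- exp_0. apply exp_nondecreasing. generalize (Rabs_pos x); nra.
  - apply (is_RInt_ext (fun u => minus (profile j w th u * cos (om * u)) (sum_n (fun m => f (w * (INR m + th)) u
     - f (w * (INR m + 1 - th)) u) N))).
    { intros u _. rewrite <- profile_remainder.
      replace (sum_n (fun m => f (w * (INR m + th)) u
     - f (w * (INR m + 1 - th)) u) N) with
       (cos (om * u) * sum_n (fun m => u ^ (2 * j) * exp (- (w * (INR m + th)) * u)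
     - u ^ (2 * j) * exp (- (w * (INR m + 1 - th)) * u)) N).
      - unfold minus, plus, opp; simpl. ring_R.
      - rewrite <- sum_n_mult_l_R. apply sum_n_ext; intro; unfold f; ring_R. }
    apply (is_RInt_minus (V := R_NormedModule)).
    + apply (RInt_correct (V := RV)), ex_RInt_cont; [apply pos_INR|].
      intros x _; apply continuous_Rmult; [apply continuous_profile|exact (proj1 (continuous_trig om x))].
    + assert (T : forall m, is_RInt (fun u => f (w * (INR m + th)) u
     - f (w * (INR m + 1 - th)) u) 0 (INR J)
       (RInt (fun x => f (w * (INR m + th)) x) 0 (INR J)
     - RInt (fun x => f (w * (INR m + 1 - th)) x) 0 (INR J))).
      { intro m. apply (is_RInt_minus (V := R_NormedModule));
        apply (RInt_correct (V := RV)), ex_RInt_cont; try apply pos_INR;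
        intros x _; refine (proj1 (continuous_pow_exp_trig _ _ _ _)). }
      exact (is_RInt_sum_n _ _ _ _ N T).
Qed.

End Ghat.

(** * Poisson summation over the cosets psi and 1 - psi *)

Lemma is_RInt_cont (f : R -> R) (a b : R) : (forall x, continuous f x) -> is_RInt f a b (RInt f a b).
Proof.
  intro H. apply (RInt_correct (V := RV)).
  apply (ex_RInt_continuous (V := RV)). intros; apply H.
Qed.

Lemma RInt_0_minus (f : R -> R) (a b : R) : (forall x, continuous f x) ->
  is_RInt f a b (RInt f 0 b - RInt f 0 a).
Proof.
  intro H.
  replace (RInt f 0 b - RInt f 0 a) with (RInt f a b); [now apply is_RInt_cont|].
  assert (E := RInt_Chasles (V := RV) f 0 a b
    (ex_intro _ _ (is_RInt_cont f 0 a H)) (ex_intro _ _ (is_RInt_cont f a b H))).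
  change plus with Rplus in E. lra.
Qed.

Lemma RInt_0_opp (f : R -> R) (s b : R) : (forall x, continuous f x) -> (forall x, f (- x) = s * f x) ->
  RInt f 0 (- b) = - s * RInt f 0 b.
Proof.
  intros H He.
  assert (I1 : is_RInt f (-1 * 0 + 0) (-1 * b + 0) (RInt f 0 (- b))).
  { replace (-1 * 0 + 0) with 0 by ring. replace (-1 * b + 0) with (- b) by ring. now apply is_RInt_cont. }
  apply is_RInt_comp_lin in I1.
  assert (I2 : is_RInt (fun y => scal (- s) (f y)) 0 b (scal (- s) (RInt f 0 b))).
  { apply (is_RInt_scal (V := R_NormedModule)). now apply is_RInt_cont. }
  apply (is_RInt_unique (V := RV)) in I1.
  apply (is_RInt_unique (V := RV)) in I2.
  rewrite <- I1. change (- s * RInt f 0 b) with (scal (- s) (RInt f 0 b)). rewrite <- I2.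
  apply RInt_ext. intros x _. unfold scal; simpl; unfold mult; simpl.
  replace (-1 * x + 0) with (- x) by ring. rewrite He. ring_R.
Qed.

Section PoissonG.

Variables (j : nat) (w th psi K c : R).
Hypothesis Hw : 0 < w.
Hypothesis HK : 0 <= K.
Hypothesis Hc : 0 < c.
Hypothesis Hth : 0 < th < 1.
Hypothesis Hpsi : 0 < psi < 1.
Hypothesis Hg : forall u, Rabs (profile j w th u) <= K * exp (- c * Rabs u) /\
   Rabs (profile' j w th u) <= K * exp (- c * Rabs u).

Let g := profile j w th.

Lemma continuous_g_cos (om x : R) : continuous (fun u => g u * cos (om * u)) x.
Proof. apply continuous_Rmult; [apply continuous_profile|exact (proj1 (continuous_trig om x))]. Qed.

Lemma continuous_g_sin (om x : R) : continuous (fun u => g u * sin (om * u)) x.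
Proof. apply continuous_Rmult; [apply continuous_profile|exact (proj2 (continuous_trig om x))]. Qed.

Lemma g_shift_RInt (om a b : R) :
  is_RInt (fun x => g (x + a) * cos (om * x)) 0 b
   (cos (om * a) * (RInt (fun u => g u * cos (om * u)) 0 (b + a) - RInt (fun u => g u * cos (om * u)) 0 a)
   + sin (om * a) * (RInt (fun u => g u * sin (om * u)) 0 (b + a) - RInt (fun u => g u * sin (om * u)) 0 a)).
Proof.
  assert (I1 := is_RInt_plus _ _ _ _ _ _
    (is_RInt_scal _ _ _ (cos (om * a)) _ (RInt_0_minus _ a (b + a) (continuous_g_cos om)))
    (is_RInt_scal _ _ _ (sin (om * a)) _ (RInt_0_minus _ a (b + a) (continuous_g_sin om)))).
  match type of I1 with is_RInt ?f _ _ ?l => assert (I2 : is_RInt f (1 * 0 + a) (1 * b + a) l) end.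
  { revert I1. replace (1 * 0 + a) with a by ring. replace (1 * b + a) with (b + a) by ring. trivial. }
  apply is_RInt_comp_lin in I2.
  eapply is_RInt_ext; [|apply I2]. intros x _.
  change (1 * (cos (om * a) * (g (1 * x + a) * cos (om * (1 * x + a))) + sin (om * a) * (g (1 * x + a) * sin (om * (1 * x + a))))
     = g (x + a) * cos (om * x)).
  replace (1 * x + a) with (x + a) by ring.
  replace (om * x) with (om * (x + a) - om * a) at 1 by ring.
  rewrite cos_minus. ring.
Qed.

(** After the shifts the integrals start at psi and -psi. The cosine primitive [C] is odd and the
    sine primitive [S] even, so these lower ends cancel; the sine parts at the upper ends share one
    limit and cancel as well, leaving only the cosine. *)
Lemma g_coeff_lim (om : R) :
  is_lim_seq (fun J => RInt (fun x => (g (x + psi) + g (x - psi)) * cos (om * x)) 0 (INR J))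
    (2 * cos (om * psi) * ghat j w th om).
Proof.
  set (C := fun X => RInt (fun u => g u * cos (om * u)) 0 X).
  set (S := fun X => RInt (fun u => g u * sin (om * u)) 0 X).
  destruct (profile_trig_lim j w th K c HK Hc Hg (fun u => sin (om * u))) as [l Hl].
  { intro u; exact (proj2 (continuous_trig om u)). } { intro; apply Rabs_sin_1. }
  assert (LC : forall a, is_lim_seq (fun J => C (INR J + a)) (ghat j w th om)).
  { intro a. apply (decay_seq_lim (K / c) c a _ C Hc). apply (ghat_spec j w th K c HK Hc Hg). }
  assert (LS : forall a, is_lim_seq (fun J => S (INR J + a)) l).
  { intro a. now apply (decay_seq_lim (K / c) c a _ S Hc). }
  assert (EC : C (- psi) = - C psi).
  { unfold C. rewrite (RInt_0_opp (fun u => g u * cos (om * u)) 1); [ring_R|apply continuous_g_cos|].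
    intro x. unfold g. rewrite profile_even by trivial. replace (om * - x) with (- (om * x)) by ring.
    rewrite cos_neg. ring. }
  assert (ES : S (- psi) = S psi).
  { unfold S. rewrite (RInt_0_opp (fun u => g u * sin (om * u)) (-1)); [ring_R|apply continuous_g_sin|].
    intro x. unfold g. rewrite profile_even by trivial. replace (om * - x) with (- (om * x)) by ring.
    rewrite sin_neg. ring. }
  apply (is_lim_seq_ext (fun J => cos (om * psi) * (C (INR J + psi) + C (INR J + - psi))
     + sin (om * psi) * (S (INR J + psi) - S (INR J + - psi)))).
  - intro J. symmetry. apply (is_RInt_unique (V := RV)).
    eapply is_RInt_ext; [|evar_last; [apply (is_RInt_plus (V := R_NormedModule));
      [apply (g_shift_RInt om psi)|apply (g_shift_RInt om (- psi))]|]].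
    + intros x _. change (g (x + psi) * cos (om * x) + g (x + - psi) * cos (om * x) = (g (x + psi) + g (x - psi)) * cos (om * x)).
      unfold Rminus. ring_R.
    + fold (C (INR J + psi)) (C psi) (C (INR J + - psi)) (C (- psi)) (S (INR J + psi)) (S psi) (S (INR J + - psi)) (S (- psi)).
      change plus with Rplus. rewrite EC, ES. replace (om * - psi) with (- (om * psi)) by ring. rewrite cos_neg, sin_neg. ring_R.
  - replace (Finite (2 * cos (om * psi) * ghat j w th om)) with
      (Finite (cos (om * psi) * (ghat j w th om + ghat j w th om) + sin (om * psi) * (l - l))) by (f_equal; ring).
    apply is_lim_seq_plus'.
    + apply (is_lim_seq_scal_l _ _ (Finite _)). apply is_lim_seq_plus'; apply LC.
    + apply (is_lim_seq_scal_l _ _ (Finite _)). apply is_lim_seq_minus'; apply LS.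
Qed.

(** The sum of the even g over psi + Z, folded onto the half line: with F x = g (x + psi) + g (x -
    psi), the term F 0 / 2 is g psi, and F d collects the points psi + d and psi - d. *)
Lemma poisson_profile (S : R) :
  is_series (fun n => g (INR n + psi) + g (INR n + 1 - psi)) S ->
  is_lim_seq (fun N => 2 * ghat j w th 0
    + 2 * sum_n (fun n => 2 * cos (freq n * psi) * ghat j w th (freq n)) N) S.
Proof.
  intro HS.
  set (F := fun x => g (x + psi) + g (x - psi)).
  set (F' := fun x => profile' j w th (x + psi) + profile' j w th (x - psi)).
  (* The factor e^c is the price of replacing |x + psi| and |x - psi| by their common lower bound x
     - 1. *)
  assert (Habs : forall x, 0 <= x -> K * exp (- c * Rabs (x + psi)) + K * exp (- c * Rabs (x - psi))
      <= 2 * K * exp c * exp (- c * x)).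
  { intros x Hx.
    assert (T : forall y, x - 1 <= y -> K * exp (- c * y) <= K * exp c * exp (- c * x)).
    { intros y Hy. rewrite Rmult_assoc, <- exp_plus. apply Rmult_le_compat_l; trivial.
      apply exp_nondecreasing. nra. }
    assert (H1 : x - 1 <= Rabs (x + psi)) by (eapply Rle_trans; [|apply Rle_abs]; lra).
    assert (H2 : x - 1 <= Rabs (x - psi)) by (eapply Rle_trans; [|apply Rle_abs]; lra).
    generalize (T _ H1) (T _ H2). lra. }
  assert (P := poisson_half_line F F' (2 * K * exp c) c Hc).
  set (S1 := S - g psi).
  assert (EF : F 0 / 2 + S1 = S).
  { unfold F, S1. rewrite Rplus_0_l. replace (0 - psi) with (- psi) by ring.
    unfold g. rewrite profile_even by trivial. field. }
  rewrite <- EF. apply P; clear P.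
  - intros x _. unfold F, F'. evar_last.
    + apply (is_derive_plus (V := R_NormedModule)).
      * apply (is_derive_comp g (fun x => x + psi)); [apply is_derive_profile|auto_derive; trivial].
      * apply (is_derive_comp g (fun x => x - psi)); [apply is_derive_profile|auto_derive; trivial].
    + unfold plus, scal; simpl; unfold mult; simpl. ring.
  - intros x _. apply continuous_Rplus.
    + apply (continuous_comp (fun x => x + psi) (profile' j w th)); [|apply continuous_profile'].
      continuous_derive.
    + apply (continuous_comp (fun x => x - psi) (profile' j w th)); [|apply continuous_profile'].
      continuous_derive.
  - intros x Hx. unfold F. eapply Rle_trans; [apply Rabs_triang|]. eapply Rle_trans; [|apply Habs, Hx].
    apply Rplus_le_compat; apply Hg.
  - intros x Hx. unfold F'. eapply Rle_trans; [apply Rabs_triang|]. eapply Rle_trans; [|apply Habs, Hx].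
    apply Rplus_le_compat; apply Hg.
  - assert (L := g_coeff_lim 0). rewrite Rmult_0_l, cos_0, Rmult_1_r in L.
    eapply is_lim_seq_ext; [|exact L]. intro J. apply RInt_ext. intros x _.
    unfold F. rewrite Rmult_0_l, cos_0. ring_R.
  - intro n. apply g_coeff_lim.
  - change (is_lim_seq (sum_n (fun d => F (INR (Datatypes.S d)))) S1).
    (* The series pairs n + psi with n + 1 - psi, Poisson summation pairs d + psi with d - psi. The
       partial sums differ by the term g psi, already counted in F 0 / 2, and by one term at the far
       end, which decays. *)
    apply (is_lim_seq_ext (fun N => sum_n (fun n => g (INR n + psi) + g (INR n + 1 - psi)) N + g (INR N + (psi + 1)) - g psi)).
    + intro N. induction N as [|N IH].
      * rewrite !sum_O_R. unfold F. simpl INR. replace (0 + psi) with psi by ring.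
        replace (0 + 1 - psi) with (1 - psi) by ring. replace (0 + (psi + 1)) with (1 + psi) by ring. ring_R.
      * rewrite !sum_Sn_R, <- IH. unfold F.
        replace (INR (Datatypes.S (Datatypes.S N)) + psi) with (INR (Datatypes.S N) + (psi + 1)) by (rewrite (S_INR (Datatypes.S N)); ring).
        replace (INR (Datatypes.S N) + psi) with (INR N + (psi + 1)) by (rewrite S_INR; ring).
        replace (INR (Datatypes.S (Datatypes.S N)) - psi) with (INR (Datatypes.S N) + 1 - psi) by (rewrite (S_INR (Datatypes.S N)); ring).
        ring_R.
    + change (is_lim_seq (fun N => sum_n (fun n => g (INR n + psi) + g (INR n + 1 - psi)) N + g (INR N + (psi + 1)) - g psi) S1).
      unfold S1. replace (S - g psi) with (S + 0 - g psi) by ring.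
      apply is_lim_seq_minus'; [|apply is_lim_seq_const].
      apply is_lim_seq_plus'; [exact HS|].
      apply (decay_seq_lim K c (psi + 1) 0 g Hc).
      intros X HX. rewrite Rminus_0_l, Rabs_Ropp. rewrite <- (Rabs_pos_eq X) at 2 by trivial. apply Hg.
Qed.

End PoissonG.

(** * Double series and divisor sums *)

Lemma sum_n_le_R (a b : nat -> R) (N : nat) : (forall n, (n <= N)%nat -> a n <= b n) -> sum_n a N <= sum_n b N.
Proof.
  induction N as [|N IH]; intro H.
  - rewrite !sum_O_R; apply H; lia.
  - rewrite !sum_Sn_R. apply Rplus_le_compat; [apply IH; intros; apply H; lia|apply H; lia].
Qed.

Lemma sum_n_plus_R (a b : nat -> R) (N : nat) : sum_n (fun n => a n + b n) N = sum_n a N + sum_n b N :> R.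
Proof. exact (sum_n_plus a b N). Qed.

Lemma Rabs_sum_n (a : nat -> R) (N : nat) : Rabs (sum_n a N) <= sum_n (fun n => Rabs (a n)) N.
Proof.
  induction N as [|N IH]; [rewrite !sum_O_R; lra|rewrite !sum_Sn_R].
  eapply Rle_trans; [apply Rabs_triang|]. lra.
Qed.

Lemma ex_series_bounded (a : nat -> R) (M : R) : (forall n, 0 <= a n) -> (forall N, sum_n a N <= M) -> ex_series a.
Proof.
  intros Ha HM. destruct (ex_finite_lim_seq_incr (sum_n a) M) as [l Hl]; trivial.
  - intro n. rewrite sum_Sn_R. generalize (Ha (S n)); lra.
  - exists l. exact Hl.
Qed.

Lemma is_series_partial_le (a : nat -> R) (l : R) (N : nat) : (forall n, 0 <= a n) -> is_series a l -> sum_n a N <= l.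
Proof.
  intros Ha Hl. apply (is_lim_seq_incr_compare (sum_n a)); [exact Hl|].
  intro n. rewrite sum_Sn_R. generalize (Ha (S n)); lra.
Qed.

Lemma series_tail_le (a b : nat -> R) (s t : R) (N : nat) : (forall n, Rabs (a n) <= b n) ->
  is_series a s -> is_series b t -> Rabs (s - sum_n a N) <= t - sum_n b N.
Proof.
  intros H Hs Ht.
  assert (L : is_lim_seq (fun M => Rabs (sum_n a M - sum_n a N)) (Rabs (s - sum_n a N))).
  { apply (is_lim_seq_abs _ (Finite _)), is_lim_seq_minus'; [exact Hs|apply is_lim_seq_const]. }
  assert (L2 : is_lim_seq (fun M => sum_n b M - sum_n b N) (t - sum_n b N)).
  { apply is_lim_seq_minus'; [exact Ht|apply is_lim_seq_const]. }
  refine (is_lim_seq_le_loc _ _ (Finite _) (Finite _) _ L L2).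
  exists N. intros M HM. induction HM as [|M HM IH].
  - rewrite !Rminus_diag, Rabs_R0. lra.
  - rewrite !sum_Sn_R.
    replace (sum_n a M + a (S M) - sum_n a N) with ((sum_n a M - sum_n a N) + a (S M)) by ring.
    eapply Rle_trans; [apply Rabs_triang|]. generalize (H (S M)). lra.
Qed.

Lemma is_series_scal_R (c : R) (a : nat -> R) (s : R) : is_series a s -> is_series (fun n => c * a n) (c * s).
Proof. exact (is_series_scal c a s). Qed.

(** A discrete integral test, from 1 + t <= e^t used twice: once to get 1 / (x + 1) <= ln ((x + 1) /
    x), once to compare the powers. The right side telescopes along x, x + 1, and so on. *)
Lemma Rpower_telescope (d x : R) : 0 < d -> 0 < x ->
  Rpower (x + 1) (- (1 + d)) <= / d * (Rpower x (- d) - Rpower (x + 1) (- d)).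
Proof.
  intros Hd Hx.
  assert (E : Rpower (x + 1) (- (1 + d)) = Rpower (x + 1) (- d) * / (x + 1)).
  { replace (- (1 + d)) with (- d + Ropp 1) by ring. rewrite Rpower_plus. f_equal.
    rewrite Rpower_Ropp, Rpower_1; lra. }
  rewrite E. set (L := ln (x + 1) - ln x).
  assert (HL : / (x + 1) <= L).
  { assert (H := exp_ineq1_le (ln (x / (x + 1)))).
    rewrite exp_ln in H by (apply Rdiv_lt_0_compat; lra).
    rewrite ln_div in H by lra. unfold L.
    replace (x / (x + 1)) with (1 - / (x + 1)) in H by (field; lra). lra. }
  assert (E2 : Rpower x (- d) = Rpower (x + 1) (- d) * exp (d * L)).
  { unfold Rpower, L. rewrite <- exp_plus. f_equal. ring. }
  rewrite E2. assert (P : 0 < Rpower (x + 1) (- d)) by apply exp_pos.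
  replace (/ d * (Rpower (x + 1) (- d) * exp (d * L) - Rpower (x + 1) (- d)))
    with (Rpower (x + 1) (- d) * (/ d * (exp (d * L) - 1))) by ring.
  apply Rmult_le_compat_l; [lra|].
  apply (Rmult_le_reg_l d); [lra|]. rewrite <- Rmult_assoc, Rinv_r, Rmult_1_l by lra.
  generalize (exp_ineq1_le (d * L)). nra.
Qed.

Lemma ex_series_Rpower (d a : R) : 0 < d -> 0 < a -> ex_series (fun n => Rpower (INR n + a) (- (1 + d))).
Proof.
  intros Hd Ha. apply ex_series_incr_1.
  apply (ex_series_bounded _ (/ d * Rpower a (- d))).
  - intro; apply Rlt_le, exp_pos.
  - intro N.
    assert (H : sum_n (fun n => Rpower (INR (S n) + a) (- (1 + d))) N
      <= / d * (Rpower a (- d) - Rpower (INR (S N) + a) (- d))).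
    { induction N as [|N IH].
      - rewrite sum_O_R. simpl INR. rewrite (Rplus_comm 1 a). now apply Rpower_telescope.
      - rewrite sum_Sn_R.
        assert (T := Rpower_telescope d (INR (S N) + a) Hd).
        replace (INR (S N) + a + 1) with (INR (S (S N)) + a) in T by (rewrite (S_INR (S N)); ring).
        generalize (pos_INR (S N)); intro. lra. }
    eapply Rle_trans; [exact H|]. apply Rmult_le_compat_l; [apply Rlt_le, Rinv_0_lt_compat, Hd|].
    assert (0 < Rpower (INR (S N) + a) (- d)) by apply exp_pos. lra.
Qed.

(** X^q e^(-X) is largest at X = q; the factor e^(-q) of the maximum is dropped. Applied to X = y d
    e or X = w u v, it makes the dependence on y or w a single power that factors out of the double
    sums and can be integrated afterwards. *)
Lemma exp_le_Rpower (q X : R) : 0 < q -> 0 < X -> exp (- X) <= Rpower q q * Rpower X (- q).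
Proof.
  intros Hq HX. unfold Rpower. rewrite <- exp_plus. apply exp_nondecreasing.
  assert (H := exp_ineq1_le (ln (X / q))).
  rewrite exp_ln in H by (now apply Rdiv_lt_0_compat).
  rewrite ln_div in H by lra.
  assert (q * (1 + (ln X - ln q)) <= q * (X / q)) by (apply Rmult_le_compat_l; lra).
  replace (q * (X / q)) with X in H0 by (field; lra). nra.
Qed.

Section DoubleSeries.

Variables (p q : nat -> R) (P Q : R).
Hypothesis Hp : forall n, 0 <= p n.
Hypothesis Hq : forall n, 0 <= q n.
Hypothesis HP : is_series p P.
Hypothesis HQ : is_series q Q.

(** A bound for the total of [p m * q n] over the pairs outside the square m, n <= N. *)
Definition double_eps (N : nat) : R := P * (Q - sum_n q N) + (P - sum_n p N) * Q.

Lemma double_eps_lim : is_lim_seq double_eps 0.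
Proof.
  replace (Finite 0) with (Finite (P * (Q - Q) + (P - P) * Q)) by (f_equal; ring).
  apply is_lim_seq_plus'.
  - apply (is_lim_seq_scal_l _ _ (Finite _)). apply is_lim_seq_minus'; [apply is_lim_seq_const|exact HQ].
  - apply (is_lim_seq_scal_r _ _ (Finite _)). apply is_lim_seq_minus'; [apply is_lim_seq_const|exact HP].
Qed.

(** Iterated sum and square partial sums are compared at a rate that depends on the family [a] only
    through the factor A. This makes the later estimates uniform in y and w. *)
Lemma double_series (a : nat -> nat -> R) (A : R) : 0 <= A ->
  (forall m n, Rabs (a m n) <= A * (p m * q n)) ->
  exists S : R, is_series (fun n => Series (fun m => a m n)) S /\
    (forall n, ex_series (fun m => a m n)) /\
    forall N, Rabs (sum_n (fun m => sum_n (fun n => a m n) N) N - S) <= A * double_eps N.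
Proof.
  intros HA Ha.
  assert (HP0 : 0 <= P). { apply Rle_trans with (sum_n p 0); [rewrite sum_O_R; apply Hp|now apply is_series_partial_le]. }
  assert (E1 : forall n, ex_series (fun m => Rabs (a m n))).
  { intro n. apply (ex_series_bounded _ (A * q n * P)).
    - intro; apply Rabs_pos.
    - intro N. apply Rle_trans with (sum_n (fun m => A * q n * p m) N).
      + apply sum_n_le_R. intros m _. eapply Rle_trans; [apply Ha|]. apply Req_le; ring.
      + rewrite sum_n_mult_l_R. apply Rmult_le_compat_l; [now apply Rmult_le_pos|].
        now apply is_series_partial_le. }
  assert (E2 : forall n, ex_series (fun m => a m n)) by (intro n; apply (ex_series_Rabs (fun m => a m n)), E1).
  set (b := fun n => Series (fun m => a m n)).
  assert (Hb : forall n N, Rabs (b n - sum_n (fun m => a m n) N) <= A * q n * (P - sum_n p N)).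
  { intros n N. rewrite Rmult_minus_distr_l, <- sum_n_mult_l_R.
    apply series_tail_le; [|exact (Series_correct _ (E2 n))|now apply is_series_scal_R].
    intro m. eapply Rle_trans; [apply Ha|]. apply Req_le; ring. }
  assert (Hb0 : forall n, Rabs (b n) <= A * P * q n).
  { intro n. assert (L : is_lim_seq (fun M => Rabs (sum_n (fun m => a m n) M)) (Rabs (b n))).
    { apply (is_lim_seq_abs _ (Finite _)). exact (Series_correct _ (E2 n)). }
    refine (is_lim_seq_le _ _ (Finite _) (Finite _) _ L (is_lim_seq_const _)).
    intro M. eapply Rle_trans; [apply Rabs_sum_n|].
    apply Rle_trans with (sum_n (fun m => A * q n * p m) M).
    - apply sum_n_le_R. intros m _. eapply Rle_trans; [apply Ha|]. apply Req_le; ring.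
    - rewrite sum_n_mult_l_R. replace (A * P * q n) with (A * q n * P) by ring.
      apply Rmult_le_compat_l; [now apply Rmult_le_pos|]. now apply is_series_partial_le. }
  assert (E3 : ex_series b).
  { apply ex_series_Rabs. apply (ex_series_bounded _ (A * P * Q)).
    - intro; apply Rabs_pos.
    - intro N. apply Rle_trans with (sum_n (fun n => A * P * q n) N).
      + apply sum_n_le_R; intros; apply Hb0.
      + rewrite sum_n_mult_l_R. apply Rmult_le_compat_l; [now apply Rmult_le_pos|].
        now apply is_series_partial_le. }
  exists (Series b). split; [exact (Series_correct _ E3)|]. split; [exact E2|]. intro N.
  assert (T1 : Rabs (Series b - sum_n b N) <= A * P * (Q - sum_n q N)).
  { rewrite Rmult_minus_distr_l, <- sum_n_mult_l_R.
    apply series_tail_le; [exact Hb0|exact (Series_correct _ E3)|now apply is_series_scal_R]. }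
  assert (T2 : Rabs (sum_n b N - sum_n (fun n => sum_n (fun m => a m n) N) N) <= A * (P - sum_n p N) * Q).
  { replace (sum_n b N - sum_n (fun n => sum_n (fun m => a m n) N) N)
      with (sum_n (fun n => b n + (-1) * sum_n (fun m => a m n) N) N : R).
    - eapply Rle_trans; [apply Rabs_sum_n|].
      apply Rle_trans with (sum_n (fun n => A * (P - sum_n p N) * q n) N).
      + apply sum_n_le_R. intros n _. replace (b n + -1 * sum_n (fun m => a m n) N) with (b n - sum_n (fun m => a m n) N) by ring.
        eapply Rle_trans; [apply Hb|]. apply Req_le; ring.
      + rewrite sum_n_mult_l_R. apply Rmult_le_compat_l.
        * apply Rmult_le_pos; trivial. generalize (is_series_partial_le p P N Hp HP); lra.
        * now apply is_series_partial_le.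
    - rewrite sum_n_plus_R, sum_n_mult_l_R. ring. }
  assert (ESW : sum_n (fun m => sum_n (fun n => a m n) N) N = sum_n (fun n => sum_n (fun m => a m n) N) N :> R)
    by exact (sum_n_switch a N N).
  rewrite ESW.
  rewrite Rabs_minus_sym.
  replace (Series b - sum_n (fun n => sum_n (fun m => a m n) N) N) with
    ((Series b - sum_n b N) + (sum_n b N - sum_n (fun n => sum_n (fun m => a m n) N) N)) by ring.
  eapply Rle_trans; [apply Rabs_triang|]. unfold double_eps. lra.
Qed.

End DoubleSeries.

Lemma sum_n_single (h : nat -> R) (e0 B : nat) :
  sum_n (fun e => if Nat.eqb e e0 then h e else 0) B = if Nat.leb e0 B then h e0 else 0 :> R.
Proof.
  induction B as [|B IH].
  - rewrite sum_O_R. destruct e0; reflexivity.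
  - rewrite sum_Sn_R, IH. destruct (Nat.eqb_spec (S B) e0) as [<-|N].
    + destruct (Nat.leb_spec (S B) B); [lia|]. destruct (Nat.leb_spec (S B) (S B)); [ring_R|lia].
    + destruct (Nat.leb_spec e0 B), (Nat.leb_spec e0 (S B)); try lia; ring_R.
Qed.

Lemma sum_n_extend (h : nat -> R) (n B : nat) : (n <= B)%nat -> (forall i, (n < i)%nat -> h i = 0) ->
  sum_n h B = sum_n h n :> R.
Proof.
  intros H Hz. induction H as [|B H IH]; trivial. rewrite sum_Sn_R, IH, Hz by lia. ring_R.
Qed.

Lemma sum_n_shift (h : nat -> R) (n : nat) : h 0%nat = 0 -> sum_n h (S n) = sum_n (fun d => h (S d)) n :> R.
Proof.
  intro H0. induction n as [|n IH].
  - rewrite sum_Sn_R, !sum_O_R, H0. ring_R.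
  - rewrite sum_Sn_R, IH, sum_Sn_R. reflexivity.
Qed.

(** Divisors d correspond to factorisations d e = n + 1. The box size B is left free so that all n
    <= N can be summed over one and the same box. *)
Lemma divisor_sum_box (f : nat -> nat -> R) (n B : nat) : (n <= B)%nat ->
  divisor_sum (S n) (fun d => f d (S n / d)%nat)
  = sum_n (fun d => sum_n (fun e => if (S d * S e =? S n)%nat then f (S d) (S e) else 0) B) B :> R.
Proof.
  intro HB.
  assert (E : forall d, (sum_n (fun e => if (S d * S e =? S n)%nat then f (S d) (S e) else 0) B : R)
     = if andb (0 <? S d)%nat (S n mod S d =? 0)%nat then f (S d) (S n / S d)%nat else 0).
  { intro d. destruct (Nat.eqb_spec (S n mod S d) 0) as [Hd|Hd].
    - set (e := (S n / S d)%nat). assert (He : (S n = S d * e)%nat) by (unfold e; now apply Nat.Div0.div_exact).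
      simpl andb. destruct e as [|e]; [lia|].
      transitivity (sum_n (fun e' => if Nat.eqb e' e then f (S d) (S e') else 0) B : R).
      + apply sum_n_ext. intro e'. rewrite He.
        destruct (Nat.eqb_spec e' e) as [->|N]; [now rewrite Nat.eqb_refl|].
        destruct (Nat.eqb_spec (S d * S e') (S d * S e)) as [H|]; trivial.
        exfalso. apply N. apply Nat.mul_cancel_l in H; lia.
      + rewrite sum_n_single. destruct (Nat.leb_spec e B); trivial. exfalso. nia.
    - replace (andb (0 <? S d)%nat false) with false by now destruct (0 <? S d)%nat.
      rewrite (sum_n_ext _ (fun _ => 0)).
      + clear. induction B as [|B IH]; [now rewrite sum_O_R|rewrite sum_Sn_R, IH; ring_R].
      + intro e. destruct (Nat.eqb_spec (S d * S e) (S n)) as [H|]; trivial.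
        exfalso. apply Hd. rewrite <- H, Nat.mul_comm. apply Nat.Div0.mod_mul. }
  rewrite (sum_n_ext _ _ _ E). unfold divisor_sum.
  rewrite sum_n_shift by reflexivity. symmetry. apply sum_n_extend; trivial.
  intros i Hi. rewrite Nat.mod_small by lia. simpl. reflexivity.
Qed.

Lemma divisor_sum_hyperbola (f : nat -> nat -> R) (N B : nat) : (N <= B)%nat ->
  sum_n (fun n => divisor_sum (S n) (fun d => f d (S n / d)%nat)) N
  = sum_n (fun d => sum_n (fun e => if (S d * S e <=? S N)%nat then f (S d) (S e) else 0) B) B :> R.
Proof.
  intro HB. induction N as [|N IH].
  - rewrite sum_O_R, (divisor_sum_box f 0 B) by trivial.
    apply sum_n_ext; intro d; apply sum_n_ext; intro e.
    destruct (Nat.eqb_spec (S d * S e) 1), (Nat.leb_spec (S d * S e) 1); trivial; lia.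
  - rewrite sum_Sn_R, IH, (divisor_sum_box f (S N) B) by lia.
    rewrite <- sum_n_plus_R. apply sum_n_ext; intro d. rewrite <- sum_n_plus_R.
    apply sum_n_ext; intro e.
    destruct (Nat.eqb_spec (S d * S e) (S (S N))), (Nat.leb_spec (S d * S e) (S N)), (Nat.leb_spec (S d * S e) (S (S N)));
    try lia; ring_R.
Qed.

(** * The Lambert series and the lattice sum *)

Lemma is_lim_seq_inj (u : nat -> R) (l l' : R) : is_lim_seq u l -> is_lim_seq u l' -> l = l'.
Proof.
  intros H H'. apply is_lim_seq_unique in H. apply is_lim_seq_unique in H'.
  rewrite H in H'. now injection H'.
Qed.

Definition div_coef (k : nat) (th psi : R) (n : nat) : R :=
  divisor_sum n (fun d => INR d ^ k * sin (2 * PI * INR d * th) * cos (2 * PI * INR n * psi / INR d)).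

Definition lambert_term (k : nat) (th psi y : R) (d e : nat) : R :=
  INR d ^ k * sin (2 * PI * INR d * th) * cos (2 * PI * INR e * psi) * exp (- y * (INR d * INR e)).

Definition lambert_sum (k : nat) (th psi y : R) (N : nat) : R :=
  sum_n (fun n => div_coef k th psi (S n) * exp (- y * INR (S n))) N.

Definition lattice_exp (k : nat) (w u v : R) : R := u ^ k * exp (- w * (u * v)).

Definition lattice_term (k : nat) (w th psi : R) (m n : nat) : R :=
  lattice_exp k w (INR n + psi) (INR m + th) + lattice_exp k w (INR n + 1 - psi) (INR m + th)
  - (lattice_exp k w (INR n + 1 - psi) (INR m + 1 - th) + lattice_exp k w (INR n + psi) (INR m + 1 - th)).

Definition lattice_sum (k : nat) (w th psi : R) (N : nat) : R :=
  sum_n (fun m => sum_n (fun n => lattice_term k w th psi m n) N) N.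

Lemma divisor_sum_scal_ext (f g : nat -> R) (c : R) (n : nat) :
  (forall d, (0 < d)%nat -> (n mod d = 0)%nat -> f d * c = g d) ->
  divisor_sum n f * c = divisor_sum n g.
Proof.
  intro H. unfold divisor_sum. rewrite Rmult_comm, <- sum_n_mult_l_R. apply sum_n_ext. intro d.
  destruct (Nat.ltb_spec 0 d); cbn [andb]; [|apply Rmult_0_r].
  destruct (Nat.eqb_spec (n mod d) 0); [|apply Rmult_0_r].
  rewrite Rmult_comm. now apply H.
Qed.

Lemma lambert_sum_divisor (k : nat) (th psi y : R) (N : nat) :
  lambert_sum k th psi y N = sum_n (fun n => divisor_sum (S n) (fun d => lambert_term k th psi y d (S n / d)%nat)) N.
Proof.
  unfold lambert_sum, div_coef. apply sum_n_ext. intro n. apply divisor_sum_scal_ext.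
  intros d Hd Hm. unfold lambert_term.
  assert (E : (S n = d * (S n / d))%nat) by (apply Nat.Div0.div_exact; trivial).
  assert (E2 : INR (S n) = INR d * INR (S n / d)) by (rewrite <- mult_INR; now f_equal).
  assert (Hd' : 0 < INR d) by now apply lt_0_INR.
  rewrite <- E2.
  replace (2 * PI * INR (S n) * psi / INR d) with (2 * PI * INR (S n / d) * psi); [ring|].
  rewrite E2. field. lra.
Qed.

Lemma inv_sq_Rpower (d : nat) : / INR (S d) ^ 2 = Rpower (INR d + 1) (- (1 + 1)).
Proof.
  rewrite <- S_INR. assert (0 < INR (S d)) by (apply lt_0_INR; lia).
  rewrite Rpower_Ropp. replace (1 + 1) with (INR 2) by (simpl; ring). now rewrite Rpower_pow.
Qed.

Lemma ex_series_inv_sq : ex_series (fun d => / INR (S d) ^ 2).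
Proof.
  eapply ex_series_ext; [|apply (ex_series_Rpower 1 1); lra].
  intro d. symmetry. apply inv_sq_Rpower.
Qed.

(** The exponent k + 3 is spent as follows: k on absorbing d^k, 2 on summability in d and e, and 1
    on the last factor 1 / (d e), which makes the terms beyond the hyperbola d e <= N + 1 small. The
    surplus power e^(-k) is discarded. *)
Lemma lambert_term_bound (k : nat) (th psi y : R) (d e : nat) : 0 < y ->
  Rabs (lambert_term k th psi y (S d) (S e)) <=
    Rpower (INR k + 3) (INR k + 3) * Rpower y (- (INR k + 3))
      * (/ INR (S d) ^ 2 * / INR (S e) ^ 2) * / INR (S d * S e).
Proof.
  intro Hy. assert (Hk := pos_INR k). unfold lambert_term.
  set (D := INR (S d)). set (E := INR (S e)).
  assert (HD : 1 <= D) by (apply (le_INR 1); lia).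
  assert (HE : 1 <= E) by (apply (le_INR 1); lia).
  assert (HDE : 0 < D * E) by (apply Rmult_lt_0_compat; lra).
  rewrite mult_INR. fold D E.
  assert (HX : 0 < y * (D * E)) by now apply Rmult_lt_0_compat.
  assert (B := exp_le_Rpower (INR k + 3) _ ltac:(lra) HX).
  replace (- (y * (D * E))) with (- y * (D * E)) in B by ring.
  rewrite <- Rpower_mult_distr in B by trivial.
  assert (EQ : Rpower (D * E) (- (INR k + 3)) = / (D * E) ^ (k + 3)).
  { rewrite Rpower_Ropp. replace (INR k + 3) with (INR (k + 3)) by (rewrite plus_INR; simpl; ring).
    now rewrite Rpower_pow. }
  rewrite EQ in B. clear EQ.
  set (A := Rpower (INR k + 3) (INR k + 3)) in *. set (Y := Rpower y (- (INR k + 3))) in *.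
  assert (HA : 0 < A) by apply exp_pos. assert (HY : 0 < Y) by apply exp_pos.
  rewrite !Rabs_mult. rewrite (Rabs_pos_eq (D ^ k)) by (apply pow_le; lra).
  rewrite (Rabs_pos_eq (exp _)) by (apply Rlt_le, exp_pos).
  apply Rle_trans with (D ^ k * exp (- y * (D * E))).
  - apply Rmult_le_compat_r; [apply Rlt_le, exp_pos|].
    assert (HDk : 0 <= D ^ k) by (apply pow_le; lra).
    generalize (Rabs_sin_1 (2 * PI * D * th)) (Rabs_cos_1 (2 * PI * E * psi))
      (Rabs_pos (sin (2 * PI * D * th))) (Rabs_pos (cos (2 * PI * E * psi))). intros.
    rewrite Rmult_assoc. rewrite <- (Rmult_1_r (D ^ k)) at 2. apply Rmult_le_compat_l; trivial. nra.
  - apply Rle_trans with (D ^ k * (A * (Y * / (D * E) ^ (k + 3)))).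
    + apply Rmult_le_compat_l; [apply pow_le; lra|exact B].
    + rewrite pow_add. rewrite (Rpow_mult_distr D E k).
      assert (HDk : 0 < D ^ k) by (apply pow_lt; lra).
      assert (HEk : 1 <= E ^ k) by (apply pow_R1_Rle; lra).
      replace (D ^ k * (A * (Y * / (D ^ k * E ^ k * (D * E) ^ 3)))) with
       (A * Y * (/ D ^ 2 * / E ^ 2) * / (D * E) * / E ^ k) by (field; repeat split; lra).
      rewrite <- Rmult_1_r. apply Rmult_le_compat_l.
      * repeat apply Rmult_le_pos; try lra; apply Rlt_le, Rinv_0_lt_compat; trivial; apply pow_lt; lra.
      * rewrite <- Rinv_1. apply Rinv_le_contravar; lra.
Qed.

(** The partial sums over n fill the region under a hyperbola, whereas [double_series] controls
    squares. In eps, the part with 1 / (N + 1) pays for the pairs of the square beyond the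
    hyperbola, the part with [double_eps] for those outside the square. *)
Lemma lambert_estimate (k : nat) (th psi : R) :
  exists eps : nat -> R, is_lim_seq eps 0 /\ forall y, 0 < y ->
    exists L : R, is_series (fun e => Series (fun d => lambert_term k th psi y (S d) (S e))) L /\
     (forall e, ex_series (fun d => lambert_term k th psi y (S d) (S e))) /\
     forall N, Rabs (lambert_sum k th psi y N - L) <= eps N * Rpower y (- (INR k + 3)).
Proof.
  destruct ex_series_inv_sq as [P HP].
  set (p := fun d => / INR (S d) ^ 2) in *.
  assert (Hp : forall d, 0 <= p d).
  { intro d. apply Rlt_le, Rinv_0_lt_compat, pow_lt, lt_0_INR; lia. }
  assert (HP0 : 0 <= P).
  { apply Rle_trans with (sum_n p 0); [rewrite sum_O_R; apply Hp|now apply is_series_partial_le]. }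
  set (A := Rpower (INR k + 3) (INR k + 3)). assert (HA : 0 < A) by apply exp_pos.
  exists (fun N => A * (P * P * / INR (S N) + double_eps p p P P N)). split.
  { replace (Finite 0) with (Finite (A * (0 + 0))) by (f_equal; ring).
    apply (is_lim_seq_scal_l _ _ (Finite _)). apply is_lim_seq_plus'.
    - apply is_lim_seq_scal_0. exact is_lim_seq_inv_S.
    - now apply double_eps_lim. }
  intros y Hy. set (Y := Rpower y (- (INR k + 3))). assert (HY : 0 < Y) by apply exp_pos.
  assert (HAY : 0 < A * Y) by now apply Rmult_lt_0_compat.
  assert (Hpp : forall d e, 0 <= p d * p e) by (intros; now apply Rmult_le_pos).
  assert (Hb : forall d e, Rabs (lambert_term k th psi y (S d) (S e)) <= A * Y * (p d * p e) * / INR (S d * S e)).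
  { intros d e. now apply lambert_term_bound. }
  destruct (double_series p p P P Hp Hp HP HP (fun d e => lambert_term k th psi y (S d) (S e)) (A * Y)) as [L [HL [HE HN]]].
  - lra.
  - intros d e. eapply Rle_trans; [apply Hb|]. rewrite <- Rmult_1_r. apply Rmult_le_compat_l.
    + apply Rmult_le_pos; [lra|apply Hpp].
    + rewrite <- Rinv_1. apply Rinv_le_contravar; [lra|]. apply (le_INR 1). nia.
  - exists L. split; [exact HL|]. split; [exact HE|]. intro N.
    replace (lambert_sum k th psi y N - L) with
     ((lambert_sum k th psi y N - sum_n (fun m => sum_n (fun n => lambert_term k th psi y (S m) (S n)) N) N)
      + (sum_n (fun m => sum_n (fun n => lambert_term k th psi y (S m) (S n)) N) N - L)) by ring.
    eapply Rle_trans; [apply Rabs_triang|].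
    replace (A * (P * P * / INR (S N) + double_eps p p P P N) * Y) with
      (A * Y * P * P * / INR (S N) + A * Y * double_eps p p P P N) by ring.
    apply Rplus_le_compat; [|apply HN].
    rewrite lambert_sum_divisor, (divisor_sum_hyperbola (lambert_term k th psi y) N N) by trivial.
    assert (HSN : 0 < INR (S N)) by (apply lt_0_INR; lia).
    assert (HSNi : 0 < / INR (S N)) by now apply Rinv_0_lt_compat.
    (* Written termwise, the difference vanishes under the hyperbola and is minus the term beyond
       it. *)
    match goal with |- Rabs (?a - ?b) <= _ => replace (a - b) with
      (sum_n (fun d => sum_n (fun e => (if (S d * S e <=? S N)%nat then lambert_term k th psi y (S d) (S e) else 0)
           + (-1) * lambert_term k th psi y (S d) (S e)) N) N : R) end.
    2: { transitivity (sum_n (fun d => sum_n (fun e => if (S d * S e <=? S N)%nat then lambert_term k th psi y (S d) (S e) else 0) N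
           + (-1) * sum_n (fun e => lambert_term k th psi y (S d) (S e)) N) N : R).
         - apply sum_n_ext; intro d. rewrite sum_n_plus_R, sum_n_mult_l_R. reflexivity.
         - rewrite sum_n_plus_R, sum_n_mult_l_R. ring_R. }
    eapply Rle_trans; [apply Rabs_sum_n|].
    apply Rle_trans with (sum_n (fun d => A * Y * P * / INR (S N) * p d) N).
    + apply sum_n_le_R. intros d _. eapply Rle_trans; [apply Rabs_sum_n|].
      apply Rle_trans with (sum_n (fun e => A * Y * / INR (S N) * p d * p e) N).
      * apply sum_n_le_R. intros e _.
        assert (Hnn : 0 <= A * Y * / INR (S N) * p d * p e).
        { rewrite Rmult_assoc. apply Rmult_le_pos; [|apply Hpp]. apply Rmult_le_pos; lra. }
        destruct (Nat.leb_spec (S d * S e) (S N)) as [H|H].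
        -- replace (lambert_term k th psi y (S d) (S e) + -1 * lambert_term k th psi y (S d) (S e)) with 0 by ring.
           rewrite Rabs_R0. exact Hnn.
        -- replace (0 + -1 * lambert_term k th psi y (S d) (S e)) with (- lambert_term k th psi y (S d) (S e)) by ring.
           rewrite Rabs_Ropp. eapply Rle_trans; [apply Hb|].
           replace (A * Y * / INR (S N) * p d * p e) with (A * Y * (p d * p e) * / INR (S N)) by ring.
           apply Rmult_le_compat_l; [apply Rmult_le_pos; [lra|apply Hpp]|].
           apply Rinv_le_contravar; trivial. apply le_INR; lia.
      * rewrite sum_n_mult_l_R.
        replace (A * Y * P * / INR (S N) * p d) with (A * Y * / INR (S N) * p d * P) by ring.
        apply Rmult_le_compat_l; [|now apply is_series_partial_le].
        apply Rmult_le_pos; [apply Rmult_le_pos; lra|apply Hp].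
    + rewrite sum_n_mult_l_R.
      replace (A * Y * P * P * / INR (S N)) with (A * Y * P * / INR (S N) * P) by ring.
      apply Rmult_le_compat_l; [|now apply is_series_partial_le].
      apply Rmult_le_pos; [apply Rmult_le_pos; lra|lra].
Qed.

(** The exponent k + 1 + d leaves u^(-(1 + d)), which is summable for any d > 0. It must stay this
    close to k + 1: after multiplication by the w^(k+1) of the transformation formula only w^(-d)
    remains, which has to be integrable against e^(nu s). *)
Lemma lattice_exp_bound (k : nat) (d w u v : R) : 0 < d -> 0 < w -> 0 < u -> 0 < v ->
  0 <= lattice_exp k w u v <= Rpower (INR k + 1 + d) (INR k + 1 + d) * Rpower w (- (INR k + 1 + d))
     * (Rpower v (- (1 + (INR k + d))) * Rpower u (- (1 + d))).
Proof.
  intros Hd Hw Hu Hv. assert (Hk := pos_INR k). unfold lattice_exp.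
  assert (HP : 0 < u ^ k) by now apply pow_lt.
  split. { apply Rmult_le_pos; [lra|apply Rlt_le, exp_pos]. }
  assert (HX : 0 < w * (u * v)) by (repeat apply Rmult_lt_0_compat; trivial).
  assert (B := exp_le_Rpower (INR k + 1 + d) _ ltac:(lra) HX).
  replace (- (w * (u * v))) with (- w * (u * v)) in B by ring.
  rewrite <- !Rpower_mult_distr in B; trivial; [|now apply Rmult_lt_0_compat].
  apply (Rmult_le_compat_l (u ^ k)) in B; [|lra].
  eapply Rle_trans; [exact B|]. apply Req_le.
  replace (Rpower u (- (1 + d))) with (u ^ k * Rpower u (- (INR k + 1 + d))).
  - replace (- (1 + (INR k + d))) with (- (INR k + 1 + d)) by ring. ring.
  - rewrite <- Rpower_pow by trivial. rewrite <- Rpower_plus. f_equal. ring.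
Qed.

Lemma ex_series_Rpower_refl (a e : R) : 0 < e -> 0 < a < 1 ->
  ex_series (fun n => Rpower (INR n + a) (- (1 + e)) + Rpower (INR n + 1 - a) (- (1 + e))).
Proof.
  intros He Ha. apply (ex_series_plus (fun n => Rpower (INR n + a) (- (1 + e)))).
  - apply ex_series_Rpower; lra.
  - eapply ex_series_ext; [|apply (ex_series_Rpower e (1 - a)); lra].
    intro n. simpl. f_equal. ring.
Qed.

Lemma lattice_estimate (k : nat) (th psi d : R) : 0 < d -> 0 < th < 1 -> 0 < psi < 1 ->
  exists eps : nat -> R, is_lim_seq eps 0 /\ forall w, 0 < w ->
    exists L : R, is_series (fun n => Series (fun m => lattice_term k w th psi m n)) L /\
     forall N, Rabs (lattice_sum k w th psi N - L) <= eps N * Rpower w (- (INR k + 1 + d)).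
Proof.
  intros Hd Hth Hpsi. assert (Hk := pos_INR k).
  destruct (ex_series_Rpower_refl th (INR k + d)) as [P HP]; try lra.
  destruct (ex_series_Rpower_refl psi d) as [Q HQ]; try lra.
  set (p := fun n => Rpower (INR n + th) (- (1 + (INR k + d))) + Rpower (INR n + 1 - th) (- (1 + (INR k + d)))) in *.
  set (q := fun n => Rpower (INR n + psi) (- (1 + d)) + Rpower (INR n + 1 - psi) (- (1 + d))) in *.
  assert (Hp : forall n, 0 <= p n) by (intro n; apply Rlt_le, Rplus_lt_0_compat; apply exp_pos).
  assert (Hq : forall n, 0 <= q n) by (intro n; apply Rlt_le, Rplus_lt_0_compat; apply exp_pos).
  set (A := Rpower (INR k + 1 + d) (INR k + 1 + d)). assert (HA : 0 < A) by apply exp_pos.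
  exists (fun N => A * double_eps p q P Q N). split.
  { apply is_lim_seq_scal_0. now apply double_eps_lim. }
  intros w Hw.
  assert (HW : 0 < Rpower w (- (INR k + 1 + d))) by apply exp_pos.
  destruct (double_series p q P Q Hp Hq HP HQ (lattice_term k w th psi) (A * Rpower w (- (INR k + 1 + d)))) as [L [HL [_ HN]]].
  - apply Rmult_le_pos; lra.
  - intros m n. unfold lattice_term.
    assert (H1 := pos_INR m). assert (H2 := pos_INR n).
    assert (B1 := lattice_exp_bound k d w (INR n + psi) (INR m + th) Hd Hw ltac:(lra) ltac:(lra)).
    assert (B2 := lattice_exp_bound k d w (INR n + 1 - psi) (INR m + th) Hd Hw ltac:(lra) ltac:(lra)).
    assert (B3 := lattice_exp_bound k d w (INR n + 1 - psi) (INR m + 1 - th) Hd Hw ltac:(lra) ltac:(lra)).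
    assert (B4 := lattice_exp_bound k d w (INR n + psi) (INR m + 1 - th) Hd Hw ltac:(lra) ltac:(lra)).
    fold A in B1, B2, B3, B4. unfold p, q. apply Rabs_le.
    rewrite !Rmult_plus_distr_l, !Rmult_plus_distr_r, !Rmult_plus_distr_l. lra.
  - exists L. split; [exact HL|]. intro N. rewrite Rmult_assoc, (Rmult_comm (double_eps _ _ _ _ _)), <- Rmult_assoc.
    apply HN.
Qed.

Lemma profile_is_series (j : nat) (w th u : R) : 0 < w -> 0 < u ->
  is_series (fun m => lattice_exp (2 * j) w u (INR m + th) - lattice_exp (2 * j) w u (INR m + 1 - th)) (profile j w th u).
Proof.
  intros Hw Hu.
  change (is_lim_seq (sum_n (fun m => lattice_exp (2 * j) w u (INR m + th) - lattice_exp (2 * j) w u (INR m + 1 - th))) (profile j w th u)).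
  apply (is_lim_seq_ext (fun M => profile j w th u - profile j w th u * exp (- (w * u) * INR (S M)))).
  - intro M.
    replace (exp (- (w * u) * INR (S M))) with (exp (- (w * INR (S M)) * u)) by (f_equal; ring).
    rewrite (Rmult_comm (profile j w th u)), <- (profile_remainder j w th Hw).
    transitivity (sum_n (fun m => u ^ (2 * j) * exp (- (w * (INR m + th)) * u)
     - u ^ (2 * j) * exp (- (w * (INR m + 1 - th)) * u)) M : R); [ring_R|].
    apply sum_n_ext. intro m. unfold lattice_exp.
    replace (- w * (u * (INR m + th))) with (- (w * (INR m + th)) * u) by ring.
    replace (- w * (u * (INR m + 1 - th))) with (- (w * (INR m + 1 - th)) * u) by ring. reflexivity.
  - replace (Finite (profile j w th u)) with (Finite (profile j w th u - 0)) by (f_equal; ring).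
    apply is_lim_seq_minus'; [apply is_lim_seq_const|]. apply is_lim_seq_scal_0.
    apply (is_lim_seq_incr_1 (fun n => exp (- (w * u) * INR n))). apply exp_INR_lim. now apply Rmult_lt_0_compat.
Qed.

(** [poisson_profile] computes R0 from the coefficients [ghat]; frequency zero contributes Z, the
    others contribute S0, and the equation is solved for S0. The argument 4 pi^2 / w arises as the
    product of lam = 2 pi / w and the frequency 2 pi e. *)
Lemma lambert_lattice (j : nat) (w th psi S0 R0 Z : R) : 0 < w -> 0 < th < 1 -> 0 < psi < 1 ->
  is_series (fun e => Series (fun d => lambert_term (2 * j) th psi (4 * PI ^ 2 / w) (S d) (S e))) S0 ->
  (forall e, ex_series (fun d => INR (S d) ^ (2 * j) * sin (2 * PI * INR (S d) * th)
       * exp (- (2 * PI / w * freq e) * INR (S d)))) ->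
  is_series (fun n => Series (fun m => lattice_term (2 * j) w th psi m n)) R0 ->
  is_lim_seq (sum_n (fun m => / (INR m + th) ^ S (2 * j) - / (INR m + 1 - th) ^ S (2 * j))) Z ->
  S0 = (-1) ^ j * ((w / (2 * PI)) ^ S (2 * j) / 4 * R0
        - INR (fact (2 * j)) * Z / (2 * (2 * PI) ^ S (2 * j))).
Proof.
  intros Hw Hth Hpsi HS HG HR HZ. assert (HPI := PI_RGT_0).
  destruct (profile_decay j w th Hw Hth) as [K [c [HK [Hc Hg]]]].
  set (lam := 2 * PI / w). assert (Hlam : 0 < lam) by (apply Rdiv_lt_0_compat; lra).
  set (k := (2 * j)%nat) in *.
  assert (Hlk : lam ^ S k <> 0) by (apply pow_nonzero; lra).
  assert (Hm1 : (-1) ^ j * (-1) ^ j = 1).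
  { rewrite <- Rpow_mult_distr. replace (-1 * -1) with 1 by ring. apply pow1. }
  set (G := fun e => Series (fun d => INR (S d) ^ k * sin (2 * PI * INR (S d) * th) * exp (- (lam * freq e) * INR (S d)))).
  (* The same partial sums over m tend to [ghat] by [ghat_sum] and to the series over d by
     [lipschitz_sum_cos]. *)
  assert (Hgh : forall e, ghat j w th (freq e) = (-1) ^ j * lam ^ S k * G e).
  { intro e. assert (L1 := ghat_sum j w th K c Hw HK Hc Hth Hg (freq e)).
    assert (L2 := lipschitz_sum_cos j w (freq e) th (G e) Hw (freq_pos e) Hth (Series_correct _ (HG e))).
    exact (is_lim_seq_inj _ _ _ L1 L2). }
  (* At frequency zero there is no series over d: the transforms are k! / (w u)^(k+1), and the
     paired sum over m is that of the zeta difference. *)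
  assert (Hgh0 : ghat j w th 0 = INR (fact k) / w ^ S k * Z).
  { assert (L1 := ghat_sum j w th K c Hw HK Hc Hth Hg 0).
    assert (L2 : is_lim_seq (fun N => sum_n (fun m => lapc k (w * (INR m + th)) 0 - lapc k (w * (INR m + 1 - th)) 0) N)
       (INR (fact k) / w ^ S k * Z)).
    { apply (is_lim_seq_ext (fun N => INR (fact k) / w ^ S k * sum_n (fun m => / (INR m + th) ^ S k - / (INR m + 1 - th) ^ S k) N)).
      - intro N. rewrite <- sum_n_mult_l_R. apply sum_n_ext. intro m.
        assert (Hm := pos_INR m).
        assert (E : forall x, 0 < x -> lapc k (w * x) 0 = INR (fact k) / w ^ S k * / x ^ S k).
        { intros x Hx. rewrite (proj1 (lap_om0 k (w * x) (Rmult_lt_0_compat _ _ Hw Hx))), Rpow_mult_distr.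
          field. split; apply pow_nonzero; lra. }
        rewrite !E by lra. ring_R.
      - now apply (is_lim_seq_scal_l _ _ (Finite _)). }
    exact (is_lim_seq_inj _ _ _ L1 L2). }
  assert (HR' : is_series (fun n => profile j w th (INR n + psi) + profile j w th (INR n + 1 - psi)) R0).
  { eapply is_series_ext; [|exact HR]. intro n. assert (Hn := pos_INR n).
    apply (is_series_unique (fun m => lattice_term k w th psi m n)).
    eapply is_series_ext; [|apply (is_series_plus _ _ _ _ (profile_is_series j w th (INR n + psi) Hw ltac:(lra))
       (profile_is_series j w th (INR n + 1 - psi) Hw ltac:(lra)))].
    intro m. unfold lattice_term, k.
    match goal with |- plus ?a ?b = ?r => change (a + b = r) end. ring_R. }
  assert (L1 := poisson_profile j w th psi K c Hw HK Hc Hpsi Hg R0 HR').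
  assert (L2 : is_lim_seq (fun N => 2 * ghat j w th 0
    + 2 * sum_n (fun n => 2 * cos (freq n * psi) * ghat j w th (freq n)) N)
     (2 * ghat j w th 0 + 4 * ((-1) ^ j * lam ^ S k) * S0)).
  { apply (is_lim_seq_ext (fun N => 2 * ghat j w th 0 + 4 * ((-1) ^ j * lam ^ S k) *
       sum_n (fun e => Series (fun d => lambert_term k th psi (4 * PI ^ 2 / w) (S d) (S e))) N)).
    - intro N. f_equal. replace (4 * ((-1) ^ j * lam ^ S k)) with (2 * (2 * ((-1) ^ j * lam ^ S k))) by ring.
      rewrite Rmult_assoc. f_equal. rewrite <- sum_n_mult_l_R. apply sum_n_ext. intro e.
      rewrite Hgh.
      replace (Series (fun d => lambert_term k th psi (4 * PI ^ 2 / w) (S d) (S e))) with (cos (freq e * psi) * G e);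
        [generalize (lam ^ S k) ((-1) ^ j) (G e); intros; ring_R|].
      unfold G. rewrite <- Series_scal_l. apply Series_ext. intro d. unfold lambert_term, lam, freq.
      replace (- (2 * PI / w * (2 * PI * INR (S e))) * INR (S d)) with (- (4 * PI ^ 2 / w) * (INR (S d) * INR (S e))) by (field; lra).
      ring.
    - apply is_lim_seq_plus'; [apply is_lim_seq_const|]. apply (is_lim_seq_scal_l _ _ (Finite _)). exact HS. }
  rewrite (is_lim_seq_inj _ _ _ L1 L2), Hgh0. unfold lam, Rdiv. rewrite !Rpow_mult_distr, !pow_inv, !Rpow_mult_distr.
  assert (Hw' : w ^ S k <> 0) by (apply pow_nonzero; lra).
  assert (H2' : 2 ^ S k <> 0) by (apply pow_nonzero; lra).
  assert (HP' : PI ^ S k <> 0) by (apply pow_nonzero; lra).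
  transitivity (((-1) ^ j * (-1) ^ j) * S0); [rewrite Hm1; ring|].
  revert Hw' H2' HP'. generalize (w ^ S k) (2 ^ S k) (PI ^ S k) ((-1) ^ j) (INR (fact k)).
  intros. field. repeat split; trivial.
Qed.

(** * The difference of zeta values as a paired series *)

Lemma Rpower_le_neg (s x y : R) : 0 <= s -> 0 < x <= y -> Rpower y (- s) <= Rpower x (- s).
Proof.
  intros Hs [Hx Hxy]. rewrite !Rpower_Ropp. apply Rinv_le_contravar; [apply exp_pos|].
  apply Rle_Rpower_l; lra.
Qed.

Definition zeta_partial (th s : R) (N : nat) : R :=
  sum_n (fun n => Rpower (INR n + th) (- s) - Rpower (INR n + 1 - th) (- s)) N.

(** Both n + th and n + 1 - th lie between n and n + 1, so a paired term is at most n^(-s) - (n +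
    1)^(-s), which telescopes. The bound is uniform in s >= 1; this gives convergence at s = 1 and
    continuity there from the right. *)
Lemma zeta_partial_cauchy (th s : R) (N M : nat) : 0 < th < 1 -> 1 <= s -> (N <= M)%nat ->
  Rabs (zeta_partial th s M - zeta_partial th s N) <= / INR (S N).
Proof.
  intros Hth Hs H.
  assert (HN : 1 <= INR (S N)) by (apply (le_INR 1); lia).
  apply Rle_trans with (Rpower (INR (S N)) (- s) - Rpower (INR (S M)) (- s)).
  - induction H as [|M H IH].
    + rewrite Rminus_diag, Rabs_R0. lra.
    + unfold zeta_partial in *. rewrite sum_Sn_R.
      match goal with |- Rabs (?a + ?b - ?c) <= _ => replace (a + b - c) with ((a - c) + b) by ring end.
      eapply Rle_trans; [apply Rabs_triang|].
      assert (HM : 1 <= INR (S M)) by (apply (le_INR 1); lia).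
      assert (B1 := Rpower_le_neg s (INR (S M)) (INR (S M) + th)).
      assert (B2 := Rpower_le_neg s (INR (S M)) (INR (S M) + 1 - th)).
      assert (B3 := Rpower_le_neg s (INR (S M) + th) (INR (S (S M)))).
      assert (B4 := Rpower_le_neg s (INR (S M) + 1 - th) (INR (S (S M)))).
      assert (E : INR (S (S M)) = INR (S M) + 1) by apply S_INR.
      assert (Rabs (Rpower (INR (S M) + th) (- s) - Rpower (INR (S M) + 1 - th) (- s))
        <= Rpower (INR (S M)) (- s) - Rpower (INR (S (S M))) (- s)) by (apply Rabs_le; lra).
      lra.
  - assert (0 < Rpower (INR (S M)) (- s)) by apply exp_pos.
    rewrite (Rpower_Ropp (INR (S N))).
    assert (INR (S N) <= Rpower (INR (S N)) s).
    { rewrite <- (Rpower_1 (INR (S N))) at 1 by lra. apply Rle_Rpower; lra. }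
    assert (/ Rpower (INR (S N)) s <= / INR (S N)) by (apply Rinv_le_contravar; lra).
    lra.
Qed.

Lemma zeta_partial_lim (th s Z : R) (N : nat) : 0 < th < 1 -> 1 <= s ->
  is_lim_seq (zeta_partial th s) Z -> Rabs (Z - zeta_partial th s N) <= / INR (S N).
Proof.
  intros Hth Hs HZ.
  assert (L : is_lim_seq (fun M => Rabs (zeta_partial th s M - zeta_partial th s N)) (Rabs (Z - zeta_partial th s N))).
  { apply (is_lim_seq_abs _ (Finite _)), is_lim_seq_minus'; [exact HZ|apply is_lim_seq_const]. }
  refine (is_lim_seq_le_loc _ _ (Finite _) (Finite _) _ L (is_lim_seq_const _)).
  exists N. intros M HM. now apply zeta_partial_cauchy.
Qed.

Lemma hurwitz_zeta_lim (th s : R) : 0 < th < 1 -> 1 < s ->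
  is_lim_seq (zeta_partial th s) (hurwitz_zeta s th - hurwitz_zeta s (1 - th)).
Proof.
  intros Hth Hs.
  assert (E : forall a, 0 < a -> is_series (fun n => Rpower (INR n + a) (- s)) (hurwitz_zeta s a)).
  { intros a Ha. apply Series_correct. replace s with (1 + (s - 1)) by ring. apply ex_series_Rpower; lra. }
  assert (H := is_series_minus _ _ _ _ (E th ltac:(lra)) (E (1 - th) ltac:(lra))).
  apply (is_lim_seq_ext (sum_n (fun n => minus (Rpower (INR n + th) (- s)) (Rpower (INR n + (1 - th)) (- s))))).
  - intro N. apply sum_n_ext. intro n. replace (INR n + (1 - th)) with (INR n + 1 - th) by ring. reflexivity.
  - exact H.
Qed.

Lemma continuous_zeta_partial (th s : R) (N : nat) : continuous (fun s => zeta_partial th s N) s.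
Proof.
  assert (T : forall n, continuous (fun s => Rpower (INR n + th) (- s) - Rpower (INR n + 1 - th) (- s)) s).
  { intro n. continuous_derive. }
  exact (continuous_sum_n _ N s T).
Qed.

Lemma inv_INR_small (eps : R) : 0 < eps -> exists N, / INR (S N) < eps.
Proof.
  intro He. destruct (nfloor_ex (/ eps)) as [n [_ Hn]]; [apply Rlt_le, Rinv_0_lt_compat, He|].
  exists n. rewrite S_INR. rewrite <- (Rinv_inv eps). apply Rinv_lt_contravar; [|lra].
  apply Rmult_lt_0_compat; [now apply Rinv_0_lt_compat|]. generalize (pos_INR n); lra.
Qed.

(** The limits s -> 1 and N -> infinity are exchanged: N is chosen by the uniform tail bound, which
    costs eps / 4 at s = 1 and again at 1 + |h|, and continuity of the N-th partial sum in s costs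
    eps / 2. *)
Lemma zeta_diff_0_lim (th : R) : 0 < th < 1 -> is_lim_seq (zeta_partial th 1) (zeta_diff 0 th).
Proof.
  intro Hth.
  assert (EZ : ex_finite_lim_seq (zeta_partial th 1)).
  { apply ex_lim_seq_cauchy_corr. intro eps.
    assert (He := cond_pos eps).
    destruct (inv_INR_small (eps / 2)) as [N HN]; [lra|].
    exists N. intros n m Hn Hm.
    assert (B1 := zeta_partial_cauchy th 1 N n Hth (Rle_refl 1) Hn).
    assert (B2 := zeta_partial_cauchy th 1 N m Hth (Rle_refl 1) Hm).
    replace (zeta_partial th 1 n - zeta_partial th 1 m) with
     ((zeta_partial th 1 n - zeta_partial th 1 N) + - (zeta_partial th 1 m - zeta_partial th 1 N)) by ring.
    eapply Rle_lt_trans; [apply Rabs_triang|]. rewrite Rabs_Ropp. lra. }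
  destruct EZ as [Z HZ].
  replace (zeta_diff 0 th) with Z; trivial. symmetry.
  unfold zeta_diff. simpl Nat.eqb. cbv iota.
  assert (L : is_lim (fun h => hurwitz_zeta (1 + Rabs h) th - hurwitz_zeta (1 + Rabs h) (1 - th)) 0 Z).
  { apply is_lim_spec. intro eps. assert (He := cond_pos eps).
    destruct (inv_INR_small (eps / 4)) as [N HN]; [lra|].
    assert (C : continuous (fun h => zeta_partial th (1 + Rabs h) N) 0).
    { apply (continuous_comp (fun h => 1 + Rabs h) (fun s => zeta_partial th s N)); [|apply continuous_zeta_partial].
      apply continuous_Rplus; [apply continuous_const|apply continuous_Rabs]. }
    assert (He4 : 0 < eps / 2) by lra.
    assert (C2 := proj1 (filterlim_locally _ _) C (mkposreal _ He4)).
    destruct C2 as [d Hd]. exists d. intros h Hh Hh0.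
    specialize (Hd h Hh). unfold ball in Hd; simpl in Hd; unfold AbsRing_ball, minus, plus, opp, abs in Hd; simpl in Hd.
    rewrite Rabs_R0, Rplus_0_r in Hd.
    assert (Hs : 1 < 1 + Rabs h) by (generalize (Rabs_pos_lt h Hh0); lra).
    assert (B1 := zeta_partial_lim th 1 Z N Hth (Rle_refl 1) HZ).
    assert (B2 := zeta_partial_lim th _ _ N Hth (Rlt_le _ _ Hs) (hurwitz_zeta_lim th _ Hth Hs)).
    set (H := hurwitz_zeta (1 + Rabs h) th - hurwitz_zeta (1 + Rabs h) (1 - th)) in *.
    apply Rabs_le_between in B1. apply Rabs_le_between in B2. apply Rabs_def2 in Hd. apply Rabs_def1; lra. }
  now rewrite (is_lim_unique _ _ _ L).
Qed.

Lemma zeta_diff_lim (k : nat) (th : R) : 0 < th < 1 ->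
  is_lim_seq (sum_n (fun m => / (INR m + th) ^ S k - / (INR m + 1 - th) ^ S k)) (zeta_diff k th).
Proof.
  intro Hth.
  apply (is_lim_seq_ext (zeta_partial th (1 + INR k))).
  - intro N. apply sum_n_ext. intro n. assert (Hn := pos_INR n).
    replace (1 + INR k) with (INR (S k)) by (rewrite S_INR; ring).
    rewrite !Rpower_Ropp, !Rpower_pow by lra. reflexivity.
  - destruct k as [|k].
    + simpl INR. rewrite Rplus_0_r. now apply zeta_diff_0_lim.
    + assert (0 < INR (S k)) by (apply lt_0_INR; lia). apply hurwitz_zeta_lim; lra.
Qed.

(** * The transformation formula for partial sums *)

(** The exact formula cancels between the two limits, so only the two truncation errors remain. The
    sequence eps is chosen before w, which is what allows the inequality to be integrated. *)
Lemma lambert_lattice_estimate (j : nat) (th psi d : R) : 0 < d -> 0 < th < 1 -> 0 < psi < 1 ->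
  exists eps : nat -> R, is_lim_seq eps 0 /\ forall w N, 0 < w ->
   Rabs (lambert_sum (2 * j) th psi (4 * PI ^ 2 / w) N
     - (-1) ^ j * ((w / (2 * PI)) ^ S (2 * j) / 4 * lattice_sum (2 * j) w th psi N
        - INR (fact (2 * j)) * zeta_diff (2 * j) th / (2 * (2 * PI) ^ S (2 * j))))
   <= eps N * (Rpower (4 * PI ^ 2 / w) (- (INR (2 * j) + 3)) + Rpower w (- d)).
Proof.
  intros Hd Hth Hpsi. assert (HPI := PI_RGT_0).
  destruct (lambert_estimate (2 * j) th psi) as [e1 [He1 H1]].
  (* With psi = 0 the cosine is 1, so this instance yields summability of the bare series over d for
     each e; for the given psi the cosine factor might vanish. *)
  destruct (lambert_estimate (2 * j) th 0) as [e0 [_ H0]].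
  destruct (lattice_estimate (2 * j) th psi d Hd Hth Hpsi) as [e2 [He2 H2]].
  exists (fun N => Rabs (e1 N) + Rabs (e2 N)). split.
  { replace (Finite 0) with (Finite (0 + 0)) by (f_equal; ring).
    apply is_lim_seq_plus'; [exact (proj1 (is_lim_seq_abs_0 e1) He1)|exact (proj1 (is_lim_seq_abs_0 e2) He2)]. }
  intros w N Hw.
  assert (Hy : 0 < 4 * PI ^ 2 / w).
  { apply Rdiv_lt_0_compat; trivial. generalize (pow_lt PI 2 HPI); lra. }
  destruct (H1 _ Hy) as [L [HL [_ BL]]]. destruct (H2 w Hw) as [R0 [HR BR]].
  assert (HG : forall e, ex_series (fun d => INR (S d) ^ (2 * j) * sin (2 * PI * INR (S d) * th)
       * exp (- (2 * PI / w * freq e) * INR (S d)))).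
  { intro e. destruct (H0 _ Hy) as [_ [_ [HE _]]]. eapply ex_series_ext; [|apply (HE e)].
    intro n. unfold lambert_term, freq. rewrite Rmult_0_r, cos_0, Rmult_1_r. f_equal. f_equal. field. lra. }
  assert (E := lambert_lattice j w th psi L R0 _ Hw Hth Hpsi HL HG HR (zeta_diff_lim (2 * j) th Hth)).
  specialize (BL N). specialize (BR N).
  set (k := (2 * j)%nat) in *. set (w2 := (w / (2 * PI)) ^ S k) in *.
  assert (Hw2 : 0 < w2 <= w ^ S k).
  { split; [apply pow_lt, Rdiv_lt_0_compat; lra|]. apply pow_incr. split; [apply Rlt_le, Rdiv_lt_0_compat; lra|].
    apply Rle_div_l; [lra|]. generalize PI2_3_2; unfold PI2. nra. }
  assert (Hm1 : Rabs ((-1) ^ j) = 1) by apply pow_1_abs.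
  assert (HWd : w ^ S k * Rpower w (- (INR k + 1 + d)) = Rpower w (- d)).
  { rewrite <- (Rpower_pow (S k)) by trivial. rewrite <- Rpower_plus. f_equal. rewrite S_INR. ring. }
  set (Y := Rpower (4 * PI ^ 2 / w) (- (INR k + 3))) in *.
  assert (HY : 0 < Y) by apply exp_pos.
  assert (HD : 0 < Rpower w (- d)) by apply exp_pos.
  set (Z := INR (fact k) * zeta_diff k th / (2 * (2 * PI) ^ S k)) in *.
  replace (lambert_sum k th psi (4 * PI ^ 2 / w) N - (-1) ^ j * (w2 / 4 * lattice_sum k w th psi N - Z))
   with ((lambert_sum k th psi (4 * PI ^ 2 / w) N - L) + (-1) ^ j * (- (w2 / 4) * (lattice_sum k w th psi N - R0)))
   by (rewrite E; ring).
  eapply Rle_trans; [apply Rabs_triang|].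
  rewrite (Rabs_mult ((-1) ^ j)), Hm1, Rmult_1_l, Rabs_mult, Rabs_Ropp, (Rabs_pos_eq (w2 / 4)) by lra.
  assert (P1 := Rabs_pos (e1 N)). assert (P2 := Rabs_pos (e2 N)).
  assert (Q1 : Rabs (lambert_sum k th psi (4 * PI ^ 2 / w) N - L) <= Rabs (e1 N) * Y).
  { eapply Rle_trans; [exact BL|]. apply Rmult_le_compat_r; [lra|apply Rle_abs]. }
  assert (Q2 : w2 / 4 * Rabs (lattice_sum k w th psi N - R0) <= Rabs (e2 N) * Rpower w (- d)).
  { rewrite <- HWd.
    replace (Rabs (e2 N) * (w ^ S k * Rpower w (- (INR k + 1 + d)))) with (w ^ S k * (Rabs (e2 N) * Rpower w (- (INR k + 1 + d)))) by ring.
    apply Rmult_le_compat; [lra|apply Rabs_pos|lra|].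
    eapply Rle_trans; [exact BR|]. apply Rmult_le_compat_r; [apply Rlt_le, exp_pos|apply Rle_abs]. }
  nra.
Qed.

(** * Integrals over the real line *)

Ltac ring_C := match goal with |- ?a = ?b => change (@eq C a b) end; ring.

Local Notation CR := C_R_CompleteNormedModule.
Local Notation CV := C_R_NormedModule.

Lemma norm_C_R (z : C) : @norm R_AbsRing CV z = Cmod z.
Proof.
  change (sqrt (Rabs (fst z) ^ 2 + Rabs (snd z) ^ 2) = sqrt (fst z ^ 2 + snd z ^ 2)).
  now rewrite !pow2_abs.
Qed.

Lemma continuous_pair_C (f g : R -> R) (x : R) : continuous f x -> continuous g x ->
  continuous (U := C_UniformSpace) (fun x => (f x, g x)) x.
Proof.
  intros Hf Hg. apply filterlim_locally. intro eps.
  assert (A := proj1 (filterlim_locally _ _) Hf eps). assert (B := proj1 (filterlim_locally _ _) Hg eps).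
  generalize (filter_and _ _ A B). apply filter_imp. intros y [H1 H2]. now split.
Qed.

Lemma Cmod_Cexp (z : C) : Cmod (Cexp z) = exp (Re z).
Proof.
  unfold Cexp, Cmod. cbn [fst snd].
  replace ((exp (Re z) * cos (Im z)) ^ 2 + (exp (Re z) * sin (Im z)) ^ 2) with
    (exp (Re z) * exp (Re z) * (Rsqr (sin (Im z)) + Rsqr (cos (Im z)))) by (unfold Rsqr; ring).
  rewrite sin2_cos2, Rmult_1_r. apply sqrt_square, Rlt_le, exp_pos.
Qed.

Lemma Cexp_plus (z z' : C) : Cexp (Cplus z z') = Cmult (Cexp z) (Cexp z').
Proof.
  unfold Cexp, Cmult, Cplus, Re, Im. cbn [fst snd]. rewrite exp_plus, cos_plus, sin_plus.
  f_equal; ring.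
Qed.

Lemma Cexp_real (x : R) : Cexp (RtoC x) = RtoC (exp x).
Proof. unfold Cexp, RtoC, Re, Im. cbn [fst snd]. rewrite cos_0, sin_0. f_equal; ring. Qed.

Lemma is_RInt_gen_norm {V : NormedModule R_AbsRing} (f : R -> V) (Fa Fb : (R -> Prop) -> Prop) (l : V) :
  Filter Fa -> Filter Fb ->
  (forall eps, 0 < eps -> filter_prod Fa Fb (fun ab => exists y, is_RInt f (fst ab) (snd ab) y /\ norm (minus y l) < eps)) ->
  is_RInt_gen f Fa Fb l.
Proof.
  intros HFa HFb H P HP.
  destruct (locally_norm_le_locally l P HP) as [eps He].
  unfold filtermapi. refine (filter_imp _ _ _ (H eps (cond_pos eps))). intros ab [y [Hy Hn]]. exists y. split; trivial.
  now apply He.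
Qed.

Lemma is_RInt_reflect (f : R -> C) (a : R) (y : C) :
  is_RInt (V := CV) (fun s => f (- s)) 0 (- a) y -> is_RInt (V := CV) f a 0 y.
Proof.
  intro I.
  assert (I' : is_RInt (V := CV) (fun s => f (- s)) (-1 * 0 + 0) (-1 * a + 0) y).
  { replace (-1 * 0 + 0) with 0 by ring. replace (-1 * a + 0) with (- a) by ring. exact I. }
  apply is_RInt_comp_lin in I'. apply is_RInt_swap in I'. apply is_RInt_opp in I'.
  eapply is_RInt_ext; [|evar_last; [exact I'|]].
  - intros x _. cbv beta. replace (-(-1 * x + 0)) with x by ring.
    unfold scal, opp; simpl. destruct (f x) as [u v].
    unfold prod_scal, prod_opp, scal, opp; simpl; unfold mult; simpl. f_equal; ring.
  - apply opp_opp.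
Qed.

(** The line is cut at 0 and its left half reflected, which reduces both halves to [RInt_decay_lim].
    The bound 2 K / c is what later turns a pointwise error of size eps_N into an error of the
    integrals. *)
Lemma is_RInt_gen_R_exists (f : R -> C) (K c : R) : 0 < c -> 0 <= K ->
  (forall s, continuous (U := C_UniformSpace) f s) ->
  (forall s, Cmod (f s) <= K * exp (- c * Rabs s)) ->
  exists l : C, is_RInt_gen (V := CV) f (Rbar_locally m_infty) (Rbar_locally p_infty) l
    /\ Cmod l <= 2 * K / c.
Proof.
  intros Hc HK Hf Hb.
  destruct (RInt_decay_lim (V := CR) f K c Hc HK) as [l1 H1].
  { intros; apply Hf. }
  { intros x Hx. rewrite norm_C_R. rewrite <- (Rabs_pos_eq x) at 2 by trivial. apply Hb. }
  assert (Hf2 : forall s, continuous (U := C_UniformSpace) (fun s => f (- s)) s).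
  { intro s. apply (continuous_comp (fun s => - s) f); [|apply Hf].
    continuous_derive. }
  destruct (RInt_decay_lim (V := CR) (fun s => f (- s)) K c Hc HK) as [l2 H2].
  { intros; apply Hf2. }
  { intros x Hx. rewrite norm_C_R. rewrite <- (Rabs_pos_eq x) at 2 by trivial. rewrite <- (Rabs_Ropp x). apply Hb. }
  exists (Cplus l1 l2). split.
  - apply is_RInt_gen_norm; try typeclasses eauto.
    intros eps He. assert (He2 : 0 < eps / 2) by lra.
    destruct (exp_decay_eventually (K / c) c (eps / 2) Hc He2) as [M [HM0 HM]].
    exists (fun a => a < - M) (fun b => M < b).
    + now exists (- M).
    + now exists M.
    + intros a b Ha Hb'. cbn [fst snd].
      exists (Cplus (RInt (V := CR) f 0 b) (RInt (V := CR) (fun s => f (- s)) 0 (- a))). split.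
      * rewrite Cplus_comm. apply (is_RInt_Chasles (V := CV) f a 0 b).
        -- apply is_RInt_reflect. apply (RInt_correct (V := CR)), (ex_RInt_continuous (V := CR)). intros; apply Hf2.
        -- apply (RInt_correct (V := CR)), (ex_RInt_continuous (V := CR)). intros; apply Hf.
      * assert (B1 := H1 b ltac:(lra)). assert (B2 := H2 (- a) ltac:(lra)).
        rewrite norm_C_R in B1, B2 |- *.
        change (minus l1 (RInt (V := CR) f 0 b)) with (Cminus l1 (RInt (V := CR) f 0 b)) in B1.
        change (minus l2 (RInt (V := CR) (fun s => f (- s)) 0 (- a))) with (Cminus l2 (RInt (V := CR) (fun s => f (- s)) 0 (- a))) in B2.
        set (u := RInt (V := CR) f 0 b) in *. set (v := RInt (V := CR) (fun s => f (- s)) 0 (- a)) in *.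
        change (Cmod (Cminus (Cplus u v) (Cplus l1 l2)) < eps).
        replace (Cminus (Cplus u v) (Cplus l1 l2)) with (Copp (Cplus (Cminus l1 u) (Cminus l2 v))).
        -- rewrite Cmod_opp. eapply Rle_lt_trans; [apply Cmod_triangle|].
           assert (HA := HM b ltac:(lra)). assert (HB := HM (- a) ltac:(lra)). lra.
        -- unfold Cminus. clearbody u v. destruct u, v, l1, l2. unfold Cplus, Copp; simpl. f_equal; ring.
  - assert (B1 := H1 0 (Rle_refl 0)). assert (B2 := H2 0 (Rle_refl 0)).
    rewrite norm_C_R in B1, B2. rewrite RInt_point in B1, B2. rewrite Rmult_0_r, exp_0, Rmult_1_r in B1, B2.
    assert (E : forall z : C, minus (G := CV) z zero = z).
    { intro z. destruct z. unfold minus, plus, opp, zero; simpl. unfold prod_plus, prod_opp, prod_zero, plus, opp, zero; simpl. f_equal; ring. }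
    rewrite E in B1, B2.
    eapply Rle_trans; [apply Cmod_triangle|]. unfold Rdiv in *. lra.
Qed.

(* Coquelicot's scal-linearity only covers real factors here, since C is
   integrated as a module over R. *)
Lemma is_RInt_gen_Cmult (f : R -> C) (Fa Fb : (R -> Prop) -> Prop) (z l : C) :
  is_RInt_gen (V := CV) f Fa Fb l ->
  is_RInt_gen (V := CV) (fun s => Cmult z (f s)) Fa Fb (Cmult z l).
Proof.
  intros H P HP.
  assert (HP' : locally l (fun y : C => P (Cmult z y))).
  { assert (Hcont : continuous (T := C_UniformSpace) (U := C_UniformSpace) (fun y : C => Cmult z y) l).
    { apply (continuous_scal_r (K := C_AbsRing) (V := C_NormedModule) z (fun y => y)). apply continuous_id. }
    exact (Hcont P HP). }
  destruct (H _ HP') as [Q1 Q2 HQ1 HQ2 HQ]. exists Q1 Q2; trivial.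
  intros a b Ha Hb. destruct (HQ a b Ha Hb) as [y [Hy HPy]]. exists (Cmult z y). split; trivial.
  cbn [fst snd] in *.
  destruct z as [za zb]. destruct y as [ya yb].
  assert (Hy1 := is_RInt_fct_extend_fst _ _ _ _ Hy). assert (Hy2 := is_RInt_fct_extend_snd _ _ _ _ Hy).
  cbn [fst snd] in Hy1, Hy2.
  apply is_RInt_fct_extend_pair.
  - eapply is_RInt_ext; [|exact (is_RInt_minus _ _ _ _ _ _ (is_RInt_scal _ _ _ za _ Hy1) (is_RInt_scal _ _ _ zb _ Hy2))].
    intros x _. reflexivity.
  - eapply is_RInt_ext; [|exact (is_RInt_plus _ _ _ _ _ _ (is_RInt_scal _ _ _ za _ Hy2) (is_RInt_scal _ _ _ zb _ Hy1))].
    intros x _. reflexivity.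
Qed.

(* With t = e^s: the Mellin transform of t |-> h (ln t) at nu. *)
Definition is_mellin (nu : C) (h : R -> R) (l : C) : Prop :=
  is_RInt_gen (V := CV) (fun s => Cmult (Cexp (Cmult nu (RtoC s))) (RtoC (h s)))
    (Rbar_locally m_infty) (Rbar_locally p_infty) l.

Lemma mellin_unique (nu : C) (h : R -> R) (l l' : C) : is_mellin nu h l -> is_mellin nu h l' -> l = l'.
Proof.
  intros H H'.
  transitivity (RInt_gen (V := CR) (fun s => Cmult (Cexp (Cmult nu (RtoC s))) (RtoC (h s)))
    (Rbar_locally m_infty) (Rbar_locally p_infty)).
  - symmetry. now apply (is_RInt_gen_unique (V := CR)).
  - now apply (is_RInt_gen_unique (V := CR)).
Qed.

Lemma mellin_ext (nu nu' : C) (h h' : R -> R) (l : C) :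
  (forall s, Cmult (Cexp (Cmult nu (RtoC s))) (RtoC (h s)) = Cmult (Cexp (Cmult nu' (RtoC s))) (RtoC (h' s))) ->
  is_mellin nu h l -> is_mellin nu' h' l.
Proof.
  intros H. apply is_RInt_gen_ext. exists (fun _ => True) (fun _ => True).
  - now exists 0.
  - now exists 0.
  - intros a b _ _ x _. apply H.
Qed.

Lemma mellin_plus (nu : C) (h h' : R -> R) (l l' : C) : is_mellin nu h l -> is_mellin nu h' l' ->
  is_mellin nu (fun s => h s + h' s) (Cplus l l').
Proof.
  intros H H'. eapply is_RInt_gen_ext; [|exact (is_RInt_gen_plus _ _ _ _ H H')].
  exists (fun _ => True) (fun _ => True); [now exists 0|now exists 0|].
  intros a b _ _ x _. change (Cplus (Cmult (Cexp (Cmult nu (RtoC x))) (RtoC (h x))) (Cmult (Cexp (Cmult nu (RtoC x))) (RtoC (h' x)))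
    = Cmult (Cexp (Cmult nu (RtoC x))) (RtoC (h x + h' x))).
  rewrite RtoC_plus. ring_C.
Qed.

Lemma scal_C_R (x : R) (z : C) : scal (V := CV) x z = Cmult (RtoC x) z.
Proof.
  destruct z as [a b]. change ((x * a, x * b) = (x * a - 0 * b, x * b + 0 * a)). f_equal; ring.
Qed.

Lemma mellin_scal (nu : C) (h : R -> R) (l : C) (x : R) : is_mellin nu h l ->
  is_mellin nu (fun s => x * h s) (Cmult (RtoC x) l).
Proof.
  intros H. rewrite <- scal_C_R. eapply is_RInt_gen_ext; [|exact (is_RInt_gen_scal _ x _ H)].
  exists (fun _ => True) (fun _ => True); [now exists 0|now exists 0|].
  intros a b _ _ s _. etransitivity; [apply scal_C_R|]. rewrite RtoC_mult. ring_C.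
Qed.

Lemma mellin_sum (nu : C) (h : nat -> R -> R) (l : nat -> C) (N : nat) : (forall n, is_mellin nu (h n) (l n)) ->
  is_mellin nu (fun s => sum_n (fun n => h n s) N) (sum_n l N).
Proof.
  intro H. induction N as [|N IH].
  - rewrite sum_O. eapply mellin_ext; [|apply (H 0%nat)]. intro; now rewrite sum_O_R.
  - rewrite sum_Sn. eapply mellin_ext; [|apply mellin_plus; [apply IH|apply (H (S N))]]. intro; now rewrite sum_Sn_R.
Qed.

Lemma continuous_mellin (nu : C) (h : R -> R) (s : R) : continuous h s ->
  continuous (U := C_UniformSpace) (fun s => Cmult (Cexp (Cmult nu (RtoC s))) (RtoC (h s))) s.
Proof.
  intro H. destruct nu as [a b].
  apply (continuous_ext (fun s => (exp (a * s) * cos (b * s) * h s, exp (a * s) * sin (b * s) * h s) : C)).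
  - intro t. unfold Cexp, Cmult, RtoC, Re, Im. cbn [fst snd].
    replace (a * t - b * 0) with (a * t) by ring. replace (a * 0 + b * t) with (b * t) by ring. f_equal; ring.
  - apply continuous_pair_C; apply continuous_Rmult; trivial.
    + continuous_derive.
    + continuous_derive.
Qed.

Lemma mellin_exists (nu : C) (h : R -> R) (K c : R) : 0 < c -> 0 <= K -> (forall s, continuous h s) ->
  (forall s, exp (Re nu * s) * Rabs (h s) <= K * exp (- c * Rabs s)) ->
  exists l, is_mellin nu h l /\ Cmod l <= 2 * K / c.
Proof.
  intros Hc HK Hh Hb. apply (is_RInt_gen_R_exists _ K c); trivial.
  - intro s. now apply continuous_mellin.
  - intro s. rewrite Cmod_mult, Cmod_Cexp, Cmod_R.
    replace (Re (Cmult nu (RtoC s))) with (Re nu * s) by (destruct nu; unfold Cmult, RtoC, Re; simpl; ring).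
    apply Hb.
Qed.

Lemma mellin_shift (nu : C) (h : R -> R) (v : R) (l : C) : is_mellin nu h l ->
  is_mellin nu (fun s => h (s + v)) (Cmult (Cexp (Copp (Cmult nu (RtoC v)))) l).
Proof.
  intro H.
  assert (H2 : is_RInt_gen (V := CV) (fun s => Cmult (Cexp (Cmult nu (RtoC (s + v)))) (RtoC (h (s + v))))
    (Rbar_locally m_infty) (Rbar_locally p_infty) l).
  { intros P HP. destruct (H P HP) as [Q1 Q2 [M1 HQ1] [M2 HQ2] HQ].
    exists (fun a => a < M1 - v) (fun b => M2 - v < b).
    - now exists (M1 - v).
    - now exists (M2 - v).
    - intros a b Ha Hb. destruct (HQ (a + v) (b + v)) as [y [Hy HPy]].
      + apply HQ1; lra.
      + apply HQ2; lra.
      + exists y. split; trivial. cbn [fst snd] in *.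
        assert (Hy' : is_RInt (V := CV) (fun s => Cmult (Cexp (Cmult nu (RtoC s))) (RtoC (h s))) (1 * a + v) (1 * b + v) y).
        { now rewrite !Rmult_1_l. }
        apply is_RInt_comp_lin in Hy'. eapply is_RInt_ext; [|exact Hy'].
        intros x _. etransitivity; [apply scal_C_R|]. rewrite Rmult_1_l. apply Cmult_1_l. }
  set (z := Cexp (Copp (Cmult nu (RtoC v)))).
  assert (Hz : forall s, Cexp (Cmult nu (RtoC s)) = Cmult z (Cexp (Cmult nu (RtoC (s + v))))).
  { intro s. unfold z. rewrite <- Cexp_plus. f_equal. rewrite RtoC_plus. ring. }
  eapply is_RInt_gen_ext; [|exact (is_RInt_gen_Cmult _ _ _ z _ H2)].
  exists (fun _ => True) (fun _ => True); [now exists 0|now exists 0|].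
  intros a b _ _ x _. rewrite (Hz x). ring_C.
Qed.

(** For s < 0 the factor e^(p s) decays by itself. For s >= 0, exp (- e^s) is at most a constant
    times e^(-2 p s): half of this cancels e^(p s), the other half is the decay. *)
Lemma exp_exp_decay (p : R) : 0 < p ->
  exists K, 0 <= K /\ forall s, exp (p * s) * exp (- exp s) <= K * exp (- p * Rabs s).
Proof.
  intro Hp. set (C := Rpower (2 * p) (2 * p)). assert (HC : 0 < C) by apply exp_pos.
  exists (1 + C). split; [lra|]. intro s.
  assert (P := exp_pos (p * s)). assert (P1 := exp_pos s). assert (P2 := exp_pos (- exp s)).
  destruct (Rle_dec 0 s) as [Hs|Hs].
  - rewrite (Rabs_pos_eq s) by trivial.
    assert (B := exp_le_Rpower (2 * p) (exp s) ltac:(lra) P1).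
    fold C in B. unfold Rpower in B. rewrite ln_exp in B.
    apply (Rmult_le_compat_l (exp (p * s))) in B; [|lra].
    replace (exp (p * s) * (C * exp (- (2 * p) * s))) with (C * exp (- p * s)) in B.
    + generalize (exp_pos (- p * s)). nra.
    + replace (- p * s) with (p * s + - (2 * p) * s) by ring. rewrite exp_plus. ring.
  - rewrite (Rabs_left s) by lra. replace (- p * - s) with (p * s) by ring.
    assert (exp (- exp s) <= 1) by (rewrite <- exp_0; apply exp_nondecreasing; lra). nra.
Qed.

Lemma continuous_exp_exp (s : R) : continuous (fun s => exp (- exp s)) s.
Proof. continuous_derive. Qed.

Lemma CGamma_mellin (nu : C) : 0 < Re nu -> is_mellin nu (fun s => exp (- exp s)) (CGamma nu).
Proof.
  intro Hnu. destruct (exp_exp_decay (Re nu) Hnu) as [K [HK HKb]].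
  destruct (mellin_exists nu (fun s => exp (- exp s)) K (Re nu) Hnu HK continuous_exp_exp) as [l [Hl _]].
  { intro s. rewrite (Rabs_pos_eq (exp _)) by (apply Rlt_le, exp_pos). apply HKb. }
  replace (CGamma nu) with l; trivial. symmetry.
  unfold CGamma.
  apply (is_RInt_gen_unique (V := CR)).
  intros P HP. destruct (Hl P HP) as [Q1 Q2 [M1 HQ1] [M2 HQ2] HQ].
  exists (fun a => 0 < a < exp M1) (fun b => exp M2 < b).
  - exists (mkposreal _ (exp_pos M1)). intros y Hy Hy0. split; trivial.
    unfold ball in Hy; simpl in Hy; unfold AbsRing_ball, minus, plus, opp, abs in Hy; simpl in Hy.
    apply Rabs_def2 in Hy. lra.
  - now exists (exp M2).
  - intros a b [Ha Ha1] Hb. assert (Hb0 : 0 < b) by (generalize (exp_pos M2); lra).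
    destruct (HQ (ln a) (ln b)) as [y [Hy HPy]].
    + apply HQ1. rewrite <- (ln_exp M1). now apply ln_increasing.
    + apply HQ2. rewrite <- (ln_exp M2). apply ln_increasing; trivial. apply exp_pos.
    + exists y. split; trivial. cbn [fst snd] in *.
      apply (is_RInt_unique (V := CR)) in Hy.
      assert (Hpos : forall x, Rmin a b <= x -> 0 < x).
      { intros x Hx. assert (0 < Rmin a b) by now apply Rmin_pos. lra. }
      (* The substitution s = ln t: its derivative 1 / t lowers the exponent from nu to nu - 1, and
         [ln] carries a neighbourhood of 0 from the right to one of minus infinity. *)
      assert (I := is_RInt_comp (V := CR) (fun s => Cmult (Cexp (Cmult nu (RtoC s))) (RtoC (exp (- exp s)))) ln (fun t => / t) a b).
      rewrite Hy in I. eapply is_RInt_ext; [|apply I].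
      * intros t [Ht _]. assert (Ht0 : 0 < t) by (apply Hpos; lra).
        etransitivity; [apply scal_C_R|].
        unfold Cpow_pos. rewrite exp_ln by trivial.
        replace (Cmult (Cminus nu 1) (RtoC (ln t))) with (Cplus (RtoC (- ln t)) (Cmult nu (RtoC (ln t)))).
        -- rewrite Cexp_plus, Cexp_real, (exp_Ropp (ln t)), exp_ln by trivial. ring_C.
        -- rewrite RtoC_opp. ring.
      * intros t [Ht _]. apply continuous_mellin, continuous_exp_exp.
      * intros t [Ht _]. specialize (Hpos t Ht). split.
        -- auto_derive; trivial. field. lra.
        -- apply (ex_derive_continuous (fun t => / t)). auto_derive. lra.
Qed.

Lemma Cexp_neq_0 (z : C) : Cexp z <> RtoC 0.
Proof.
  intro H. assert (E := Cmod_Cexp z). rewrite H, Cmod_0 in E. generalize (exp_pos (Re z)). lra.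
Qed.

Lemma Cexp_opp (z : C) : Cexp (Copp z) = Cinv (Cexp z).
Proof.
  assert (E : Cmult (Cexp (Copp z)) (Cexp z) = RtoC 1).
  { rewrite <- Cexp_plus. replace (Cplus (Copp z) z) with (RtoC 0) by ring. rewrite Cexp_real, exp_0. reflexivity. }
  rewrite <- (Cmult_1_l (Cinv (Cexp z))), <- E.
  rewrite <- Cmult_assoc, Cinv_r by apply Cexp_neq_0. ring.
Qed.

Lemma mellin_Gamma_scaled (nu : C) (r : R) : 0 < Re nu -> 0 < r ->
  is_mellin nu (fun s => exp (- (r * exp s))) (Cdiv (CGamma nu) (Cpow_pos r nu)).
Proof.
  intros Hnu Hr.
  assert (H := mellin_shift nu _ (ln r) _ (CGamma_mellin nu Hnu)).
  replace (Cdiv (CGamma nu) (Cpow_pos r nu)) with (Cmult (Cexp (Copp (Cmult nu (RtoC (ln r))))) (CGamma nu)).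
  - eapply mellin_ext; [|exact H]. intro s. cbv beta. rewrite exp_plus, exp_ln by trivial.
    now rewrite (Rmult_comm (exp s)).
  - rewrite Cexp_opp. unfold Cdiv, Cpow_pos. ring.
Qed.

Lemma mellin_weight (nu : C) (m : R) (h : R -> R) (l : C) :
  is_mellin (Cplus nu (RtoC m)) h l -> is_mellin nu (fun s => exp (m * s) * h s) l.
Proof.
  apply mellin_ext. intro s.
  replace (Cmult (Cplus nu (RtoC m)) (RtoC s)) with (Cplus (Cmult nu (RtoC s)) (RtoC (m * s))) by (rewrite RtoC_mult; ring).
  rewrite Cexp_plus, Cexp_real, RtoC_mult. ring.
Qed.

Lemma is_RInt_fold (f : R -> C) (b : R) (y : C) : (forall s, continuous (U := C_UniformSpace) f s) ->
  is_RInt (V := CV) f (- b) b y ->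
  is_RInt (V := CV) (fun t => Cplus (f t) (f (- t))) 0 b y.
Proof.
  intros Hf Hy.
  assert (I1 : is_RInt (V := CV) f 0 b (RInt (V := CR) f 0 b)).
  { apply (RInt_correct (V := CR)), (ex_RInt_continuous (V := CR)). intros; apply Hf. }
  assert (I2 : is_RInt (V := CV) (fun s => f (- s)) 0 b (RInt (V := CR) (fun s => f (- s)) 0 b)).
  { apply (RInt_correct (V := CR)), (ex_RInt_continuous (V := CR)). intros x _.
    apply (continuous_comp (fun s => - s) f); [|apply Hf].
    continuous_derive. }
  assert (I3 : is_RInt (V := CV) f (- b) 0 (RInt (V := CR) (fun s => f (- s)) 0 b)).
  { apply is_RInt_reflect. now rewrite Ropp_involutive. }
  assert (I4 := is_RInt_Chasles (V := CV) _ _ _ _ _ _ I3 I1).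
  apply (is_RInt_unique (V := CR)) in I4. apply (is_RInt_unique (V := CR)) in Hy.
  rewrite <- Hy, I4. rewrite plus_comm. exact (is_RInt_plus _ _ _ _ _ _ I1 I2).
Qed.

(** Since cosh is even, folding the symmetric interval [-b, b] at 0 adds e^(nu t) and e^(-nu t); the
    factor 1/2 is the one in [Ccosh]. *)
Lemma BesselK_mellin (nu : C) (z : R) (l : C) : is_mellin nu (fun s => exp (- z * cosh s)) l ->
  BesselK nu z = Cmult (RtoC (/ 2)) l.
Proof.
  intro H. unfold BesselK. apply (is_RInt_gen_unique (V := CR)).
  intros P HP.
  assert (H' := is_RInt_gen_Cmult _ _ _ (RtoC (/ 2)) _ H).
  destruct (H' P HP) as [Q1 Q2 [M1 HQ1] [M2 HQ2] HQ].
  exists (fun a => a = 0) (fun b => Rmax M2 (- M1) < b).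
  - reflexivity.
  - now exists (Rmax M2 (- M1)).
  - intros a b -> Hb. generalize (Rmax_l M2 (- M1)) (Rmax_r M2 (- M1)); intros Hb1 Hb2.
    destruct (HQ (- b) b) as [y [Hy HPy]]; [apply HQ1; lra|apply HQ2; lra|].
    exists y. split; trivial. cbn [fst snd] in *.
    apply is_RInt_fold in Hy.
    + eapply is_RInt_ext; [|exact Hy]. intros t _. cbv beta.
      replace (cosh (- t)) with (cosh t) by (unfold cosh; rewrite Ropp_involutive; field).
      unfold Ccosh. rewrite RtoC_opp.
      replace (Cmult nu (Copp (RtoC t))) with (Copp (Cmult nu (RtoC t))) by ring. ring_C.
    + intro s.
      apply (continuous_scal_r (K := C_AbsRing) (V := C_NormedModule) (RtoC (/ 2)) (fun s => Cmult (Cexp (Cmult nu (RtoC s))) (RtoC (exp (- z * cosh s))))).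
      apply continuous_mellin. continuous_derive.
Qed.

(** The exponent e^s + B e^(-s) is smallest at s = ln B / 2. Translating by this amount makes it 2
    sqrt B cosh s, and the translation produces the power B^(nu/2). *)
Lemma mellin_Bessel (nu : C) (B : R) : 0 < Re nu -> 0 < B ->
  is_mellin nu (fun s => exp (- exp s) * exp (- (B * exp (- s))))
   (Cmult (RtoC 2) (Cmult (Cpow_pos B (Cdiv nu (RtoC 2))) (BesselK nu (2 * sqrt B)))).
Proof.
  intros Hnu HB. destruct (exp_exp_decay (Re nu) Hnu) as [K [HK HKb]].
  destruct (mellin_exists nu (fun s => exp (- exp s) * exp (- (B * exp (- s)))) K (Re nu) Hnu HK) as [l [Hl _]].
  { intro s. continuous_derive. }
  { intro s. rewrite Rabs_pos_eq by (apply Rmult_le_pos; apply Rlt_le, exp_pos).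
    eapply Rle_trans; [|apply HKb]. rewrite <- Rmult_assoc. rewrite <- (Rmult_1_r (_ * exp (- exp s))) at 2.
    apply Rmult_le_compat_l; [apply Rmult_le_pos; apply Rlt_le, exp_pos|].
    rewrite <- exp_0. apply exp_nondecreasing. generalize (exp_pos (- s)); nra. }
  assert (Hv : exp (ln B / 2) = sqrt B).
  { symmetry. apply sqrt_lem_1; [lra|apply Rlt_le, exp_pos|]. rewrite <- exp_plus.
    replace (ln B / 2 + ln B / 2) with (ln B) by field. now apply exp_ln. }
  assert (Hsq : sqrt B * sqrt B = B) by (apply sqrt_sqrt; lra).
  assert (Hs0 : 0 < sqrt B) by now apply sqrt_lt_R0.
  assert (Hs := mellin_shift nu _ (ln B / 2) _ Hl).
  assert (Hs' : is_mellin nu (fun s => exp (- (2 * sqrt B) * cosh s)) (Cmult (Cexp (Copp (Cmult nu (RtoC (ln B / 2))))) l)).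
  { eapply mellin_ext; [|exact Hs]. intro s. cbv beta. do 2 f_equal.
    rewrite <- exp_plus. f_equal. unfold cosh.
    replace (- (s + ln B / 2)) with (- s + - (ln B / 2)) by ring.
    rewrite !exp_plus, (exp_Ropp (ln B / 2)), Hv. rewrite <- Hsq at 2. field. lra. }
  rewrite (BesselK_mellin _ _ _ Hs'), Cexp_opp.
  replace (Cpow_pos B (Cdiv nu (RtoC 2))) with (Cexp (Cmult nu (RtoC (ln B / 2)))).
  - assert (N := Cexp_neq_0 (Cmult nu (RtoC (ln B / 2)))). set (E := Cexp _) in *.
    match goal with |- is_mellin _ _ ?r => replace r with l; [exact Hl|] end.
    rewrite RtoC_inv by lra. field; trivial.
  - unfold Cpow_pos. f_equal. unfold Rdiv, Cdiv. rewrite RtoC_mult, RtoC_inv by lra. ring.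
Qed.

(** * The theorem *)

Definition Ccv (u : nat -> C) (l : C) : Prop := is_lim_seq (fun n => Cmod (Cminus (u n) l)) 0.

Lemma Ccv_filterlim (u : nat -> C) (l : C) : Ccv u l -> filterlim u eventually (locally l).
Proof.
  intro H. apply (filterlim_locally_ball_norm (K := C_AbsRing) (U := C_NormedModule)). intro eps.
  apply is_lim_seq_spec in H. destruct (H eps) as [N HN]. exists N. intros n Hn.
  specialize (HN n Hn). rewrite Rminus_0_r, Rabs_pos_eq in HN by apply Cmod_ge_0. exact HN.
Qed.

Lemma Ccv_scal (u : nat -> C) (l z : C) : Ccv u l -> Ccv (fun n => Cmult z (u n)) (Cmult z l).
Proof.
  intro H. unfold Ccv. apply (is_lim_seq_ext (fun n => Cmod z * Cmod (Cminus (u n) l))).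
  - intro n. rewrite <- Cmod_mult. f_equal. ring.
  - now apply is_lim_seq_scal_0.
Qed.

Lemma Ccv_squeeze (u : nat -> C) (l : C) (e : nat -> R) :
  (forall n, Cmod (Cminus (u n) l) <= e n) -> is_lim_seq e 0 -> Ccv u l.
Proof.
  intros H He. apply (is_lim_seq_squeeze _ e); trivial.
  intro n. rewrite Rminus_0_r, Rabs_pos_eq by apply Cmod_ge_0. apply H.
Qed.

Lemma Ccv_const (l : C) : Ccv (fun _ => l) l.
Proof.
  apply (Ccv_squeeze _ _ (fun _ => 0)); [|apply is_lim_seq_const].
  intros _. replace (Cminus l l) with (RtoC 0) by ring. rewrite Cmod_0. lra.
Qed.

Lemma Ccv_plus (u v : nat -> C) (l m : C) : Ccv u l -> Ccv v m -> Ccv (fun n => Cplus (u n) (v n)) (Cplus l m).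
Proof.
  intros H H'. apply (Ccv_squeeze _ _ (fun n => Cmod (Cminus (u n) l) + Cmod (Cminus (v n) m))).
  - intro n. eapply Rle_trans; [|apply Cmod_triangle]. apply Req_le. f_equal. ring.
  - replace (Finite 0) with (Finite (0 + 0)) by (f_equal; ring). now apply is_lim_seq_plus'.
Qed.

Lemma sum_n_C_scal (z : C) (u : nat -> C) (N : nat) : sum_n (fun n => Cmult z (u n)) N = Cmult z (sum_n u N) :> C.
Proof.
  induction N as [|N IH]; [now rewrite !sum_O|]. rewrite !sum_Sn, IH.
  change plus with Cplus. ring_C.
Qed.

Lemma fst_sum_n (u : nat -> C) (N : nat) : fst (sum_n u N : C) = sum_n (fun n => fst (u n)) N.
Proof.
  induction N as [|N IH]; [now rewrite !sum_O|]. rewrite !sum_Sn, <- IH. reflexivity.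
Qed.

Lemma snd_sum_n (u : nat -> C) (N : nat) : snd (sum_n u N : C) = sum_n (fun n => snd (u n)) N.
Proof.
  induction N as [|N IH]; [now rewrite !sum_O|]. rewrite !sum_Sn, <- IH. reflexivity.
Qed.

Lemma double_sum_C (p q : nat -> R) (A : R) (T : nat -> nat -> C) : 0 <= A ->
  (forall n, 0 <= p n) -> (forall n, 0 <= q n) -> ex_series p -> ex_series q ->
  (forall m n, Cmod (T m n) <= A * (p m * q n)) ->
  exists D, is_double_sum T D /\ Ccv (fun N => sum_n (fun m => sum_n (fun n => T m n) N) N) D.
Proof.
  intros HA Hp Hq [P HP] [Q HQ] HT.
  assert (Hc : forall (z : C), Rabs (fst z) <= Cmod z /\ Rabs (snd z) <= Cmod z).
  { intro z. generalize (Rmax_Cmod z) (Rmax_l (Rabs (fst z)) (Rabs (snd z))) (Rmax_r (Rabs (fst z)) (Rabs (snd z))). lra. }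
  destruct (double_series p q P Q Hp Hq HP HQ (fun m n => fst (T m n)) A HA) as [S1 [_ [_ H1]]].
  { intros m n. eapply Rle_trans; [apply Hc|apply HT]. }
  destruct (double_series p q P Q Hp Hq HP HQ (fun m n => snd (T m n)) A HA) as [S2 [_ [_ H2]]].
  { intros m n. eapply Rle_trans; [apply Hc|apply HT]. }
  assert (L : Ccv (fun N => sum_n (fun m => sum_n (fun n => T m n) N) N) (S1, S2)).
  { apply (Ccv_squeeze _ _ (fun N => 2 * (A * double_eps p q P Q N))).
    - intro N. set (z := Cminus _ _).
      assert (Hz : Cmod z <= Rabs (fst z) + Rabs (snd z)).
      { replace z with (Cplus (RtoC (fst z)) (Cmult Ci (RtoC (snd z)))) at 1.
        - eapply Rle_trans; [apply Cmod_triangle|]. rewrite Cmod_mult, !Cmod_R.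
          replace (Cmod Ci) with 1; [lra|]. unfold Cmod, Ci; simpl. replace (0 * (0 * 1) + 1 * (1 * 1)) with 1 by ring. now rewrite sqrt_1.
        - destruct z as [za zb]. unfold Cplus, Cmult, RtoC, Ci; simpl. f_equal; ring. }
      specialize (H1 N). specialize (H2 N).
      assert (E1 : fst z = sum_n (fun m => sum_n (fun n => fst (T m n)) N) N - S1).
      { unfold z. cbn [Cminus Cplus Copp fst snd]. rewrite fst_sum_n. unfold Rminus. f_equal.
        apply sum_n_ext; intro m. apply fst_sum_n. }
      assert (E2 : snd z = sum_n (fun m => sum_n (fun n => snd (T m n)) N) N - S2).
      { unfold z. cbn [Cminus Cplus Copp fst snd]. rewrite snd_sum_n. unfold Rminus. f_equal.
        apply sum_n_ext; intro m. apply snd_sum_n. }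
      rewrite E1, E2 in Hz. lra.
    - apply is_lim_seq_scal_0, is_lim_seq_scal_0. now apply double_eps_lim. }
  exists (S1, S2). split; trivial. split; [|now apply Ccv_filterlim].
  assert (HP0 : 0 <= P).
  { apply Rle_trans with (sum_n p 0); [rewrite sum_O_R; apply Hp|now apply is_series_partial_le]. }
  assert (HQ0 : 0 <= Q).
  { apply Rle_trans with (sum_n q 0); [rewrite sum_O_R; apply Hq|now apply is_series_partial_le]. }
  exists (A * Q * P). intro N.
  apply Rle_trans with (sum_n (fun m => A * Q * p m) N).
  - apply sum_n_le_R. intros m _. apply Rle_trans with (sum_n (fun n => A * p m * q n) N).
    + apply sum_n_le_R. intros n _. eapply Rle_trans; [apply HT|]. apply Req_le; ring.
    + rewrite sum_n_mult_l_R. replace (A * Q * p m) with (A * p m * Q) by ring.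
      apply Rmult_le_compat_l; [now apply Rmult_le_pos|now apply is_series_partial_le].
  - rewrite sum_n_mult_l_R. apply Rmult_le_compat_l; [now apply Rmult_le_pos|now apply is_series_partial_le].
Qed.

Lemma Cmod_Cpow_pos (r : R) (z : C) : Cmod (Cpow_pos r z) = Rpower r (Re z).
Proof.
  unfold Cpow_pos. rewrite Cmod_Cexp. unfold Rpower. f_equal.
  destruct z. unfold Cmult, RtoC, Re; simpl. ring.
Qed.

Definition lattice_kernel (k : nat) (e : C) (c u v : R) : C :=
  Cdiv (RtoC (u ^ k)) (Cpow_pos (c * (u * v) + 1) e).

Definition lattice_kernel_term (k : nat) (e : C) (c th psi : R) (m n : nat) : C :=
  Cminus (Cplus (lattice_kernel k e c (INR n + psi) (INR m + th))
             (lattice_kernel k e c (INR n + 1 - psi) (INR m + th)))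
      (Cplus (lattice_kernel k e c (INR n + 1 - psi) (INR m + 1 - th))
             (lattice_kernel k e c (INR n + psi) (INR m + 1 - th))).

Lemma Cpow_pos_neq_0 (r : R) (z : C) : Cpow_pos r z <> RtoC 0.
Proof. apply Cexp_neq_0. Qed.

(** Dropping the summand 1 in the base leaves pure powers of u and v, with the exponents of
    [lattice_exp_bound] at d = Re nu. *)
Lemma lattice_kernel_bound (k : nat) (nu : C) (c u v : R) : 0 < Re nu -> 0 < c -> 0 < u -> 0 < v ->
  Cmod (lattice_kernel k (Cplus nu (RtoC (INR k + 1))) c u v) <=
   Rpower c (- (INR k + 1 + Re nu)) * (Rpower v (- (1 + (INR k + Re nu))) * Rpower u (- (1 + Re nu))).
Proof.
  intros Hnu Hc Hu Hv. assert (Hk := pos_INR k). unfold lattice_kernel.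
  rewrite Cmod_div by apply Cpow_pos_neq_0. rewrite Cmod_R, Cmod_Cpow_pos, Rabs_pos_eq by (apply pow_le; lra).
  replace (Re (Cplus nu (RtoC (INR k + 1)))) with (INR k + 1 + Re nu)
    by (destruct nu; unfold Cplus, RtoC, Re; simpl; ring).
  set (s := INR k + 1 + Re nu). assert (Hs : 0 < s) by (unfold s; lra).
  assert (Huv : 0 < u * v) by now apply Rmult_lt_0_compat.
  assert (Hcuv : 0 < c * (u * v)) by now apply Rmult_lt_0_compat.
  unfold Rdiv. rewrite <- Rpower_Ropp.
  apply Rle_trans with (u ^ k * Rpower (c * (u * v)) (- s)).
  - apply Rmult_le_compat_l; [apply pow_le; lra|]. apply Rpower_le_neg; lra.
  - rewrite <- !Rpower_mult_distr; trivial. apply Req_le.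
    replace (Rpower u (- (1 + Re nu))) with (u ^ k * Rpower u (- s)).
    + replace (- (1 + (INR k + Re nu))) with (- s) by (unfold s; ring). ring.
    + rewrite <- Rpower_pow, <- Rpower_plus by trivial. f_equal. unfold s; ring.
Qed.

Lemma lattice_kernel_double_sum (k : nat) (nu : C) (c th psi : R) : 0 < Re nu -> 0 < c -> 0 < th < 1 -> 0 < psi < 1 ->
  let T := lattice_kernel_term k (Cplus nu (RtoC (INR k + 1))) c th psi in
  exists D, is_double_sum T D /\ Ccv (fun N => sum_n (fun m => sum_n (fun n => T m n) N) N) D.
Proof.
  intros Hnu Hc Hth Hpsi T. assert (Hk := pos_INR k).
  apply (double_sum_C
    (fun m => Rpower (INR m + th) (- (1 + (INR k + Re nu))) + Rpower (INR m + 1 - th) (- (1 + (INR k + Re nu))))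
    (fun n => Rpower (INR n + psi) (- (1 + Re nu)) + Rpower (INR n + 1 - psi) (- (1 + Re nu)))
    (Rpower c (- (INR k + 1 + Re nu)))).
  - apply Rlt_le, exp_pos.
  - intro; apply Rlt_le, Rplus_lt_0_compat; apply exp_pos.
  - intro; apply Rlt_le, Rplus_lt_0_compat; apply exp_pos.
  - apply ex_series_Rpower_refl; lra.
  - apply ex_series_Rpower_refl; lra.
  - intros m n. assert (H1 := pos_INR m). assert (H2 := pos_INR n).
    assert (B1 := lattice_kernel_bound k nu c (INR n + psi) (INR m + th) Hnu Hc ltac:(lra) ltac:(lra)).
    assert (B2 := lattice_kernel_bound k nu c (INR n + 1 - psi) (INR m + th) Hnu Hc ltac:(lra) ltac:(lra)).
    assert (B3 := lattice_kernel_bound k nu c (INR n + 1 - psi) (INR m + 1 - th) Hnu Hc ltac:(lra) ltac:(lra)).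
    assert (B4 := lattice_kernel_bound k nu c (INR n + psi) (INR m + 1 - th) Hnu Hc ltac:(lra) ltac:(lra)).
    unfold T, lattice_kernel_term, Cminus.
    eapply Rle_trans; [apply Cmod_triangle|]. rewrite Cmod_opp.
    eapply Rle_trans; [apply Rplus_le_compat; apply Cmod_triangle|].
    rewrite !Rmult_plus_distr_l, !Rmult_plus_distr_r, !Rmult_plus_distr_l. lra.
Qed.

(** A scaled Gamma integral: exp (- e^s) supplies the summand 1 in the base c u v + 1, and the
    weight e^((k+1) s), which stems from w^(k+1), raises nu to nu + k + 1. *)
Lemma mellin_lattice_exp (k : nat) (nu : C) (c u v : R) : 0 < Re nu -> 0 < c -> 0 < u -> 0 < v ->
  is_mellin nu (fun s => exp ((INR k + 1) * s) * (exp (- exp s) * lattice_exp k (c * exp s) u v))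
   (Cmult (CGamma (Cplus nu (RtoC (INR k + 1)))) (lattice_kernel k (Cplus nu (RtoC (INR k + 1))) c u v)).
Proof.
  intros Hnu Hc Hu Hv. assert (Hk := pos_INR k). apply mellin_weight. set (e := Cplus nu (RtoC (INR k + 1))).
  assert (He : 0 < Re e) by (unfold e; destruct nu; unfold Cplus, RtoC, Re in *; simpl in *; lra).
  assert (Hr : 0 < c * (u * v) + 1) by (assert (0 < c * (u * v)) by (repeat apply Rmult_lt_0_compat; trivial); lra).
  assert (H := mellin_scal _ _ _ (u ^ k) (mellin_Gamma_scaled e _ He Hr)).
  replace (Cmult (CGamma e) (lattice_kernel k e c u v)) with (Cmult (RtoC (u ^ k)) (Cdiv (CGamma e) (Cpow_pos (c * (u * v) + 1) e)))
    by (unfold lattice_kernel, Cdiv; ring).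
  eapply mellin_ext; [|exact H]. intro s. cbv beta. do 2 f_equal. unfold lattice_exp.
  replace (- ((c * (u * v) + 1) * exp s)) with (- exp s + - (c * exp s) * (u * v)) by ring.
  rewrite exp_plus. ring.
Qed.

Lemma mellin_lattice_sum (k : nat) (nu : C) (c th psi : R) (N : nat) : 0 < Re nu -> 0 < c -> 0 < th < 1 -> 0 < psi < 1 ->
  is_mellin nu (fun s => exp ((INR k + 1) * s) * (exp (- exp s) * lattice_sum k (c * exp s) th psi N))
   (Cmult (CGamma (Cplus nu (RtoC (INR k + 1))))
     (sum_n (fun m => sum_n (fun n => lattice_kernel_term k (Cplus nu (RtoC (INR k + 1))) c th psi m n) N) N)).
Proof.
  intros Hnu Hc Hth Hpsi. rewrite <- sum_n_C_scal.
  assert (H : is_mellin nu (fun s => sum_n (fun m => sum_n (fun n =>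
       exp ((INR k + 1) * s) * (exp (- exp s) * lattice_term k (c * exp s) th psi m n)) N) N)
    (sum_n (fun m => sum_n (fun n => Cmult (CGamma (Cplus nu (RtoC (INR k + 1)))) (lattice_kernel_term k (Cplus nu (RtoC (INR k + 1))) c th psi m n)) N) N)).
  { apply (mellin_sum nu (fun m s => sum_n (fun n => exp ((INR k + 1) * s) * (exp (- exp s) * lattice_term k (c * exp s) th psi m n)) N)).
    intro m. apply (mellin_sum nu (fun n s => exp ((INR k + 1) * s) * (exp (- exp s) * lattice_term k (c * exp s) th psi m n))).
    intro n. assert (H1 := pos_INR m). assert (H2 := pos_INR n).
    assert (B1 := mellin_lattice_exp k nu c (INR n + psi) (INR m + th) Hnu Hc ltac:(lra) ltac:(lra)).
    assert (B2 := mellin_lattice_exp k nu c (INR n + 1 - psi) (INR m + th) Hnu Hc ltac:(lra) ltac:(lra)).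
    assert (B3 := mellin_lattice_exp k nu c (INR n + 1 - psi) (INR m + 1 - th) Hnu Hc ltac:(lra) ltac:(lra)).
    assert (B4 := mellin_lattice_exp k nu c (INR n + psi) (INR m + 1 - th) Hnu Hc ltac:(lra) ltac:(lra)).
    assert (B := mellin_plus _ _ _ _ _ (mellin_plus _ _ _ _ _ B1 B2) (mellin_scal _ _ _ (-1) (mellin_plus _ _ _ _ _ B3 B4))).
    match type of B with is_mellin _ _ ?l => match goal with |- is_mellin _ _ ?l' => replace l' with l end end.
    - eapply mellin_ext; [|exact B]. intro s. cbv beta. do 2 f_equal. unfold lattice_term. ring.
    - unfold lattice_kernel_term.
      replace (RtoC (-1)) with (Copp (RtoC 1)) by (unfold RtoC, Copp; simpl; f_equal; ring). ring. }
  match type of H with is_mellin _ _ ?l => match goal with |- is_mellin _ _ ?l' => replace l' with l end end.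
  - eapply mellin_ext; [|exact H]. intro s. cbv beta. do 2 f_equal. unfold lattice_sum.
    rewrite <- !sum_n_mult_l_R. apply sum_n_ext. intro m. rewrite <- !sum_n_mult_l_R. reflexivity.
  - apply sum_n_ext. intro m. apply sum_n_C_scal.
Qed.

Definition bessel_value (nu : C) (A : R) (n : nat) : C :=
  Cmult (RtoC 2) (Cmult (Cpow_pos (A * INR n) (Cdiv nu (RtoC 2))) (BesselK nu (2 * sqrt (A * INR n)))).

Lemma mellin_lambert_sum (k : nat) (nu : C) (A th psi : R) (N : nat) : 0 < Re nu -> 0 < A ->
  is_mellin nu (fun s => exp (- exp s) * lambert_sum k th psi (A * exp (- s)) N)
   (sum_n (fun n => Cmult (RtoC (div_coef k th psi (S n))) (bessel_value nu A (S n))) N).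
Proof.
  intros Hnu HA.
  assert (H : is_mellin nu (fun s => sum_n (fun n => div_coef k th psi (S n) * (exp (- exp s) * exp (- (A * INR (S n) * exp (- s))))) N)
    (sum_n (fun n => Cmult (RtoC (div_coef k th psi (S n))) (bessel_value nu A (S n))) N)).
  { apply (mellin_sum nu (fun n s => div_coef k th psi (S n) * (exp (- exp s) * exp (- (A * INR (S n) * exp (- s)))))).
    intro n. apply mellin_scal. apply mellin_Bessel; trivial.
    apply Rmult_lt_0_compat; trivial. apply lt_0_INR; lia. }
  eapply mellin_ext; [|exact H]. intro s. cbv beta. do 2 f_equal. unfold lambert_sum.
  rewrite <- sum_n_mult_l_R. apply sum_n_ext. intro n.
  replace (- (A * exp (- s)) * INR (S n)) with (- (A * INR (S n) * exp (- s))) by ring. ring_R.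
Qed.

Lemma continuous_lambert_sum (k : nat) (A th psi : R) (N : nat) (s : R) :
  continuous (fun s => lambert_sum k th psi (A * exp (- s)) N) s.
Proof.
  apply (continuous_sum_n (fun n s => div_coef k th psi (S n) * exp (- (A * exp (- s)) * INR (S n)))).
  intro n. continuous_derive.
Qed.

Lemma continuous_lattice_sum (k : nat) (c th psi : R) (N : nat) (s : R) :
  continuous (fun s => lattice_sum k (c * exp s) th psi N) s.
Proof.
  apply (continuous_sum_n (fun m s => sum_n (fun n => lattice_term k (c * exp s) th psi m n) N)).
  intro m. apply (continuous_sum_n (fun n s => lattice_term k (c * exp s) th psi m n)). intro n.
  unfold lattice_term, lattice_exp. continuous_derive.
Qed.

(** The Mellin transform of the partial-sum estimate. X and Y are the transforms of the truncated
    Lambert and lattice sides; their difference is the transform of a function bounded by eps N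
    times a fixed weight, and Y converges because the lattice sum does. *)
Lemma bessel_sum_lim (j : nat) (nu : C) (A th psi : R) (D : C) : 0 < Re nu -> 0 < A -> 0 < th < 1 -> 0 < psi < 1 ->
  let k := (2 * j)%nat in
  let e := Cplus nu (RtoC (INR k + 1)) in
  Ccv (fun N => sum_n (fun m => sum_n (fun n => lattice_kernel_term k e (4 * PI ^ 2 / A) th psi m n) N) N) D ->
  Ccv (fun N => sum_n (fun n => Cmult (RtoC (div_coef k th psi (S n))) (bessel_value nu A (S n))) N)
   (Cplus (Cmult (RtoC ((-1) ^ j * ((2 * PI / A) ^ S k / 4))) (Cmult (CGamma e) D))
     (Cmult (RtoC (- ((-1) ^ j * (INR (fact k) * zeta_diff k th / (2 * (2 * PI) ^ S k))))) (CGamma nu))).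
Proof.
  intros Hnu HA Hth Hpsi k e HD. assert (HPI := PI_RGT_0).
  (* With y = A e^(-s) and w = 4 pi^2 / y, this is the constant for which w = c e^s. *)
  set (c := 4 * PI ^ 2 / A) in *.
  assert (Hc : 0 < c) by (apply Rdiv_lt_0_compat; trivial; generalize (pow_lt PI 2 HPI); lra).
  set (U := fun N => sum_n (fun m => sum_n (fun n => lattice_kernel_term k e c th psi m n) N) N) in *.
  set (X := fun N => sum_n (fun n => Cmult (RtoC (div_coef k th psi (S n))) (bessel_value nu A (S n))) N).
  set (c1 := (-1) ^ j * ((2 * PI / A) ^ S k / 4)).
  set (c2 := - ((-1) ^ j * (INR (fact k) * zeta_diff k th / (2 * (2 * PI) ^ S k)))).
  set (Y := fun N => Cplus (Cmult (RtoC c1) (Cmult (CGamma e) (U N))) (Cmult (RtoC c2) (CGamma nu))).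
  assert (HY : Ccv Y (Cplus (Cmult (RtoC c1) (Cmult (CGamma e) D)) (Cmult (RtoC c2) (CGamma nu)))).
  { apply Ccv_plus; [|apply Ccv_const]. apply Ccv_scal, Ccv_scal, HD. }
  (* The lattice error carries w^(-d), hence e^(-d s). Half of Re nu compensates it as s tends to
     minus infinity, and the other half remains as the decay e^(-d |s|). *)
  set (d := Re nu / 2). assert (Hd : 0 < d) by (unfold d; lra).
  destruct (lambert_lattice_estimate j th psi d Hd Hth Hpsi) as [eps [Heps Hcore]]. fold k in Hcore.
  assert (Hk := pos_INR k).
  (* The Lambert error carries y^(-(k+3)), a multiple of e^((k+3) s), which joins e^(Re nu s). *)
  destruct (exp_exp_decay (Re nu + (INR k + 3)) ltac:(lra)) as [K1 [HK1 HK1b]].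
  destruct (exp_exp_decay d Hd) as [K2 [HK2 HK2b]].
  set (K := Rpower A (- (INR k + 3)) * K1 + Rpower c (- d) * K2).
  assert (HA1 : 0 < Rpower A (- (INR k + 3))) by apply exp_pos.
  assert (HA2 : 0 < Rpower c (- d)) by apply exp_pos.
  assert (HK : 0 <= K) by (unfold K; apply Rplus_le_le_0_compat; apply Rmult_le_pos; lra).
  assert (HXY : forall N, Cmod (Cminus (X N) (Y N)) <= (2 * K / d) * eps N).
  { intro N.
    assert (HX := mellin_lambert_sum k nu A th psi N Hnu HA). fold (X N) in HX.
    assert (HL := mellin_lattice_sum k nu c th psi N Hnu Hc Hth Hpsi).
    assert (HB := mellin_plus _ _ _ _ _ HX (mellin_scal _ _ _ (-1) (mellin_plus _ _ _ _ _ (mellin_scal _ _ _ c1 HL)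
       (mellin_scal _ _ _ c2 (CGamma_mellin nu Hnu))))).
    match type of HB with is_mellin _ ?f ?l => set (h := f) in HB; assert (El : l = Cminus (X N) (Y N)) end.
    { unfold Y. fold e. fold (U N).
      replace (RtoC (-1)) with (Copp (RtoC 1)) by (unfold RtoC, Copp; simpl; f_equal; ring). ring. }
    rewrite El in HB.
    assert (Hh : forall s, h s = exp (- exp s) * (lambert_sum k th psi (4 * PI ^ 2 / (c * exp s)) N
       - (-1) ^ j * ((c * exp s / (2 * PI)) ^ S k / 4 * lattice_sum k (c * exp s) th psi N
        - INR (fact k) * zeta_diff k th / (2 * (2 * PI) ^ S k)))).
    { intro s. unfold h. assert (Es := exp_pos s).
      assert (E1 : 4 * PI ^ 2 / (c * exp s) = A * exp (- s)).
      { unfold c. rewrite exp_Ropp. field. repeat split; lra. }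
      assert (E2 : (c * exp s / (2 * PI)) ^ S k = (2 * PI / A) ^ S k * exp ((INR k + 1) * s)).
      { replace ((INR k + 1) * s) with (- (- s) * INR (S k)) by (rewrite S_INR; ring).
        rewrite exp_INR, Ropp_involutive, <- Rpow_mult_distr. f_equal. unfold c. field. lra. }
      rewrite E1, E2. unfold c1, c2. generalize ((2 * PI / A) ^ S k) ((2 * PI) ^ S k) (INR (fact k) * zeta_diff k th) ((-1) ^ j). intros.
      unfold Rdiv. ring. }
    assert (Hb : forall s, exp (Re nu * s) * Rabs (h s) <= eps N * K * exp (- d * Rabs s)).
    { intro s. assert (Es := exp_pos s). assert (Hw : 0 < c * exp s) by now apply Rmult_lt_0_compat.
      rewrite Hh, Rabs_mult, (Rabs_pos_eq (exp _)) by (apply Rlt_le, exp_pos).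
      assert (HC := Hcore (c * exp s) N Hw).
      set (Q := Rabs _) in *.
      assert (P1 := exp_pos (Re nu * s)). assert (P2 := exp_pos (- exp s)).
      assert (E1 : 4 * PI ^ 2 / (c * exp s) = A * exp (- s)).
      { unfold c. rewrite exp_Ropp. field. repeat split; lra. }
      rewrite E1 in HC.
      rewrite <- !Rpower_mult_distr in HC; trivial; try apply exp_pos.
      assert (E2 : Rpower (exp (- s)) (- (INR k + 3)) = exp ((INR k + 3) * s)).
      { unfold Rpower. rewrite ln_exp. f_equal. ring. }
      assert (E3 : Rpower (exp s) (- d) = exp (- d * s)).
      { unfold Rpower. now rewrite ln_exp. }
      rewrite E2, E3 in HC.
      assert (Q0 : 0 <= Q) by apply Rabs_pos.
      assert (P3 := exp_pos ((INR k + 3) * s)). assert (P4 := exp_pos (- d * s)).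
      (* The sign of eps is not part of the estimate, but eps N times a positive weight dominates an
         absolute value. *)
      assert (Heps0 : 0 <= eps N).
      { apply Rnot_lt_le. intro Hlt.
        assert (0 < Rpower A (- (INR k + 3)) * exp ((INR k + 3) * s) + Rpower c (- d) * exp (- d * s)).
        { apply Rplus_lt_0_compat; now apply Rmult_lt_0_compat. }
        nra. }
      apply Rle_trans with (exp (Re nu * s) * (exp (- exp s) * (eps N * (Rpower A (- (INR k + 3)) * exp ((INR k + 3) * s) + Rpower c (- d) * exp (- d * s))))).
      { apply Rmult_le_compat_l; [lra|]. apply Rmult_le_compat_l; [lra|exact HC]. }
      assert (B1 := HK1b s). assert (B2 := HK2b s).
      rewrite Rmult_plus_distr_r, exp_plus in B1.
      replace (d * s) with (Re nu * s + - d * s) in B2 by (unfold d; field). rewrite exp_plus in B2.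
      assert (B3 : exp (- (Re nu + (INR k + 3)) * Rabs s) <= exp (- d * Rabs s)).
      { apply exp_nondecreasing. generalize (Rabs_pos s). unfold d. nra. }
      set (E := exp (- d * Rabs s)) in *. assert (PE : 0 < E) by apply exp_pos.
      assert (B4 : exp (Re nu * s) * exp ((INR k + 3) * s) * exp (- exp s) <= K1 * E).
      { eapply Rle_trans; [exact B1|]. now apply Rmult_le_compat_l. }
      apply Rle_trans with (eps N * (Rpower A (- (INR k + 3)) * (K1 * E) + Rpower c (- d) * (K2 * E))).
      - replace (exp (Re nu * s) * (exp (- exp s) * (eps N * (Rpower A (- (INR k + 3)) * exp ((INR k + 3) * s) + Rpower c (- d) * exp (- d * s)))))
        with (eps N * (Rpower A (- (INR k + 3)) * (exp (Re nu * s) * exp ((INR k + 3) * s) * exp (- exp s))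
           + Rpower c (- d) * (exp (Re nu * s) * exp (- d * s) * exp (- exp s)))) by ring.
        apply Rmult_le_compat_l; trivial.
        apply Rplus_le_compat; apply Rmult_le_compat_l; lra.
      - apply Req_le. unfold K. ring. }
    assert (HepsK : 0 <= eps N * K).
    { assert (H0 := Hb 0). rewrite Rmult_0_r, Rabs_R0, Rmult_0_r, exp_0, Rmult_1_r, Rmult_1_l in H0.
      eapply Rle_trans; [apply Rabs_pos|exact H0]. }
    destruct (mellin_exists nu h (eps N * K) d Hd HepsK) as [l [Hl Hlb]]; trivial.
    - intro s. unfold h. apply continuous_Rplus.
      + apply continuous_Rmult; [apply continuous_exp_exp|apply continuous_lambert_sum].
      + apply continuous_Rmult; [apply continuous_const|]. apply continuous_Rplus.
        * apply continuous_Rmult; [apply continuous_const|]. apply continuous_Rmult.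
          -- continuous_derive.
          -- apply continuous_Rmult; [apply continuous_exp_exp|apply continuous_lattice_sum].
        * apply continuous_Rmult; [apply continuous_const|apply continuous_exp_exp].
    (* The transform of h is X N - Y N by linearity, and it is also the integral l, whose modulus is
       bounded. *)
    - rewrite (mellin_unique _ _ _ _ HB Hl). eapply Rle_trans; [exact Hlb|]. apply Req_le. field. lra. }
  apply (Ccv_squeeze _ _ (fun N => (2 * K / d) * eps N + Cmod (Cminus (Y N) (Cplus (Cmult (RtoC c1) (Cmult (CGamma e) D)) (Cmult (RtoC c2) (CGamma nu)))))).
  - intro N. fold (X N). set (y := Cplus (Cmult (RtoC c1) _) _).
    replace (Cminus (X N) y) with (Cplus (Cminus (X N) (Y N)) (Cminus (Y N) y)) by ring.
    eapply Rle_trans; [apply Cmod_triangle|]. generalize (HXY N). lra.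
  - replace (Finite 0) with (Finite (0 + 0)) by (f_equal; ring).
    apply is_lim_seq_plus'; [now apply is_lim_seq_scal_0|exact HY].
Qed.

Lemma Cpow_pos_mult (r r' : R) (z : C) : 0 < r -> 0 < r' ->
  Cpow_pos (r * r') z = Cmult (Cpow_pos r z) (Cpow_pos r' z).
Proof.
  intros H H'. unfold Cpow_pos. rewrite ln_mult, RtoC_plus by trivial.
  rewrite <- Cexp_plus. f_equal. ring.
Qed.

Lemma Cpow_pos_plus_nat (r : R) (z : C) (n : nat) : 0 < r ->
  Cpow_pos r (Cplus z (RtoC (INR n))) = Cmult (Cpow_pos r z) (RtoC (r ^ n)).
Proof.
  intro H. unfold Cpow_pos.
  replace (Cmult (Cplus z (RtoC (INR n))) (RtoC (ln r))) with (Cplus (Cmult z (RtoC (ln r))) (RtoC (INR n * ln r)))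
    by (rewrite RtoC_mult; ring).
  rewrite Cexp_plus, Cexp_real. do 2 f_equal. exact (Rpower_pow n r H).
Qed.

Theorem theorem2p16 (a x theta psi : R) (k : nat) (nu : C)
  (ha : 0 < a) (hx : 0 < x)
  (htheta : 0 < theta < 1) (hpsi : 0 < psi < 1)
  (hk : Nat.Even k) (hnu : 0 < Re nu) :
  let c := 16 * PI ^ 2 / a ^ 2 in
  let e := Cplus nu (RtoC (INR k + 1)) in
  let F (u v : R) : C :=
    Cdiv (RtoC (u ^ k)) (Cpow_pos (c * (u * v) / x + 1) e) in
  let T (m n : nat) : C :=
    Cminus
      (Cplus (F (INR n + psi) (INR m + theta))
             (F (INR n + 1 - psi) (INR m + theta)))
      (Cplus (F (INR n + 1 - psi) (INR m + 1 - theta))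
             (F (INR n + psi) (INR m + 1 - theta))) in
  let lhs_term (n : nat) : C :=
    Cmult (Cmult (Cpow_pos (INR n) (Cdiv nu (RtoC 2)))
                 (BesselK nu (a * sqrt (INR n * x))))
          (RtoC (divisor_sum n (fun d =>
               INR d ^ k * sin (2 * PI * INR d * theta)
                 * cos (2 * PI * INR n * psi / INR d)))) in
  exists L D : C,
    is_series (fun n => lhs_term (S n)) L /\
    is_double_sum T D /\
    Cmult (Cpow_pos (a ^ 2 * x / 4) (Cplus (Cdiv nu (RtoC 2)) (RtoC (INR k + 1)))) L
    = Cplus
        (Cmult (RtoC (- ((-1) ^ (k / 2) * a ^ (2 * k + 2) * INR (fact k)
                          / (2 ^ (2 * k + 4) * (2 * PI) ^ (k + 1)))
                       * zeta_diff k theta * x ^ (k + 1)))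
               (CGamma nu))
        (Cmult (RtoC ((-1) ^ (k / 2) * (2 * PI) ^ (k + 1) / 8))
               (Cmult (CGamma e) D)).
Proof.
  intros c e F T lhs_term. assert (HPI := PI_RGT_0).
  destruct hk as [j Hj].
  assert (Ek2 : (k / 2 = j)%nat) by (rewrite Hj, Nat.mul_comm; apply Nat.div_mul; lia).
  set (A := a ^ 2 * x / 4).
  assert (HA : 0 < A) by (unfold A; generalize (pow_lt a 2 ha); intro; apply Rdiv_lt_0_compat; [now apply Rmult_lt_0_compat|lra]).
  (* This equals 16 pi^2 / (a^2 x), so the scale of the kernel is the one in the statement. *)
  set (C0 := 4 * PI ^ 2 / A).
  assert (HC0 : 0 < C0) by (apply Rdiv_lt_0_compat; trivial; generalize (pow_lt PI 2 HPI); lra).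
  assert (HF : forall u v, F u v = lattice_kernel k e C0 u v).
  { intros u v. unfold F, lattice_kernel. replace (c * (u * v) / x + 1) with (C0 * (u * v) + 1); trivial.
    unfold c, C0, A. field. split; lra. }
  destruct (lattice_kernel_double_sum k nu C0 theta psi hnu HC0 htheta hpsi) as [D [HD1 HD2]].
  fold e in HD1, HD2.
  assert (HT : T = lattice_kernel_term k e C0 theta psi).
  { unfold T, lattice_kernel_term. apply functional_extensionality. intro m.
    apply functional_extensionality. intro n. now rewrite !HF. }
  assert (HX := bessel_sum_lim j nu A theta psi D hnu HA htheta hpsi).
  cbv zeta in HX. rewrite <- Hj in HX. fold e C0 in HX. specialize (HX HD2).
  set (y := Cplus _ _) in HX.
  set (E0 := Cpow_pos A (Cdiv nu (RtoC 2))). assert (HE0 : E0 <> RtoC 0) by apply Cpow_pos_neq_0.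
  assert (H2 : RtoC 2 <> RtoC 0) by (intro HH; apply RtoC_inj in HH; lra).
  (* Each [bessel_value] is 2 A^(nu/2) times n^(nu/2) K_nu, so the limit y is divided by 2
     A^(nu/2). *)
  exists (Cmult (Cinv (Cmult (RtoC 2) E0)) y), D. split; [|split].
  - apply Ccv_filterlim.
    eapply is_lim_seq_ext; [|exact (Ccv_scal _ _ (Cinv (Cmult (RtoC 2) E0)) HX)].
    intro N. cbv beta. do 2 f_equal. rewrite <- sum_n_C_scal. apply sum_n_ext. intro n.
    unfold bessel_value, lhs_term, div_coef.
    assert (Hn : 0 < INR (S n)) by (apply lt_0_INR; lia).
    rewrite Cpow_pos_mult by trivial. fold E0.
    replace (2 * sqrt (A * INR (S n))) with (a * sqrt (INR (S n) * x)).
    + set (z1 := Cpow_pos _ _). set (z2 := BesselK _ _). set (z3 := RtoC (divisor_sum _ _)).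
      change (@eq C (Cmult (Cinv (Cmult (RtoC 2) E0)) (Cmult z3 (Cmult (RtoC 2) (Cmult (Cmult E0 z1) z2)))) (Cmult (Cmult z1 z2) z3)).
      field; repeat split; trivial.
    + symmetry. replace (A * INR (S n)) with ((a / 2) * (a / 2) * (INR (S n) * x)) by (unfold A; field).
      rewrite sqrt_mult, sqrt_square by nra. field.
  - rewrite HT. exact HD1.
  - replace (INR k + 1) with (INR (S k)) by apply S_INR.
    rewrite Cpow_pos_plus_nat by trivial. fold E0. rewrite Ek2.
    replace (Cmult (Cmult E0 (RtoC (A ^ S k))) (Cmult (Cinv (Cmult (RtoC 2) E0)) y))
      with (Cmult (RtoC (A ^ S k / 2)) y).
    2: { unfold Rdiv. rewrite RtoC_mult, RtoC_inv by lra. field; repeat split; trivial. }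
    unfold y.
    assert (HAk : A ^ S k <> 0) by (apply pow_nonzero; lra).
    assert (HPk : (2 * PI) ^ S k <> 0) by (apply pow_nonzero; lra).
    set (g1 := Cmult (CGamma e) D). set (g2 := CGamma nu).
    rewrite Cmult_plus_distr_l, !Cmult_assoc, <- !RtoC_mult, Cplus_comm.
    replace (k + 1)%nat with (S k) by lia.
    f_equal; f_equal; f_equal.
    (* Here 4^(k+1) from A^(k+1), the 2 from the division above and the 2 in the transformation
       formula make up 2^(2k+4). *)
    + replace (A ^ S k) with (a ^ (2 * k + 2) * x ^ S k / 2 ^ (2 * k + 2)).
      * replace (2 * k + 4)%nat with (2 * k + 2 + 2)%nat by lia. rewrite (pow_add 2 (2 * k + 2) 2).
        assert (H2k : 2 ^ (2 * k + 2) <> 0) by (apply pow_nonzero; lra).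
        field; repeat split; trivial.
      * unfold A, Rdiv. rewrite !Rpow_mult_distr, pow_inv, <- pow_mult.
        replace (2 * k + 2)%nat with (2 * S k)%nat by lia. rewrite (pow_mult 2). replace (2 ^ 2) with 4 by ring. reflexivity.
    (* The powers of A cancel, and 8 is 2 from the division above times 4 from the transformation
       formula. *)
    + replace ((2 * PI / A) ^ S k) with ((2 * PI) ^ S k / A ^ S k)
        by (unfold Rdiv; rewrite (Rpow_mult_distr (2 * PI)), pow_inv; reflexivity).
      field. trivial.
Qed.
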